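(* Let $\Bbbk$ be a commutative ring and $n$ a positive integer. The cobar construction $R(\Omega_n^{epi})=B^c(K(\Omega_n^{epi}))$ defines a quasi-free model of $\Omega_n^{epi}$ in the category of dg-categories: it is a quasi-free dg-category, and the augmentation $$\epsilon: B^c(K(\Omega_n^{epi}))\rightarrow\Omega_n^{epi},\qquad \epsilon\{u\}=\begin{cases}\mathrm{sgn}(u)\{u\},&\text{if }\deg u=1,\\ 0,&\text{if }\deg u>1,\end{cases}$$ is a morphism of dg-categories (identity on objects) which induces an isomorphism in homology on every hom-object.
   Context: Category of pruned trees. Write $\underline{\mathsf r}=\{1<\dots<r\}$. An object $\underline{\tau}$ of $\Omega_n^{epi}$ is a sequence of weakly increasing surjections $\underline{\mathsf t}_0\xrightarrow{\tau_1}\underline{\mathsf t}_1\xrightarrow{\tau_2}\cdots\xrightarrow{\tau_n}\underline{\mathsf t}_n=\underline{\mathsf 1}$ (a planar tree; $\underline{\mathsf t}_i$ is the ordered set of vertices of level $i$, the root is at level $n$). A morphism $u:\underline{\tau}\to\underline{\sigma}$ is a sequence of surjections $u:\underline{\mathsf t}_i\to\underline{\mathsf s}_i$, $0\le i\le n$, commuting with the maps $\tau_i,\sigma_i$, and such that $u:\underline{\mathsf t}_i\to\underline{\mathsf s}_i$ is weakly increasing on each fiber $\tau_{i+1}^{-1}(x)$, $x\in\underline{\mathsf t}_{i+1}$. Composition is levelwise. Degrees: $\deg(\underline{\tau})=t_0+\dots+t_{n-1}$, and $\deg(u)=\deg(\underline{\tau})-\deg(\underline{\sigma})$ for $u:\underline{\tau}\to\underline{\sigma}$.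 The $\Bbbk$-linear version of this category, with hom-objects the free $\Bbbk$-modules $\Omega_n^{epi}(\underline{\tau},\underline{\sigma})=\bigoplus_{u:\underline{\tau}\to\underline{\sigma}}\Bbbk\{u\}$, is viewed as a dg-category (category enriched in dg-modules) concentrated in degree $0$. Signs. A morphism $u:\underline{\tau}\to\underline{\sigma}$ of degree $1$ merges exactly two vertices $x_i,x_j$, consecutive in one fiber $\tau_{k+1}^{-1}(b)$ at some level $k<n$, and is bijective on all other vertices. Assign a symbol of degree $1$ to each vertex of level $<n$, and order the vertices of a tree by depth-first order from the root (from bottom to top, then left to right). Then $\mathrm{sgn}(u)$ is the product of two Koszul signs: the sign of the permutation of degree $1$ symbols bringing $x_i\otimes x_j$ ($x_i$ preceding $x_j$) to the front of the ordered tensor of the vertices of $\underline{\tau}$, the other symbols keeping their order; and, after replacing $x_i\otimes x_j$ by one symbol $x_{ij}$ of degree $1$, the sign of the permutation putting the resulting tensor in the depth-first order of the vertices of $\underline{\sigma}$. Koszul cocategory and its cobar construction. $K(\Omega_n^{epi})(\underline{\tau},\underline{\sigma})=\bigoplus_{u:\underline{\tau}\to\underline{\sigma}}\Bbbk\{u\}$, with $\{u\}$ in degree $\deg u$ and zero differential, is a dg-cocategory with diagonal $\Delta\{u\}=\sum_{u=vw}\{v\}\otimes\{w\}$. The cobar construction $B^c(K(\Omega_n^{epi}))$ is the dg-category with object set $\mathrm{Ob}\,\Omega_n^{epi}$ whose underlying graded category is the free $\Bbbk$-linear category on generating morphisms $\{u\}:\underline{\tau}\to\underline{\sigma}$ of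 degree $\deg(u)-1$, one for each non-identity morphism $u:\underline{\tau}\to\underline{\sigma}$ of $\Omega_n^{epi}$, with differential the unique derivation ($\partial(\alpha\beta)=\partial(\alpha)\beta+(-1)^{\deg\alpha}\alpha\,\partial(\beta)$) such that $\partial\{u\}=\sum_{u=vw}(-1)^{\deg v}\{v\}\cdot\{w\}$, the sum running over factorizations with $v,w\ne\mathrm{id}$ and $\deg v$ being the degree of $v$ in $\Omega_n^{epi}$. A dg-category is quasi-free if it is a free dg-category on a dg-graph (a collection of dg-modules indexed by pairs of objects) with a derivation added to its differential. *)

(* Defs.v *)
From HB Require Import structures.
From mathcomp Require Import all_boot all_order all_algebra all_fingroup.
From mathcomp Require Import finmap boolp classical_sets fsbigop.
From mathcomp Require Import monalg.

Set Implicit Arguments.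
Unset Strict Implicit.
Unset Printing Implicit Defensive.

Import Order.TTheory GRing.Theory Num.Theory.
Local Open Scope ring_scope.

(* The alias carries the module structure of {malg k[K]} over every ring; the
   instance of the monalg library excludes the zero ring. *)
Definition freemod (k : pzRingType) (K : choiceType) := {malg k[K]}.
HB.instance Definition _ (k : pzRingType) (K : choiceType) :=
  GRing.Zmodule.on (freemod k K).

Section FreeModule.
Variables (k : pzRingType) (K : choiceType).

Definition fscale (c : k) (x : freemod k K) : freemod k K :=
  \sum_(p <- msupp x) << c * x@_p *g p >>.

Lemma fscaleE c x p : (fscale c x)@_p = c * x@_p.
Proof.
rewrite {2}[x]monalgE !raddf_sum mulr_sumr.
by apply/eq_bigr=> /= i _; rewrite !mcoeffU mulrnAr.
Qed.

Lemma fscaleA c1 c2 x : fscale c1 (fscale c2 x) = fscale (c1 * c2) x.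
Proof. by apply/malgP=> p; rewrite !fscaleE mulrA. Qed.

Lemma fscale1 : left_id 1 fscale.
Proof. by move=> x; apply/malgP=> p; rewrite fscaleE mul1r. Qed.

Lemma fscaleDr : right_distributive fscale +%R.
Proof.
by move=> c x y; apply/malgP=> p; rewrite !(mcoeffD, fscaleE) mulrDr.
Qed.

Lemma fscaleDl x : {morph fscale^~ x : a b / a + b}.
Proof. by move=> a b; apply/malgP=> p; rewrite !(mcoeffD, fscaleE) mulrDl. Qed.

HB.instance Definition _ := GRing.Zmodule_isLmodule.Build k (freemod k K)
  fscaleA fscale1 fscaleDr fscaleDl.

Definition basis (p : K) : freemod k K := << 1 *g p >>.

Definition linext (V : lmodType k) (f : K -> V) (x : freemod k K) : V :=
  \sum_(p <- msupp x) x@_p *: f p.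

End FreeModule.

Arguments basis {k K}.

Definition isign (k : pzRingType) (i : int) : k := (-1) ^+ absz i.

Section DG.
Variable k : comPzRingType.

(* Dg-modules are Z-graded, by an internal splitting into homogeneous
   submodules, and differentials lower the degree by 1. *)
Record dgmod_data := DgModData {
  dg_car :> lmodType k;
  dg_homog : int -> dg_car -> Prop;
  dg_d : dg_car -> dg_car }.

Definition is_linear (U V : lmodType k) (f : U -> V) : Prop :=
  forall a x y, f (a *: x + y) = a *: f x + f y.

Record is_dgmod (V : dgmod_data) : Prop := IsDgMod {
  homog0 : forall i, dg_homog i (0 : V);
  homog_lin : forall i a (x y : V),
    dg_homog i x -> dg_homog i y -> dg_homog i (a *: x + y);
  homog_span : forall x : V, exists (s : seq int) (c : int -> V),
    (forall i, dg_homog i (c i)) /\ x = \sum_(i <- s) c i;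
  homog_indep : forall (s : seq int) (c : int -> V),
    uniq s -> (forall i, dg_homog i (c i)) -> \sum_(i <- s) c i = 0 ->
    forall i, i \in s -> c i = 0;
  dg_d_linear : is_linear (@dg_d V);
  dg_d_homog : forall i (x : V), dg_homog i x -> dg_homog (i - 1) (dg_d x);
  dg_d_d : forall x : V, dg_d (dg_d x) = 0 }.

Record is_dgmorph (V W : dgmod_data) (f : V -> W) : Prop := IsDgMorph {
  dgmorph_linear : is_linear f;
  dgmorph_homog : forall i x, dg_homog i x -> dg_homog i (f x);
  dgmorph_d : forall x, f (dg_d x) = dg_d (f x) }.

Definition is_cycle (V : dgmod_data) (i : int) (x : V) : Prop :=
  dg_homog i x /\ dg_d x = 0.

Definition homologous (V : dgmod_data) (i : int) (x y : V) : Prop :=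
  exists2 z : V, dg_homog (i + 1) z & x - y = dg_d z.

(* H_i(V) is the quotient of the module of i-cycles by [homologous i]; the two
   clauses are the injectivity and the surjectivity of H_i(f). *)
Definition homology_iso (V W : dgmod_data) (f : V -> W) : Prop :=
  forall i : int,
    (forall x y : V, is_cycle i x -> is_cycle i y ->
       homologous i (f x) (f y) -> homologous i x y) /\
    (forall z : W, is_cycle i z ->
       exists2 x : V, is_cycle i x & homologous i (f x) z).

Record dgcat_data (O : Type) := DgCatData {
  dg_hom :> O -> O -> dgmod_data;
  dg_id : forall a, dg_hom a a;
  dg_comp : forall a b c, dg_hom b c -> dg_hom a b -> dg_hom a c }.

Arguments dg_id {O} _ _.

Record is_dgcat (O : Type) (C : dgcat_data O) : Prop := IsDgCat {
  dgcat_hom : forall a b, is_dgmod (C a b);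
  dgcat_comp_linearl : forall a b c (y : C a b),
    is_linear (fun x : C b c => dg_comp x y);
  dgcat_comp_linearr : forall a b c (x : C b c),
    is_linear (fun y : C a b => dg_comp x y);
  dgcat_comp_homog : forall a b c i j (x : C b c) (y : C a b),
    dg_homog i x -> dg_homog j y -> dg_homog (i + j) (dg_comp x y);
  dgcat_comp_d : forall a b c i (x : C b c) (y : C a b), dg_homog i x ->
    dg_d (dg_comp x y) =
    dg_comp (dg_d x) y + isign k i *: dg_comp x (dg_d y);
  dgcat_id_homog : forall a, dg_homog 0 (dg_id C a);
  dgcat_id_d : forall a, dg_d (dg_id C a) = 0;
  dgcat_compA : forall a b c d (x : C c d) (y : C b c) (z : C a b),
    dg_comp x (dg_comp y z) = dg_comp (dg_comp x y) z;
  dgcat_comp1l : forall a b (x : C a b), dg_comp (dg_id C b) x = x;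
  dgcat_comp1r : forall a b (x : C a b), dg_comp x (dg_id C a) = x }.

Record is_dgfunctor (O O' : Type) (C : dgcat_data O) (D : dgcat_data O')
    (f0 : O -> O') (f : forall a b, C a b -> D (f0 a) (f0 b)) : Prop :=
  IsDgFunctor {
  dgfunctor_hom : forall a b, is_dgmorph (@f a b);
  dgfunctor_id : forall a, f a a (dg_id C a) = dg_id D (f0 a);
  dgfunctor_comp : forall a b c (x : C b c) (y : C a b),
    f a c (dg_comp x y) = dg_comp (f b c x) (f a b y) }.

(* The target D ranges over dg-categories with an arbitrary set of objects. *)
Definition is_free_dgcat (O : Type) (X : O -> O -> dgmod_data)
    (F : dgcat_data O) (iota : forall a b, X a b -> F a b) : Prop :=
  [/\ is_dgcat F,
      forall a b, is_dgmorph (@iota a b)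
    & forall (O' : Type) (D : dgcat_data O') (f0 : O -> O')
        (g : forall a b, X a b -> D (f0 a) (f0 b)),
      is_dgcat D -> (forall a b, is_dgmorph (@g a b)) ->
      exists f : forall a b, F a b -> D (f0 a) (f0 b),
      [/\ is_dgfunctor f,
          forall a b x, f a b (iota a b x) = g a b x
        & forall f' : forall a b, F a b -> D (f0 a) (f0 b),
          is_dgfunctor f' -> (forall a b x, f' a b (iota a b x) = g a b x) ->
          forall a b x, f' a b x = f a b x]].

Record is_derivation (O : Type) (C : dgcat_data O)
    (D : forall a b, C a b -> C a b) : Prop := IsDerivation {
  derivation_linear : forall a b, is_linear (@D a b);
  derivation_homog : forall a b i (x : C a b),
    dg_homog i x -> dg_homog (i - 1) (D a b x);
  derivation_comp : forall a b c i (x : C b c) (y : C a b), dg_homog i x ->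
    D a c (dg_comp x y) =
    dg_comp (D b c x) y + isign k i *: dg_comp x (D a b y) }.

Definition dgcat_twist (O : Type) (C : dgcat_data O)
    (D : forall a b, C a b -> C a b) : dgcat_data O :=
  DgCatData
    (dg_hom := fun a b =>
       DgModData (@dg_homog (C a b)) (fun x : C a b => dg_d x + D a b x))
    (fun a => dg_id C a)
    (fun a b c (x : C b c) (y : C a b) => dg_comp x y).

Definition quasi_free (O : Type) (C : dgcat_data O) : Prop :=
  exists (X : O -> O -> dgmod_data) (F : dgcat_data O)
    (iota : forall a b, X a b -> F a b) (D : forall a b, F a b -> F a b)
    (phi : forall a b, dgcat_twist D a b -> C a b),
  [/\ forall a b, is_dgmod (X a b),
      is_free_dgcat iota,
      is_derivation D,
      is_dgfunctor (f0 := id) phi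
    & forall a b, bijective (@phi a b)].

End DG.

Arguments dg_id {k O} _ _.

(* A map from {0, ..., r-1} to {0, ..., s-1} is encoded by the sequence of its
   r values, and the sets r = {1 < ... < r} are shifted to {0, ..., r-1}. *)
Definition is_surj (r s : nat) (f : seq nat) : bool :=
  [&& size f == r, all (fun y => y < s)%N f & all (fun y => y \in f) (iota 0 s)].

(* A tree is encoded by the sequence of the maps tau_1, ..., tau_n (so that the
   item i is the map tau_{i+1} from level i to level i+1), and a morphism by the
   sequence of its components at the levels 0, ..., n-1. The default value
   [:: 0] stands for the one-point set at level n, respectively for the only
   possible component of a morphism at level n. *)
Definition level_map (f : seq (seq nat)) (i : nat) : seq nat := nth [:: 0%N] f i.
Definition ev (f : seq (seq nat)) (i x : nat) : nat := nth 0%N (level_map f i) x.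
Definition lsize (t : seq (seq nat)) (i : nat) : nat := size (level_map t i).

Definition is_ptree (n : nat) (t : seq (seq nat)) : bool :=
  (size t == n) &&
  [forall i : 'I_n, sorted leq (level_map t i) &&
                    is_surj (lsize t i) (lsize t i.+1) (level_map t i)].

Record ptree (n : nat) := PTree {
  ptree_val :> seq (seq nat);
  ptreeP : is_ptree n ptree_val }.
HB.instance Definition _ n := [isSub for @ptree_val n].
HB.instance Definition _ n := [Choice of ptree n by <:].

Definition is_mor (n : nat) (t s u : seq (seq nat)) : bool :=
  [&& size u == n,
      [forall i : 'I_n, is_surj (lsize t i) (lsize s i) (level_map u i)],
      [forall i : 'I_n, forall x : 'I_(lsize t i),
         ev u i.+1 (ev t i x) == ev s i (ev u i x)]
    & [forall i : 'I_n, forall x : 'I_(lsize t i), forall y : 'I_(lsize t i),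
         (x <= y)%N && (ev t i x == ev t i y) ==> (ev u i x <= ev u i y)%N]].

Record mor (n : nat) (t s : ptree n) := Mor {
  mor_val :> seq (seq nat);
  morP : is_mor n t s mor_val }.
HB.instance Definition _ n t s := [isSub for @mor_val n t s].
HB.instance Definition _ n t s := [Choice of @mor n t s by <:].

Definition mid_val (t : seq (seq nat)) : seq (seq nat) :=
  [seq iota 0 (size f) | f <- t].

Definition mcomp_val (n : nat) (v w : seq (seq nat)) : seq (seq nat) :=
  mkseq (fun i => [seq ev v i x | x <- level_map w i]) n.

Section Category.
Variable n : nat.
Implicit Types t r s : ptree n.

Lemma size_ptree t : size t = n.
Proof. by case/andP: (ptreeP t) => /eqP. Qed.

Lemma level_map_out f i : (size f <= i)%N -> level_map f i = [:: 0%N].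
Proof. exact: nth_default. Qed.

Lemma ev_ptree t (i : 'I_n) x :
  (x < lsize t i)%N -> (ev t i x < lsize t i.+1)%N.
Proof.
move=> xi; case/andP: (ptreeP t) => _ /forallP /(_ i) /andP[_].
by case/and3P=> _ /allP + _; apply; apply: mem_nth.
Qed.

Lemma ev_mor t s (u : mor t s) (i : nat) x : (i <= n)%N ->
  (x < lsize t i)%N -> (ev u i x < lsize s i)%N.
Proof.
have /and4P[/eqP szu /forallP surju _ _] := morP u.
rewrite leq_eqVlt => /orP[/eqP->|ltin xi].
  by rewrite /ev /lsize !level_map_out ?size_ptree ?szu //; case: x.
case/and3P: (surju (Ordinal ltin)) => /eqP sz /allP + _; apply.
by apply: mem_nth; rewrite sz.
Qed.

Lemma ev_mid t i x : (i <= n)%N -> (x < lsize t i)%N -> ev (mid_val t) i x = x.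
Proof.
rewrite leq_eqVlt => /orP[/eqP->|ltin].
  by rewrite /ev /lsize !level_map_out ?size_map ?size_ptree //; case: x.
rewrite /ev /lsize /level_map (nth_map [:: 0%N]) ?size_ptree // => xi.
by rewrite nth_iota.
Qed.

Lemma mid_subproof t : is_mor n t t (mid_val t).
Proof.
apply/and4P; split; first by rewrite size_map size_ptree.
- apply/forallP=> i; rewrite /is_surj /level_map (nth_map [:: 0%N]) ?size_ptree //.
  rewrite size_iota eqxx /=; apply/andP; split; apply/allP=> y //.
  by rewrite mem_iota.
- apply/forallP=> i; apply/forallP=> x.
  by rewrite !ev_mid ?(ltnW (ltn_ord i)) ?ltn_ord // ev_ptree.
- apply/forallP=> i; apply/forallP=> x; apply/forallP=> y; apply/implyP.
  by rewrite !ev_mid ?(ltnW (ltn_ord i)) // => /andP[].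
Qed.

Definition mid t : mor t t := Mor (mid_subproof t).

Lemma ev_mcomp t r s (v : mor r s) (w : mor t r) i x :
  (i <= n)%N -> (x < lsize t i)%N ->
  ev (mcomp_val n v w) i x = ev v i (ev w i x).
Proof.
have /and4P[/eqP szv _ _ _] := morP v.
have /and4P[/eqP szw /forallP surjw _ _] := morP w.
rewrite leq_eqVlt => /orP[/eqP->|ltin].
  rewrite /ev /lsize !level_map_out ?size_mkseq ?szv ?szw ?size_ptree //.
  by case: x.
case/and3P: (surjw (Ordinal ltin)) => /eqP /= sz _ _ xi.
by rewrite /ev /level_map nth_mkseq // (nth_map 0%N) // sz.
Qed.

Lemma mcomp_subproof t r s (v : mor r s) (w : mor t r) :
  is_mor n t s (mcomp_val n v w).
Proof.
have /and4P[_ /forallP sv /forallP cv /forallP fv] := morP v.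
have /and4P[_ /forallP sw /forallP cw /forallP fw] := morP w.
apply/and4P; split; first by rewrite size_mkseq.
- apply/forallP=> i.
  case/and3P: (sv i) => /eqP zv /allP lv /allP ov.
  case/and3P: (sw i) => /eqP zw /allP lw /allP ow.
  rewrite /is_surj {1 2 3}/level_map nth_mkseq // size_map zw eqxx /=.
  apply/andP; split; apply/allP=> y.
    by case/mapP=> x /lw xr ->; apply: lv; rewrite mem_nth // zv.
  move=> /ov /(nthP 0%N)[x xr <-]; apply/mapP; exists x => //.
  by apply: ow; rewrite mem_iota /= add0n -zv.
- apply/forallP=> i; apply/forallP=> x.
  have lin := ltnW (ltn_ord i).
  have wx : (ev w i x < lsize r i)%N by rewrite ev_mor.
  rewrite !ev_mcomp // ?ev_ptree //.
  move/forallP: (cw i) => /(_ x)/eqP->.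
  by move/forallP: (cv i) => /(_ (Ordinal wx))/eqP /= ->.
- apply/forallP=> i; apply/forallP=> x; apply/forallP=> y.
  have lin := ltnW (ltn_ord i).
  have wx : (ev w i x < lsize r i)%N by rewrite ev_mor.
  have wy : (ev w i y < lsize r i)%N by rewrite ev_mor.
  apply/implyP=> /andP[xy /eqP exy]; rewrite !ev_mcomp //.
  have /forallP/(_ (Ordinal wx))/forallP/(_ (Ordinal wy))/implyP := fv i.
  apply; apply/andP; split => /=.
    have /forallP/(_ x)/forallP/(_ y)/implyP := fw i.
    by apply; rewrite xy exy eqxx.
  have /forallP cwi := cw i.
  by rewrite -(eqP (cwi x)) -(eqP (cwi y)) exy.
Qed.

Definition mcomp t r s (v : mor r s) (w : mor t r) : mor t s :=
  Mor (mcomp_subproof v w).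

Definition tdeg t : nat := (\sum_(i < n) lsize t i)%N.
Definition mdeg t s (u : mor t s) : int := (tdeg t)%:Z - (tdeg s)%:Z.

Definition is_id t s (u : mor t s) : bool :=
  (t == s) && (mor_val u == mid_val t).

Record gen t s := Gen { gen_mor :> mor t s; genP : ~~ is_id gen_mor }.
HB.instance Definition _ t s := [isSub for @gen_mor t s].
HB.instance Definition _ t s := [Choice of gen t s by <:].

(* The vertex x of level i, followed by its descendants: a vertex comes before
   its children, and the children are visited from left to right. *)
Fixpoint dfs (t : seq (seq nat)) (i x : nat) : seq (nat * nat) :=
  (i, x) ::
  if i is j.+1 then
    flatten [seq dfs t j y | y <- iota 0 (lsize t j) & ev t j y == x]
  else [::].

(* The vertices (level, index) of level < n, the root being omitted. *)
Definition vertices t : seq (nat * nat) := behead (dfs t n 0).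

(* The parity of the permutation which takes the word l1 to the word l2, for
   words without repetition and with the same letters. *)
Definition rearr_odd (l1 l2 : seq (nat * nat)) : bool :=
  [exists p : 'S_(size l1),
     (l2 == [seq nth (0, 0)%N l1 (p i) | i <- enum 'I_(size l1)]) && odd_perm p].

Definition vimage (u : seq (seq nat)) (x : nat * nat) : nat * nat :=
  (x.1, ev u x.1 x.2).

(* In degree 1, [merged] is the word [:: x_i; x_j] of the two vertices with the
   same image; x_{ij} is identified with this image in the target tree. *)
Definition merged t s (u : mor t s) : seq (nat * nat) :=
  [seq x <- vertices t |
     has (fun y => (y != x) && (vimage u y == vimage u x)) (vertices t)].
Definition unmerged t s (u : mor t s) : seq (nat * nat) :=
  [seq x <- vertices t | x \notin merged u].

Definition sgn_odd t s (u : mor t s) : bool :=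
  rearr_odd (vertices t) (merged u ++ unmerged u) (+)
  rearr_odd (take 1 (map (vimage u) (merged u)) ++ map (vimage u) (unmerged u))
            (vertices s).

End Category.

(* The morphisms of the free category on a graph G. A composite
   u_1 u_2 ... u_m, where u_m is applied first, is
   gcons u_1 (gcons u_2 ... (gcons u_m (gnil _))). *)
Inductive gpath (O : Type) (G : O -> O -> Type) (a : O) : O -> Type :=
| gnil : gpath G a a
| gcons b c : G b c -> gpath G a b -> gpath G a c.

Arguments gnil {O G} a.
Arguments gcons {O G a b c} _ _.

HB.instance Definition _ O (G : O -> O -> Type) a b :=
  gen_eqMixin (gpath G a b).
HB.instance Definition _ O (G : O -> O -> Type) a b :=
  gen_choiceMixin (gpath G a b).

Fixpoint gcat (O : Type) (G : O -> O -> Type) (a b c : O) (p : gpath G b c) :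
    gpath G a b -> gpath G a c :=
  match p in gpath _ _ c return gpath G a b -> gpath G a c with
  | gnil => fun q => q
  | gcons _ _ u p' => fun q => gcons u (gcat p' q)
  end.

Section Cobar.
Variables (k : comPzRingType) (n : nat).
Implicit Types t r s : ptree n.

Definition omega_hom t s : dgmod_data k :=
  @DgModData k (freemod k (mor t s)) (fun i x => i <> 0 -> x = 0) (fun=> 0).

Definition omega_comp t r s (x : omega_hom r s) (y : omega_hom t r) :
    omega_hom t s :=
  linext (fun v : mor r s =>
    linext (fun w : mor t r => basis (mcomp v w) : omega_hom t s) y) x.

Definition omega : dgcat_data k (ptree n) :=
  DgCatData (dg_hom := omega_hom) (fun t => basis (mid t)) omega_comp.

Definition cpath t s := gpath (@gen n) t s.

Fixpoint cpath_deg t s (p : cpath t s) : int :=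
  if p is gcons _ _ u p' then (mdeg u - 1) + cpath_deg p' else 0.

Definition cobar_car t s : lmodType k := freemod k (cpath t s).

Definition cobar_comp t r s (x : cobar_car r s) (y : cobar_car t r) :
    cobar_car t s :=
  linext (fun p : cpath r s =>
    linext (fun q : cpath t r => basis (gcat p q) : cobar_car t s) y) x.

(* The index f packages a tree r with non-identity morphisms v : r -> s and
   w : t -> r; u has finitely many factorizations, so that the finitely
   supported sum is the sum over all of them. *)
Definition gen_d t s (u : gen t s) : cobar_car t s :=
  \sum_(f \in [set f : {r : ptree n & (gen r s * gen t r)%type} |
               mcomp (tagged f).1 (tagged f).2 = u :> mor t s]%classic)
    isign k (mdeg (tagged f).1) *:
      basis (gcons (tagged f).1 (gcons (tagged f).2 (gnil t))).

Fixpoint cpath_d t s (p : cpath t s) : cobar_car t s :=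
  match p in gpath _ _ s return cobar_car t s with
  | gnil => 0
  | gcons _ _ u p' =>
      cobar_comp (gen_d u) (basis p') +
      isign k (mdeg u - 1) *:
        cobar_comp (basis (gcons u (gnil _))) (cpath_d p')
  end.

Definition cobar_hom t s : dgmod_data k :=
  @DgModData k (cobar_car t s)
    (fun i x => forall p : cpath t s, p \in msupp x -> cpath_deg p = i)
    (linext (fun p : cpath t s => cpath_d p)).

Definition cobar : dgcat_data k (ptree n) :=
  DgCatData (dg_hom := cobar_hom) (fun t => basis (gnil t)) cobar_comp.

Definition gen_aug t s (u : gen t s) : omega t s :=
  if mdeg u == 1 then (-1) ^+ sgn_odd u *: (basis (gen_mor u) : omega t s)
  else 0.

Fixpoint cpath_aug t s (p : cpath t s) : omega t s :=
  match p in gpath _ _ s return omega t s with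
  | gnil => dg_id omega t
  | gcons _ _ u p' => dg_comp (gen_aug u) (cpath_aug p')
  end.

Definition augmentation t s : cobar t s -> omega t s :=
  linext (fun p : cpath t s => cpath_aug p).

End Cobar.

(* Main.v *)
From Stdlib Require Import Eqdep_dec.
From HB Require Import structures.
From mathcomp Require Import all_boot all_order all_algebra all_fingroup.
From mathcomp Require Import zify.
From mathcomp Require Import finmap boolp classical_sets cardinality fsbigop.
From mathcomp Require Import monalg.
Require Import Defs.

Set Implicit Arguments.
Unset Strict Implicit.
Unset Printing Implicit Defensive.

Import Order.TTheory GRing.Theory Num.Theory.

(** Every morphism of pruned trees is an epimorphism, and isomorphisms are
identities, so the component of the cobar construction over a morphism [u] is
spanned by the chains [id < w_1 < ... < u] of quotients of the source that lie
below [u]. These chains carry a discrete Morse matching.  A vertex [x] is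
critical for a quotient [w] below [u] when the later vertices that [w] puts
under the same parent and [u] identifies with [x] are placed before [x].  Look
at the first noncritical vertex, levels being ordered from the leaves upwards:
if it is alone in its block, merge it with the block that follows; otherwise
split it off in front of its block.  Splitting depends on [w] only, and not on
[u], so it singles out one maximal chain for every [u]; extending the matching
to all chains leaves exactly these as critical cells, all of degree 0.  Since the
matching is triangular for a lexicographic rank, a cycle without partners in
its support vanishes, and the augmentation maps the critical chain of [u] to
[u] up to sign.

That the augmentation is a chain map amounts to the fact that a morphism of
degree 2 has exactly two factorizations, with opposite signs: they either merge
two pairs of vertices in different orders, or merge the second pair in opposite
directions, or associate the merging of three vertices differently. *)

(** * Pruned trees and their morphisms *)

Section Basics.
Variable n : nat.
Implicit Types t r s : ptree n.

Lemma ptree_lt t i x : i < n -> x < lsize t i -> ev t i x < lsize t i.+1.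
Proof. by move=> lti; apply: (ev_ptree (i := Ordinal lti)). Qed.

Lemma ptree_mono t i x y :
  i < n -> x <= y -> y < lsize t i -> ev t i x <= ev t i y.
Proof.
move=> lti xy yi; case/andP: (ptreeP t) => _ /forallP /(_ (Ordinal lti)) /andP[].
move=> so _; apply: (sorted_leq_nth leq_trans leqnn 0 so) => //.
exact: leq_ltn_trans yi.
Qed.

Lemma lsize_root t : lsize t n = 1.
Proof. by rewrite /lsize level_map_out ?size_ptree. Qed.

Lemma size_mor t s (u : mor t s) : size u = n.
Proof. by have /and4P[/eqP] := morP u. Qed.

Lemma mor_size t s (u : mor t s) i : i < n -> size (level_map u i) = lsize t i.
Proof.
move=> lti; have /and4P[_ /forallP /(_ (Ordinal lti)) + _ _] := morP u.
by case/and3P => /eqP.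
Qed.

Lemma mor_surj t s (u : mor t s) i y : i <= n -> y < lsize s i ->
  exists2 x, x < lsize t i & ev u i x = y.
Proof.
rewrite leq_eqVlt => /orP[/eqP->|lti] ys.
  move: ys; rewrite lsize_root ltnS leqn0 => /eqP ->; exists 0; first by rewrite lsize_root.
  by rewrite /ev level_map_out ?size_mor.
have /and4P[_ /forallP /(_ (Ordinal lti)) + _ _] := morP u.
case/and3P => /eqP /= sz _ /allP /(_ y); rewrite mem_iota ys => /(_ isT).
by move=> /(nthP 0)[x]; rewrite sz; exists x.
Qed.

Lemma mor_comm t s (u : mor t s) i x : i < n -> x < lsize t i ->
  ev u i.+1 (ev t i x) = ev s i (ev u i x).
Proof.
move=> lti xi; have /and4P[_ _ /forallP /(_ (Ordinal lti)) /forallP + _] := morP u.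
by move=> /(_ (Ordinal xi)) /eqP.
Qed.

Lemma mor_fib t s (u : mor t s) i x y : i < n -> x <= y -> y < lsize t i ->
  ev t i x = ev t i y -> ev u i x <= ev u i y.
Proof.
move=> lti xy yi e; have /and4P[_ _ _ /forallP /(_ (Ordinal lti)) /forallP] := morP u.
move=> /(_ (Ordinal (leq_ltn_trans xy yi))) /forallP /(_ (Ordinal yi)) /implyP; apply.
by rewrite /= xy e eqxx.
Qed.

Lemma mor_root t s (u : mor t s) x : x < lsize t n -> ev u n x = 0.
Proof.
by rewrite lsize_root ltnS leqn0 => /eqP->; rewrite /ev level_map_out ?size_mor.
Qed.

Lemma mor_par t s (u : mor t s) i x y : i < n -> x < lsize t i -> y < lsize t i ->
  ev u i x <= ev u i y -> ev u i.+1 (ev t i x) <= ev u i.+1 (ev t i y).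
Proof.
move=> lti xi yi le; rewrite !mor_comm //; apply: ptree_mono => //.
by apply: ev_mor => //; apply: ltnW.
Qed.

Lemma mor_parlt t s (u : mor t s) i x y : i < n -> x < lsize t i -> y < lsize t i ->
  ev u i.+1 (ev t i x) < ev u i.+1 (ev t i y) -> ev u i x < ev u i y.
Proof. by move=> lti xi yi; rewrite !ltnNge; apply/contra/mor_par. Qed.

Lemma mor_pareq t s (u : mor t s) i x y : i < n -> x < lsize t i -> y < lsize t i ->
  ev u i x = ev u i y -> ev u i.+1 (ev t i x) = ev u i.+1 (ev t i y).
Proof. by move=> lti xi yi e; rewrite !mor_comm // e. Qed.

Lemma mor_ext t r s (u : mor t r) (v : mor t s) :
  (forall i x, i < n -> x < lsize t i -> ev u i x = ev v i x) ->
  mor_val u = mor_val v.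
Proof.
move=> H; apply: (@eq_from_nth _ [:: 0]); rewrite ?size_mor // => i lti.
apply: (@eq_from_nth _ 0); rewrite -/(level_map u i) -/(level_map v i) ?mor_size //.
by move=> x xi; apply: H.
Qed.

Lemma lsize_maxE t r (u : mor t r) i : i <= n ->
  lsize r i = size (undup [seq ev u i x | x <- iota 0 (lsize t i)]).
Proof.
move=> lei; rewrite -(size_iota 0 (lsize r i)); apply: perm_size.
apply: uniq_perm; rewrite ?iota_uniq ?undup_uniq // => y.
rewrite mem_undup mem_iota /= add0n; apply/idP/mapP.
  by case/(mor_surj u lei) => x xi <-; exists x; rewrite // mem_iota.
by case=> x; rewrite mem_iota /= add0n => xi ->; apply: ev_mor.
Qed.

Lemma mor_tgt t r s (u : mor t r) (v : mor t s) : mor_val u = mor_val v -> r = s.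
Proof.
move=> e; apply: val_inj => /=.
have sz i : i <= n -> lsize r i = lsize s i.
  by move=> lei; rewrite (lsize_maxE u lei) (lsize_maxE v lei) e.
apply: (@eq_from_nth _ [:: 0]); rewrite ?size_ptree // => i lti.
apply: (@eq_from_nth _ 0); first exact: (sz _ (ltnW lti)).
move=> y yi; case: (mor_surj u (ltnW lti) yi) => x xi ex.
have := mor_comm u lti xi; rewrite ex e mor_comm // -e ex.
by rewrite /ev /level_map => ->.
Qed.

Lemma mor_eq t s (u v : mor t s) :
  (forall i x, i < n -> x < lsize t i -> ev u i x = ev v i x) -> u = v.
Proof. by move=> H; apply: val_inj; apply: mor_ext. Qed.

Lemma ev_comp t r s (v : mor r s) (w : mor t r) i x :
  i <= n -> x < lsize t i -> ev (mcomp v w) i x = ev v i (ev w i x).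
Proof. exact: ev_mcomp. Qed.

Lemma mcompA t r q s (a : mor q s) (b : mor r q) (c : mor t r) :
  mcomp a (mcomp b c) = mcomp (mcomp a b) c.
Proof.
apply: mor_eq => i x lti xi; have lei := ltnW lti.
by rewrite !ev_comp // ev_mor.
Qed.

Lemma mcomp1l t s (u : mor t s) : mcomp (mid s) u = u.
Proof.
apply: mor_eq => i x lti xi; have lei := ltnW lti.
by rewrite ev_comp //= ev_mid // ev_mor.
Qed.

Lemma mcomp1r t s (u : mor t s) : mcomp u (mid t) = u.
Proof.
apply: mor_eq => i x lti xi; have lei := ltnW lti.
by rewrite ev_comp //= ev_mid.
Qed.

Lemma mcomp_epi t r s (v v' : mor r s) (w : mor t r) :
  mcomp v w = mcomp v' w -> v = v'.
Proof.
move=> e; apply: mor_eq => i y lti yi; have lei := ltnW lti.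
by case: (mor_surj w lei yi) => x xi <-; rewrite -!ev_comp // e.
Qed.

Lemma lsize_le t s (u : mor t s) i : i <= n -> lsize s i <= lsize t i.
Proof.
move=> lei; rewrite (lsize_maxE u lei); apply: leq_trans (size_undup _) _.
by rewrite size_map size_iota.
Qed.

Lemma mor_inj_size t s (u : mor t s) i : i <= n ->
  (forall x y, x < y -> y < lsize t i -> ev u i x != ev u i y) <->
  lsize s i = lsize t i.
Proof.
move=> lei; rewrite (lsize_maxE u lei).
have szE : size [seq ev u i x | x <- iota 0 (lsize t i)] = lsize t i.
  by rewrite size_map size_iota.
split=> [inj|e x y xy yi].
  rewrite undup_id // map_inj_in_uniq ?iota_uniq // => x y.
  rewrite !mem_iota /= !add0n => xi yi e.
  case: (ltngtP x y) => // h; first by have := inj _ _ h yi; rewrite e eqxx.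
  by have := inj _ _ h xi; rewrite e eqxx.
have: uniq [seq ev u i x | x <- iota 0 (lsize t i)].
  by rewrite -[uniq _]negbK -ltn_size_undup szE e ltnn.
move=> un; apply/eqP => exy.
have xi := ltn_trans xy yi.
have /(uniqP 0)/(_ x y) := un; rewrite !inE szE => /(_ xi yi).
rewrite !(nth_map 0) ?size_iota // !nth_iota // !add0n => /(_ exy) E.
by rewrite E ltnn in xy.
Qed.

Lemma mor_id_above t s (u : mor t s) k :
  (forall i, k <= i <= n -> lsize s i = lsize t i) ->
  forall i x, k <= i <= n -> x < lsize t i -> ev u i x = x.
Proof.
move=> sz i x /andP[ki lei].
have [d ed] : exists d, d = n - i by eexists.
elim: d i x ki lei ed => [|d IH] i z ki lei ed zi.
  have ei : i = n by lia.
  by subst i; rewrite mor_root //; move: zi; rewrite lsize_root; case: z.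
have lti : i < n by lia.
have szi := sz i (introT andP (conj ki lei)).
have par y : y < lsize t i -> ev s i (ev u i y) = ev t i y.
  by move=> yi; rewrite -mor_comm // IH //; [lia | lia | exact: ptree_lt].
have mono x' y' : x' < y' -> y' < lsize t i -> ev u i x' < ev u i y'.
  move=> xy yi; have xi := ltn_trans xy yi.
  have := proj2 (mor_inj_size u lei) szi _ _ xy yi.
  case: (ltngtP (ev u i x') (ev u i y')) => // h _.
  have : ev s i (ev u i y') <= ev s i (ev u i x').
    by apply: ptree_mono => //; [exact: ltnW | apply: ev_mor].
  rewrite !par // => le1.
  have le2 := ptree_mono lti (ltnW xy) yi.
  have /(mor_fib u lti (ltnW xy) yi) : ev t i x' = ev t i y' by lia.
  lia.
have lo : forall y', y' < lsize t i -> y' <= ev u i y'.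
  by elim=> // y' IHy yi; apply: leq_ltn_trans (IHy (ltnW yi)) (mono _ _ _ yi).
have hi : forall d' y', y' < lsize t i -> lsize t i - y' = d'.+1 ->
    ev u i y' + d' < lsize t i.
  elim=> [|d' IHd] y' yi ed'; first by rewrite addn0 -szi; apply: ev_mor.
  have yi' : y'.+1 < lsize t i by lia.
  have := IHd _ yi' ltac:(lia); have := mono _ _ (ltnSn y') yi'; lia.
have := lo _ zi; have := hi (lsize t i - z).-1 z zi ltac:(lia); lia.
Qed.

Lemma mor_is_id t s (u : mor t s) :
  (forall i, i < n -> lsize s i = lsize t i) -> is_id u.
Proof.
move=> sz; have H : mor_val u = mor_val (mid t).
  apply: mor_ext => i x lti; rewrite /= => xi; rewrite ev_mid ?(ltnW lti) //.
  apply: (@mor_id_above _ _ u 0) => //=; last exact: ltnW.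
  move=> j /=; rewrite leq_eqVlt => /orP[/eqP->|]; rewrite ?lsize_root //; exact: sz.
by rewrite /is_id H eqxx andbT; apply/eqP; exact: esym (mor_tgt H).
Qed.

Lemma mid_is_id t : is_id (mid t).
Proof. by rewrite /is_id !eqxx. Qed.

Lemma mdeg_ge0 t s (u : mor t s) : (0 <= mdeg u)%R.
Proof.
rewrite /mdeg subr_ge0 lez_nat /tdeg; apply: leq_sum => i _.
exact/lsize_le/ltnW.
Qed.

Lemma mdegM t r s (v : mor r s) (w : mor t r) :
  mdeg (mcomp v w) = (mdeg v + mdeg w)%R.
Proof. by rewrite /mdeg; lia. Qed.

Lemma mdegE t s (u : mor t s) :
  mdeg u = Posz (\sum_(i < n) (lsize t i - lsize s i)).
Proof.
rewrite /mdeg /tdeg sumnB; last by move=> i _; apply/lsize_le/ltnW.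
rewrite subzn //; apply: leq_sum => i _; exact/lsize_le/ltnW.
Qed.

Lemma mdeg0 t s (u : mor t s) : (mdeg u == 0)%R = is_id u.
Proof.
apply/idP/idP; last by case/andP=> /eqP e _; rewrite /mdeg e subrr.
rewrite mdegE eqz_nat sum_nat_eq0 => /forallP /= H; apply: mor_is_id => i lti.
have := H (Ordinal lti); rewrite /= => h.
by apply/eqP; rewrite eqn_leq lsize_le ?(ltnW lti).
Qed.

Lemma mdeg1P t s (u : mor t s) : (mdeg u == 1)%R <-> exists j,
  [/\ j < n, (lsize s j).+1 = lsize t j &
      forall i, i <= n -> i != j -> lsize s i = lsize t i].
Proof.
have le i (lei : i <= n) := lsize_le u lei.
rewrite mdegE eqz_nat; split=> [/sum_nat_eq1[[j ltj] /= [_ ej H]]|].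
  exists j; split=> //; first by have := le j (ltnW ltj); lia.
  move=> i; rewrite leq_eqVlt => /orP[/eqP->|lti] nij; first by rewrite !lsize_root.
  have := H (Ordinal lti) nij isT; have := le i (ltnW lti); rewrite /=; lia.
case=> j [ltj ej H]; apply/sum_nat_eq1; exists (Ordinal ltj); split=> //=; first by lia.
move=> i nij _; rewrite H ?subnn //; exact/ltnW.
Qed.

Definition merge_level t (w : seq (seq nat)) (j c : nat) : Prop :=
  [/\ j < n, c.+1 < lsize t j, ev t j c = ev t j c.+1,
      forall i x, j < i <= n -> x < lsize t i -> ev w i x = x
    & (forall x, x < lsize t j -> ev w j x = x - (c < x)) /\
      forall i x y, i < j -> x < lsize t i -> y < lsize t i ->
        ev w i x = ev w i y -> x = y].

Lemma mdeg1_merge t s (u : mor t s) : (mdeg u = 1)%R -> exists j c, merge_level t u j c.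
Proof.
move=> /eqP/mdeg1P [j [ltj ej H]].
have idl i x : j < i <= n -> x < lsize t i -> ev u i x = x.
  move=> ji; apply: (@mor_id_above _ _ u j.+1) => // k kn; apply: H; lia.
have lej := ltnW ltj.
have par y : y < lsize t j -> ev s j (ev u j y) = ev t j y.
  by move=> yj; rewrite -mor_comm // idl ?ptree_lt //; lia.
have mono x y : x <= y -> y < lsize t j -> ev u j x <= ev u j y.
  move=> xy yj; have xj := leq_ltn_trans xy yj.
  rewrite leqNgt; apply/negP => h.
  have : ev s j (ev u j y) <= ev s j (ev u j x).
    by apply: ptree_mono => //; [exact: ltnW | apply: ev_mor].
  rewrite !par // => le1; have le2 := ptree_mono ltj xy yj.
  have /(mor_fib u ltj xy yj) : ev t j x = ev t j y by lia.
  lia.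
have step x : x.+1 < lsize t j -> ev u j x.+1 <= (ev u j x).+1.
  move=> xj; rewrite leqNgt; apply/negP => h.
  have : (ev u j x).+1 < lsize s j.
    by apply: leq_trans (ev_mor u lej xj); apply: ltnW.
  case/(mor_surj u lej) => z zj ez; case: (leqP z x) => zx.
    have := mono _ _ zx (ltnW xj); lia.
  have := mono _ _ zx zj; lia.
have [c cj ec] : exists2 c, c.+1 < lsize t j & ev u j c = ev u j c.+1.
  apply: contrapT => nex; have : lsize s j = lsize t j.
    apply/(mor_inj_size u lej) => x y xy yj; apply/eqP => e; apply: nex.
    exists x; first by lia.
    have h1 := mono _ _ (leqnSn x) ltac:(lia); have h2 := mono _ _ xy yj; lia.
  lia.
have stepn d x : x + d < lsize t j -> ev u j (x + d) <= ev u j x + d.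
  elim: d => [|d IH] xd; first by rewrite !addn0.
  rewrite !addnS in xd *; apply: leq_trans (step _ xd) _; rewrite ltnS; apply: IH; lia.
have [z zj z0] := mor_surj u lej (y := 0) ltac:(lia).
have u0 : ev u j 0 = 0 by have := mono 0 z isT zj; lia.
have [q qj qe] := mor_surj u lej (y := (lsize s j).-1) ltac:(lia).
have top : ev u j (lsize t j).-1 = (lsize s j).-1.
  have := mono q (lsize t j).-1 ltac:(lia) ltac:(lia).
  have := ev_mor u lej (x := (lsize t j).-1) ltac:(lia); lia.
have up x : x < lsize t j -> ev u j x <= x.
  by move=> xj; have := stepn x 0 xj; rewrite u0.
have dn x : x < lsize t j -> x <= (ev u j x).+1.
  move=> xj; have := stepn ((lsize t j).-1 - x) x ltac:(lia).
  rewrite subnKC; last by lia.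
  rewrite top; lia.
exists j, c; split=> //; first by rewrite -!par ?ec // ltnW.
split=> [x xj|i x y ij xi yi e]; last first.
  have lei : i <= n by lia.
  have := H i lei ltac:(lia) => /(mor_inj_size u lei) h.
  case: (ltngtP x y) => // xy; first by have := h _ _ xy yi; rewrite e eqxx.
  by have := h _ _ xy xi; rewrite e eqxx.
have uc : ev u j c = c by have := dn _ cj; have := up c (ltnW cj); lia.
case: (leqP x c) => xc.
  have := stepn (c - x) x ltac:(lia); rewrite subnKC // uc.
  have := up x xj; lia.
have := stepn (x - c.+1) c.+1 ltac:(lia); rewrite subnKC // -ec uc.
have := dn x xj; lia.
Qed.

Lemma merge_mdeg1 t s (u : mor t s) j c : merge_level t u j c -> mdeg u = 1%R.
Proof.
case=> ltj cj ec idl [merge injl]; apply/eqP/mdeg1P; exists j; split=> //.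
  have lej := ltnW ltj.
  have hi y : y < lsize s j -> y < (lsize t j).-1.
    case/(mor_surj u lej) => x xj <-; rewrite merge //; case: (ltnP c x); lia.
  have lo : (lsize t j).-2 < lsize s j.
    have := ev_mor u lej (x := (lsize t j).-1) ltac:(lia).
    rewrite merge; lia.
  have := hi (lsize s j).-1 ltac:(lia); lia.
move=> i lei nij; apply/(mor_inj_size u lei) => x y xy yi; apply/eqP => e.
case: (ltngtP i j) nij => // ij _.
  have := injl _ _ _ ij (ltn_trans xy yi) yi e; lia.
move: e; rewrite !idl ?ij //; lia.
Qed.

Lemma order_le N M (f g : nat -> nat) :
  (forall y, y < N -> exists2 x, x < M & f x = y) ->
  (forall x, x < M -> f x < N) ->
  (forall x y, x < M -> y < M -> (f x <= f y) = (g x <= g y)) ->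
  forall x, x < M -> f x <= g x.
Proof.
move=> sf bf H.
suff K k z : z < M -> f z = k -> k <= g z by move=> x xM; apply: K.
elim: k z => // k IH z zM ez.
have kN : k < N by rewrite ltnW // -ez bf.
have [y yM ey] := sf k kN.
have := H z y zM yM; rewrite ez ey ltnn => /esym/negbT.
by rewrite -ltnNge; apply: leq_ltn_trans; apply: IH.
Qed.

Lemma mor_det_above t r s (w : mor t r) (w' : mor t s) k :
  (forall i x y, k <= i < n -> x < lsize t i -> y < lsize t i ->
     ev w i.+1 (ev t i x) = ev w i.+1 (ev t i y) ->
     (forall z, z < lsize t i.+1 -> ev w i.+1 z = ev w' i.+1 z) ->
     (ev w i x <= ev w i y) = (ev w' i x <= ev w' i y)) ->
  forall i x, k <= i <= n -> x < lsize t i -> ev w i x = ev w' i x.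
Proof.
move=> H i x /andP[ki lei] xi.
have [d ed] : exists d, d = n - i by eexists.
elim: d i ki lei ed x xi => [|d IH] i ki lei ed x xi.
  have ei : i = n by lia.
  by subst i; rewrite !mor_root.
have lti : i < n by lia.
have {}IH := IH i.+1 (leqW ki) lti ltac:(lia).
have ord a b : a < lsize t i -> b < lsize t i ->
    (ev w i a <= ev w i b) = (ev w' i a <= ev w' i b).
  move=> ai bi; case: (ltngtP (ev w i.+1 (ev t i a)) (ev w i.+1 (ev t i b))) => h.
  - have h' := h; rewrite !IH ?ptree_lt // in h'.
    by rewrite (ltnW (mor_parlt lti ai bi h)) (ltnW (mor_parlt lti ai bi h')).
  - have h' := h; rewrite !IH ?ptree_lt // in h'.
    by rewrite [LHS]leqNgt [RHS]leqNgt (mor_parlt lti bi ai h) (mor_parlt lti bi ai h').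
  - by apply: H => //; rewrite ki.
apply/eqP; rewrite eqn_leq; apply/andP; split.
  apply: (@order_le (lsize r i) (lsize t i)) => //.
    by move=> y yi; apply: mor_surj.
  by move=> y yi; apply: ev_mor.
apply: (@order_le (lsize s i) (lsize t i)) => //.
- by move=> y yi; apply: mor_surj.
- by move=> y yi; apply: ev_mor.
- by move=> a b ai bi; rewrite ord.
Qed.

Lemma mor_det t r s (w : mor t r) (w' : mor t s) :
  (forall i x y, i < n -> x < lsize t i -> y < lsize t i ->
     ev w i.+1 (ev t i x) = ev w i.+1 (ev t i y) ->
     (forall z, z < lsize t i.+1 -> ev w i.+1 z = ev w' i.+1 z) ->
     (ev w i x <= ev w i y) = (ev w' i x <= ev w' i y)) ->
  mor_val w = mor_val w'.
Proof.
move=> H; apply: mor_ext => i x lti xi.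
apply: (@mor_det_above _ _ _ w w' 0) => //=; exact: ltnW.
Qed.

End Basics.

Section Construct.
Variable n : nat.
Implicit Types t r s : ptree n.

Definition seq_of_fun (N : nat -> nat) (f : nat -> nat -> nat) : seq (seq nat) :=
  mkseq (fun i => mkseq (f i) (N i)) n.

Lemma seq_of_fun_level N f i : i < n -> level_map (seq_of_fun N f) i = mkseq (f i) (N i).
Proof. by move=> lti; rewrite /level_map nth_mkseq. Qed.

Lemma seq_of_fun_ev N f i x : i < n -> x < N i -> ev (seq_of_fun N f) i x = f i x.
Proof. by move=> lti xi; rewrite /ev seq_of_fun_level // nth_mkseq. Qed.

Lemma ptree_of_fun (N : nat -> nat) (g : nat -> nat -> nat) :
  N n = 1 ->
  (forall i x, i < n -> x < N i -> g i x < N i.+1) ->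
  (forall i x y, i < n -> x <= y -> y < N i -> g i x <= g i y) ->
  (forall i y, i < n -> y < N i.+1 -> exists2 x, x < N i & g i x = y) ->
  exists r : ptree n, (forall i, i <= n -> lsize r i = N i) /\
    forall i x, i < n -> x < N i -> ev r i x = g i x.
Proof.
move=> Nn bg mg sg; pose v := seq_of_fun N g.
have sz i : i <= n -> lsize v i = N i.
  rewrite leq_eqVlt => /orP[/eqP->|lti].
    by rewrite /lsize level_map_out ?size_mkseq.
  by rewrite /lsize seq_of_fun_level // size_mkseq.
have vP : is_ptree n v.
  rewrite /is_ptree size_mkseq eqxx /=; apply/forallP=> i.
  have lti := ltn_ord i; rewrite !sz ?(ltnW lti) // seq_of_fun_level //.
  apply/andP; split.
    apply/(sortedP 0) => x; rewrite size_mkseq => xi.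
    by rewrite !nth_mkseq ?(ltnW xi) //; apply: mg => //; apply: ltnW.
  apply/and3P; split; first by rewrite size_mkseq.
    by apply/allP => y /mapP[x]; rewrite mem_iota => xi ->; apply: bg.
  apply/allP => y; rewrite mem_iota /= add0n => yi.
  by have [x xi <-] := sg _ _ lti yi; apply: map_f; rewrite mem_iota.
exists (PTree vP); split=> [i lei|i x lti xi]; first exact: sz.
exact: seq_of_fun_ev.
Qed.

Lemma mor_of_fun t s (f : nat -> nat -> nat) :
  (forall i x, i < n -> x < lsize t i -> f i x < lsize s i) ->
  (forall i y, i < n -> y < lsize s i -> exists2 x, x < lsize t i & f i x = y) ->
  (forall i x, i.+1 < n -> x < lsize t i -> f i.+1 (ev t i x) = ev s i (f i x)) ->
  (forall i x y, i < n -> x <= y -> y < lsize t i -> ev t i x = ev t i y ->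
     f i x <= f i y) ->
  exists u : mor t s, forall i x, i < n -> x < lsize t i -> ev u i x = f i x.
Proof.
move=> bf sf cf mf; pose v := seq_of_fun (lsize t) f.
have vP : is_mor n t s v.
  apply/and4P; split; first by rewrite size_mkseq.
  - apply/forallP=> i; have lti := ltn_ord i; rewrite seq_of_fun_level //.
    apply/and3P; split; first by rewrite size_mkseq.
      by apply/allP => y /mapP[x]; rewrite mem_iota => xi ->; apply: bf.
    apply/allP => y; rewrite mem_iota /= add0n => yi.
    by have [x xi <-] := sf _ _ lti yi; apply: map_f; rewrite mem_iota.
  - apply/forallP=> i; apply/forallP=> x; have lti := ltn_ord i; have xi := ltn_ord x.
    rewrite (seq_of_fun_ev _ lti) //.
    move: lti; rewrite leq_eqVlt => /orP[/eqP e|lti].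
      have := ptree_lt (ltn_ord i) xi; have := ptree_lt (ltn_ord i) (bf _ _ (ltn_ord i) xi).
      rewrite e !lsize_root /ev [level_map v n]level_map_out ?size_mkseq // -/(ev t _ _).
      by rewrite !ltnS !leqn0 => /eqP -> /eqP ->.
    by rewrite seq_of_fun_ev // ?cf // ptree_lt // ltnW.
  - apply/forallP=> i; apply/forallP=> x; apply/forallP=> y; apply/implyP => /andP[xy /eqP e].
    by rewrite !seq_of_fun_ev // mf.
by exists (Mor vP) => i x lti xi; apply: seq_of_fun_ev.
Qed.

Definition coarser t (w W : seq (seq nat)) : Prop :=
  forall i x y, i < n -> x < lsize t i -> y < lsize t i ->
    ev w i.+1 (ev t i x) = ev w i.+1 (ev t i y) -> ev w i x <= ev w i y ->
    ev W i x <= ev W i y.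

Lemma coarser_comp t r s (v : mor r s) (w : mor t r) : coarser t w (mcomp v w).
Proof.
move=> i x y lti xi yi; have lei := ltnW lti.
rewrite !mor_comm // !ev_comp // => e le; apply: mor_fib => //.
exact: ev_mor.
Qed.

Lemma mor_preimage t r (w : mor t r) : exists p : nat -> nat -> nat,
  forall i c, i <= n -> c < lsize r i -> p i c < lsize t i /\ ev w i (p i c) = c.
Proof.
exists (fun i c => index c [seq ev w i x | x <- iota 0 (lsize t i)]) => i c lei ci.
have cin : c \in [seq ev w i x | x <- iota 0 (lsize t i)].
  by case: (mor_surj w lei ci) => x xi <-; apply: map_f; rewrite mem_iota.
have jl := cin; rewrite -index_mem size_map size_iota in jl.
split=> //; have := nth_index 0 cin.
by rewrite (nth_map 0) ?size_iota // nth_iota.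
Qed.

Lemma coarser_factor t r s (w : mor t r) (W : mor t s) : coarser t w W ->
  exists v : mor r s, mcomp v w = W.
Proof.
move=> H; have [p pP] := mor_preimage w.
have lei i : i < n -> i <= n by apply: ltnW.
have Heq i x y : i < n -> x < lsize t i -> y < lsize t i -> ev w i x = ev w i y ->
    ev W i x = ev W i y.
  move=> lti xi yi e; have e' := mor_pareq lti xi yi e.
  by apply/eqP; rewrite eqn_leq !H // e.
have E i x : i < n -> x < lsize t i -> ev W i (p i (ev w i x)) = ev W i x.
  move=> lti xi; have [pl pe] := pP i (ev w i x) (lei _ lti) (ev_mor w (lei _ lti) xi).
  exact: Heq.
have [||||v vE] := @mor_of_fun r s (fun i c => ev W i (p i c)).
- by move=> i c lti ci; have [pl pe] := pP i c (lei _ lti) ci; apply: ev_mor => //; exact: lei.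
- move=> i y lti yi; have [x xi <-] := mor_surj W (lei _ lti) yi.
  by exists (ev w i x); [apply: ev_mor => //; exact: lei | apply: E].
- move=> i c lti ci; have [pl pe] := pP i c (lei _ (ltnW lti)) ci.
  rewrite -mor_comm ?(ltnW lti) //.
  rewrite -{1}pe -mor_comm ?(ltnW lti) //; apply: E => //; apply: ptree_lt => //; exact: ltnW.
- move=> i c d lti cd di e; have ci := leq_ltn_trans cd di.
  have [pc ec] := pP i c (lei _ lti) ci; have [pd ed] := pP i d (lei _ lti) di.
  by apply: H; rewrite ?ec ?ed // !mor_comm // ec ed e.
exists v; apply: mor_eq => i x lti xi.
have lein := lei _ lti; by rewrite ev_comp // vE ?E // ev_mor.
Qed.

Fixpoint lexi_key t (loc : nat -> nat -> nat) (M d x : nat) : nat :=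
  if d is d'.+1 then lexi_key t loc M d' (ev t (n - d) x) * M + loc (n - d) x else 0.

Lemma sorted_index_leq (L : seq nat) a b : sorted ltn L -> a \in L -> b \in L ->
  (index a L <= index b L) = (a <= b).
Proof.
move=> so aL bL; have lt := sorted_ltn_nth ltn_trans 0 so.
have H c d : c \in L -> d \in L -> index c L < index d L -> c < d.
  move=> cL dL; have := lt (index c L) (index d L).
  by rewrite !inE !index_mem !nth_index // => h /(h cL dL).
case: (ltngtP (index a L) (index b L)) => h.
- by rewrite ltnW // H.
- by have := H _ _ bL aL h; rewrite ltnNge => /negbTE.
- by rewrite -(nth_index 0 aL) h nth_index // leqnn.
Qed.

Lemma build_quotient t (loc : nat -> nat -> nat) :
  (forall i x y, i < n -> x <= y -> y < lsize t i -> ev t i x = ev t i y ->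
     loc i x <= loc i y) ->
  exists r (w : mor t r), forall i x y, i < n -> x < lsize t i -> y < lsize t i ->
    (ev w i x <= ev w i y) =
    (ev w i.+1 (ev t i x) < ev w i.+1 (ev t i y)) ||
    ((ev w i.+1 (ev t i x) == ev w i.+1 (ev t i y)) && (loc i x <= loc i y)).
Proof.
move=> mloc.
pose M := (\max_(i < n) \max_(x < lsize t i) loc i x).+1.
have locM i x : i < n -> x < lsize t i -> loc i x < M.
  move=> lti xi; rewrite ltnS.
  apply: leq_trans (leq_bigmax (Ordinal lti)) => /=.
  exact: (leq_bigmax (Ordinal xi)).
pose K i x := lexi_key t loc M (n - i) x.
have KE i x : i < n -> K i x = K i.+1 (ev t i x) * M + loc i x.
  move=> lti; rewrite /K -[in LHS](subnSK lti) /=.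
  by have -> : n - (n - i.+1).+1 = i by lia.
have Kle i x y : i < n -> x < lsize t i -> y < lsize t i -> (K i x <= K i y) =
    (K i.+1 (ev t i x) < K i.+1 (ev t i y)) ||
    ((K i.+1 (ev t i x) == K i.+1 (ev t i y)) && (loc i x <= loc i y)).
  move=> lti xi yi; rewrite (KE i x lti) (KE i y lti); have := locM _ _ lti xi; have := locM _ _ lti yi.
  case: (ltngtP (K i.+1 (ev t i x)) (K i.+1 (ev t i y))) => /= [h|h|->] ? ?.
  - have : (K i.+1 (ev t i x)).+1 * M <= K i.+1 (ev t i y) * M by rewrite leq_mul2r h orbT.
    rewrite mulSn; lia.
  - have : (K i.+1 (ev t i y)).+1 * M <= K i.+1 (ev t i x) * M by rewrite leq_mul2r h orbT.
    rewrite mulSn; lia.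
  - by rewrite leq_add2l.
pose S i := [seq K i x | x <- iota 0 (lsize t i)].
pose L i := sort leq (undup (S i)).
have Lso i : sorted ltn (L i).
  by rewrite ltn_sorted_uniq_leq sort_uniq undup_uniq /= sort_sorted //; apply: leq_total.
have Lmem i x : x < lsize t i -> K i x \in L i.
  by move=> xi; rewrite mem_sort mem_undup; apply: map_f; rewrite mem_iota.
pose F i x := index (K i x) (L i).
pose N i := size (L i).
have FN i x : x < lsize t i -> F i x < N i by move=> xi; rewrite index_mem Lmem.
have FK i x y : x < lsize t i -> y < lsize t i -> (F i x <= F i y) = (K i x <= K i y).
  by move=> xi yi; apply: sorted_index_leq; rewrite ?Lmem.
have Fsurj i c : c < N i -> exists2 x, x < lsize t i & F i x = c.
  move=> ci; have : nth 0 (L i) c \in L i by apply: mem_nth.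
  rewrite mem_sort mem_undup => /mapP[x]; rewrite mem_iota /= add0n => xi e.
  by exists x => //; rewrite /F -e index_uniq // sort_uniq undup_uniq.
have FKeq i x y : x < lsize t i -> y < lsize t i -> (F i x == F i y) = (K i x == K i y).
  by move=> xi yi; rewrite !eqn_leq !FK.
have FKlt i x y : x < lsize t i -> y < lsize t i -> (F i x < F i y) = (K i x < K i y).
  by move=> xi yi; rewrite !ltnNge FK.
have Kpar i x y : i < n -> x < lsize t i -> y < lsize t i -> K i x <= K i y ->
    K i.+1 (ev t i x) <= K i.+1 (ev t i y).
  by move=> lti xi yi; rewrite Kle // => /orP[/ltnW|/andP[/eqP->]].
pose p i c := index c [seq F i x | x <- iota 0 (lsize t i)].
have pP i c : c < N i -> p i c < lsize t i /\ F i (p i c) = c.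
  move=> ci; have cin : c \in [seq F i x | x <- iota 0 (lsize t i)].
    by case: (Fsurj _ _ ci) => x xi <-; apply: map_f; rewrite mem_iota.
  have jl := cin; rewrite -index_mem size_map size_iota in jl.
  split=> //; have := nth_index 0 cin.
  by rewrite (nth_map 0) ?size_iota // nth_iota.
have [||||r [szr evr]] := @ptree_of_fun N (fun i c => F i.+1 (ev t i (p i c))).
- have e : L n = [:: 0].
    by rewrite /L /S lsize_root /= /K subnn.
  by rewrite /N e.
- by move=> i c lti ci; apply: FN; apply: ptree_lt => //; case: (pP i c ci).
- move=> i c d lti cd di; have ci := leq_ltn_trans cd di.
  have [pc ec] := pP i c ci; have [pd ed] := pP i d di.
  rewrite FK ?ptree_lt //; apply: Kpar => //.
  by rewrite -FK // ec ed.
- move=> i y lti yi; have [z zi ez] := Fsurj _ _ yi.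
  have [x xi ex] : exists2 x, x < lsize t i & ev t i x = z.
    case/andP: (ptreeP t) => _ /forallP /(_ (Ordinal lti)) /andP[_].
    case/and3P => _ _ /allP /(_ z); rewrite mem_iota /= add0n => /(_ zi) /(nthP 0)[x xi <-].
    by exists x.
  exists (F i x); first exact: FN.
  have [pc ec] := pP i _ (FN _ _ xi).
  rewrite -ez -ex; apply/eqP; rewrite FKeq ?ptree_lt //.
  have /eqP := ec; rewrite FKeq // => /eqP eK.
  by rewrite eqn_leq !Kpar // eK.
have [||||w wE] := @mor_of_fun t r F.
- by move=> i x lti xi; rewrite szr ?FN // ltnW.
- by move=> i y lti; rewrite szr ?(ltnW lti) // => /Fsurj.
- move=> i x lti' xi; have lti := ltnW lti'; rewrite evr // ?FN //.
  have [pc ec] := pP i _ (FN _ _ xi).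
  apply/eqP; rewrite FKeq ?ptree_lt //; have /eqP := ec; rewrite FKeq // => /eqP eK.
  by rewrite eqn_leq !Kpar // eK.
- move=> i x y lti xy yi e; have xi := leq_ltn_trans xy yi.
  by rewrite FK // Kle // e eqxx mloc // orbT.
have wE' i x : i <= n -> x < lsize t i -> ev w i x = F i x.
  rewrite leq_eqVlt => /orP[/eqP->|lti]; last exact: wE.
  move=> xi; rewrite mor_root //; have := FN _ _ xi; rewrite -szr // lsize_root.
  by case: (F n x).
exists r, w => i x y lti xi yi; rewrite !wE' ?ptree_lt // ?(ltnW lti) //.
by rewrite FK // FKeq ?FKlt ?ptree_lt // Kle.
Qed.

End Construct.

(** * The matching on the quotients of a tree *)

Section Matching.
Variable n : nat.
Implicit Types t r s : ptree n.

Definition lexlt (i x j y : nat) : bool := (i < j) || ((i == j) && (x < y)).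

Definition crit t (w u : seq (seq nat)) (i x : nat) : Prop :=
  forall y, x < y -> y < lsize t i -> ev u i y = ev u i x ->
    ev w i.+1 (ev t i y) = ev w i.+1 (ev t i x) -> ev w i y < ev w i x.

Definition first_noncrit t (w u : seq (seq nat)) (i x : nat) : Prop :=
  [/\ i < n, x < lsize t i, ~ crit t w u i x &
      forall j z, j < n -> z < lsize t j -> lexlt j z i x -> crit t w u j z].

Definition nonalone t (w : seq (seq nat)) (i x : nat) : Prop :=
  exists y, [/\ x < y, y < lsize t i & ev w i y = ev w i x].

(* [w] is the coarser element of its matched pair among the quotients below [u]. *)
Definition up t (w u : seq (seq nat)) : Prop :=
  exists i x, first_noncrit t w u i x /\ nonalone t w i x.

Lemma first_noncrit_uniq t w u i x j y :
  first_noncrit t w u i x -> first_noncrit t w u j y -> i = j /\ x = y.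
Proof.
case=> li xi ni mi [lj yj nj mj].
case: (boolP (lexlt i x j y)) => [/(mj _ _ li xi)//|h1].
case: (boolP (lexlt j y i x)) => [/(mi _ _ lj yj)//|h2].
move: h1 h2; rewrite /lexlt; lia.
Qed.

Lemma first_noncritP t w u : (exists i x, [/\ i < n, x < lsize t i & ~ crit t w u i x]) ->
  exists i x, first_noncrit t w u i x.
Proof.
move=> ex.
have exi : exists i, `[< exists x, [/\ i < n, x < lsize t i & ~ crit t w u i x] >].
  by case: ex => i [x H]; exists i; apply/asboolP; exists x.
case: (ex_minnP exi) => i /asboolP ei mi.
have exx : exists x, `[< [/\ i < n, x < lsize t i & ~ crit t w u i x] >].
  by case: ei => x H; exists x; apply/asboolP.
case: (ex_minnP exx) => x /asboolP [li xi nc] mx.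
exists i, x; split=> // j z lj zj lt; apply: contrapT => nz.
case/orP: lt => [lt|/andP[/eqP e lt]].
  have : i <= j by apply: mi; apply/asboolP; exists z.
  by rewrite leqNgt lt.
subst j; have : x <= z by apply: mx; apply/asboolP.
by rewrite leqNgt lt.
Qed.

Lemma first_noncrit_ex t r s (w : mor t r) (u : mor t s) : ~~ is_id u ->
  exists i x, first_noncrit t w u i x.
Proof.
move=> nid; apply: first_noncritP; apply: contrapT => nex.
have cr i x : i < n -> x < lsize t i -> crit t w u i x.
  by move=> lti xi; apply: contrapT => nc; apply: nex; exists i, x.
move/negP: nid; apply.
have K d i : d = n - i -> i <= n -> lsize s i = lsize t i.
  elim: d {-2}d (leqnn d) i => [|d IH] d' ld i ed lei.
    have -> : i = n by lia.
    by rewrite !lsize_root.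
  case: (ltngtP i n) lei => // [lti _|-> _]; last by rewrite !lsize_root.
  have idl j x : i.+1 <= j <= n -> x < lsize t j -> ev u j x = x.
    by apply: (@mor_id_above n t s u i.+1) => k' hk; apply: (IH (n - k')) => //; lia.
  apply/(mor_inj_size u (ltnW lti)) => x y xy yi; apply/eqP => e.
  have xi := ltn_trans xy yi; have := mor_pareq lti xi yi e.
  rewrite !idl ?ptree_lt //; try lia; move=> ep.
  have := cr i x lti xi y xy yi (esym e); rewrite ep => /(_ erefl).
  have := mor_fib w lti (ltnW xy) yi ep; lia.
by apply: mor_is_id => i lti; apply: (K (n - i)) => //; apply: ltnW.
Qed.

Lemma coarser_eq t r (w : mor t r) W i x y : coarser t w W -> i < n ->
  x < lsize t i -> y < lsize t i -> ev w i x = ev w i y -> ev W i x = ev W i y.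
Proof.
move=> co lti xi yi e; have ep := mor_pareq lti xi yi e.
by apply/eqP; rewrite eqn_leq !co // e.
Qed.

Lemma coarser_pareq t r s (w : mor t r) (W : mor t s) i x y : coarser t w W -> i <= n ->
  x < lsize t i -> y < lsize t i -> ev w i x = ev w i y -> ev W i x = ev W i y.
Proof.
move=> co; rewrite leq_eqVlt => /orP[/eqP->|lti]; last exact: coarser_eq.
by move=> xi yi _; rewrite !mor_root.
Qed.

Lemma nonalone_noncrit t r s (w : mor t r) (u : mor t s) i x : coarser t w u ->
  i < n -> nonalone t w i x -> ~ crit t w u i x.
Proof.
move=> co lti [y [xy yi e]] cr; have xi := ltn_trans xy yi.
have := cr y xy yi (coarser_eq co lti yi xi e) (mor_pareq lti yi xi e).
by rewrite e ltnn.
Qed.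

Lemma first_noncrit_alone t r s (w : mor t r) (u : mor t s) i x : coarser t w u ->
  ~ up t w u -> first_noncrit t w u i x ->
  forall y, y < lsize t i -> ev w i y = ev w i x -> y = x.
Proof.
move=> co nup fn y yi e; case: (fn) => lti xi nc mn.
case: (ltngtP y x) => // [yx|xy].
  have /mn : lexlt i y i x by rewrite /lexlt eqxx yx orbT.
  move=> /(_ lti yi) cr; exfalso; apply: (nonalone_noncrit co lti _ cr).
  by exists x.
by exfalso; apply: nup; exists i, x; split=> //; exists y.
Qed.

Lemma crit_inj t r s (w : mor t r) (u : mor t s) i x y : coarser t w u -> i < n ->
  (forall z, z < lsize t i -> crit t w u i z) ->
  x < lsize t i -> y < lsize t i -> ev w i x = ev w i y -> x = y.
Proof.
move=> co lti cr xi yi e; case: (ltngtP x y) => // h; exfalso.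
  by apply: (nonalone_noncrit co lti _ (cr x xi)); exists y.
by apply: (nonalone_noncrit co lti _ (cr y yi)); exists x.
Qed.

(* The matching partner of w below u: the vertex x is merged with the block
   that follows it, and the levels below are reordered decreasingly. *)
Lemma partner_ex t r s (w : mor t r) (u : mor t s) j x :
  coarser t w u -> ~ up t w u -> first_noncrit t w u j x ->
  exists r' (W : mor t r'),
  [/\ [/\ coarser t w W, coarser t W u & ~ up t w W],
      first_noncrit t W u j x /\ nonalone t W j x,
      (forall i z, j < i <= n -> z < lsize t i -> ev W i z = ev w i z),
      (forall z, z < lsize t j -> ev W j z = ev w j z - (ev w j x < ev w j z)) &
      exists m : mor r r', merge_level r m j (ev w j x) /\ mcomp m w = W].
Proof.
move=> co nup fn; have alone := first_noncrit_alone co nup fn.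
case: (fn) => ltj xj nc mn; have lej := ltnW ltj.
have [v vE] := coarser_factor co.
have [y [xy yj uy py wy]] : exists y, [/\ x < y, y < lsize t j, ev u j y = ev u j x,
    ev w j.+1 (ev t j y) = ev w j.+1 (ev t j x) & ev w j x < ev w j y].
  apply: contrapT => nex; apply: nc => y xy yj uy py; rewrite ltnNge; apply/negP => le.
  apply: nex; exists y; split=> //; rewrite ltn_neqAle le andbT; apply/eqP => e.
  by have := alone y yj (esym e); lia.
set c := ev w j x in wy *.
have cr : c.+1 < lsize r j by apply: leq_ltn_trans wy _; apply: ev_mor.
have rc : ev r j c = ev r j c.+1.
  apply/eqP; rewrite eqn_leq ptree_mono //=.
  apply: leq_trans (ptree_mono ltj wy (ev_mor w lej yj)) _.
  by rewrite -!mor_comm // py.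
have vc : ev v j c = ev v j c.+1.
  apply/eqP; rewrite eqn_leq (mor_fib v ltj) //=.
  have -> : ev v j c = ev v j (ev w j y) by rewrite -!ev_comp // vE.
  apply: mor_fib => //; first exact: ev_mor.
  by rewrite -rc -!mor_comm.
have crlow i z : i < j -> z < lsize t i -> crit t w u i z.
  by move=> ij zi; apply: mn => //; [lia | rewrite /lexlt ij].
have uvE i z : i < n -> z < lsize t i -> ev u i z = ev v i (ev w i z).
  by move=> lti zi; rewrite -vE ev_comp // ltnW.
pose loc i z := if i < j then ev u i z * (lsize t i).+1 + (lsize t i - z)
  else if i == j then ev w i z - (c < ev w i z) else ev w i z.
have loclt i a b : i < j -> a < lsize t i -> b < lsize t i ->
    (loc i a <= loc i b) = (ev u i a < ev u i b) || ((ev u i a == ev u i b) && (b <= a)).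
  move=> ij ai bi; rewrite /loc ij.
  case: (ltngtP (ev u i a) (ev u i b)) => /= [h|h|->].
  - have : (ev u i a).+1 * (lsize t i).+1 <= ev u i b * (lsize t i).+1 by rewrite leq_mul2r h orbT.
    rewrite mulSn; lia.
  - have : (ev u i b).+1 * (lsize t i).+1 <= ev u i a * (lsize t i).+1 by rewrite leq_mul2r h orbT.
    rewrite mulSn; lia.
  - rewrite leq_add2l; lia.
have [|r' [W WE]] := @build_quotient n t loc.
  move=> i a b lti ab bi ep; have ai := leq_ltn_trans ab bi.
  case: (ltngtP i j) => ij.
  - rewrite loclt //; have := mor_fib u lti ab bi ep; rewrite leq_eqVlt => /orP[/eqP e|->//].
    rewrite e eqxx ltnn /=; move: ab; rewrite leq_eqVlt => /orP[/eqP->//|ab].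
    have := crlow i a ij ai b ab bi (esym e); rewrite ep => /(_ erefl).
    by rewrite ltnNge (mor_fib w lti (ltnW ab) bi ep).
  - have := mor_fib w lti ab bi ep; rewrite /loc ltnNge (ltnW ij) /= gtn_eqF //.
  - have := mor_fib w lti ab bi ep; subst i; rewrite /loc ltnn eqxx; lia.
have Wabove i z : j < i <= n -> z < lsize t i -> ev W i z = ev w i z.
  apply: (@mor_det_above n _ _ _ W w j.+1) => {z}{}i a b /andP[ji lti] ai bi ep Hz.
  by rewrite WE // ep ltnn eqxx /= /loc ltnNge (ltnW ji) /= gtn_eqF.
have Wpar z : z < lsize t j -> ev W j.+1 (ev t j z) = ev w j.+1 (ev t j z).
  by move=> zj; rewrite Wabove ?ptree_lt //; lia.
have locj z : loc j z = ev w j z - (c < ev w j z) by rewrite /loc ltnn eqxx.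
have ordj a b : a < lsize t j -> b < lsize t j -> (ev W j a <= ev W j b) = (loc j a <= loc j b).
  move=> aj bj; rewrite WE // !Wabove ?ptree_lt //; try lia.
  case: (ltngtP (ev w j.+1 (ev t j a)) (ev w j.+1 (ev t j b))) => /= h.
  - by have := mor_parlt ltj aj bj h; rewrite !locj; lia.
  - have := mor_parlt ltj bj aj h; rewrite !locj => lt.
    case: (leqP c.+2 (ev w j a)) => h2; first lia.
    case: (leqP c (ev w j b)) => h3; last lia.
    have ea : ev w j a = c.+1 by lia.
    have eb : ev w j b = c by lia.
    by move: h; rewrite !mor_comm // ea eb rc ltnn.
  - by [].
have Wj z : z < lsize t j -> ev W j z = ev w j z - (c < ev w j z).
  move=> zj; rewrite -locj; apply/eqP; rewrite eqn_leq; apply/andP; split.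
    apply: (@order_le (lsize r' j) (lsize t j)) => //.
      by move=> q qj; apply: mor_surj.
    by move=> q qj; apply: ev_mor.
  apply: (@order_le (lsize r j).-1 (lsize t j) (loc j) (ev W j)) => //.
  - move=> q qj; case: (leqP q c) => qc.
      have [q' q'j e] := mor_surj w lej (y := q) ltac:(lia).
      by exists q' => //; rewrite locj e; lia.
    have [q' q'j e] := mor_surj w lej (y := q.+1) ltac:(lia).
    by exists q' => //; rewrite locj e; lia.
  - by move=> q qj; have := ev_mor w lej qj; rewrite locj; lia.
  - by move=> a b aj bj; rewrite ordj.
have injlow i a b : i < j -> a < lsize t i -> b < lsize t i -> ev W i a = ev W i b -> a = b.
  move=> ij ai bi e; have lti : i < n by lia.
  have ep := mor_pareq lti ai bi e.
  have := WE i a b lti ai bi; have := WE i b a lti bi ai.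
  rewrite e ep leqnn ltnn eqxx /= !loclt //; lia.
have Weqpar i a b : i <= n -> a < lsize t i -> b < lsize t i -> ev w i a = ev w i b ->
    ev W i a = ev W i b.
  move=> lei ai bi e; case: (ltngtP i j) => ij.
  - have lti : i < n by lia.
    by rewrite (crit_inj co lti _ ai bi e) // => z zi; apply: crlow.
  - by rewrite !Wabove ?ij.
  - by subst i; rewrite !Wj // e.
have cowW : coarser t w W.
  move=> i a b lti ai bi ep le; case: (ltngtP i j) => ij.
  - rewrite WE // (Weqpar i.+1 (ev t i a) (ev t i b)) ?ptree_lt // ltnn eqxx /= loclt //.
    have := co i a b lti ai bi ep le; rewrite leq_eqVlt => /orP[/eqP e|->//].
    rewrite e ltnn eqxx /= leqNgt; apply/negP => ab.
    by have := crlow i a ij ai b ab bi (esym e) (esym ep); rewrite ltnNge le.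
  - by rewrite !Wabove // ?ij; lia.
  - by subst i; rewrite !Wj //; lia.
have coWu : coarser t W u.
  move=> i a b lti ai bi ep le; case: (ltngtP i j) => ij.
  - by move: le; rewrite WE // ep ltnn eqxx /= loclt //; lia.
  - move: ep le; rewrite !Wabove ?ptree_lt ?ij //; [exact: co | lia..].
  - subst i; move: ep le; rewrite !Wpar // => ep.
    rewrite !Wj // => le.
    case: (leqP (ev w j a) (ev w j b)) => h; first exact: co.
    have ea : ev w j a = c.+1 by lia.
    have eb : ev w j b = c by lia.
    by rewrite !uvE // ea eb vc.
have succ z : z < lsize t j -> ev w j z = c.+1 -> x < z.
  move=> zj ez; case: (ltngtP x z) => // [zx|e]; last by move: ez; rewrite -e -/c; lia.
  have := mn j z ltj zj; rewrite /lexlt eqxx zx orbT => /(_ isT) /(_ y) cz.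
  have := cz (ltn_trans zx xy) yj; rewrite ez ltnNge wy => K; exfalso; suff : false by [].
  apply: K; first by rewrite uy !uvE // ez -/c vc.
  by rewrite py !mor_comm // ez -/c rc.
have [z zj ez] := mor_surj w lej cr.
have critW i a : i < n -> a < lsize t i -> lexlt i a j x -> crit t W u i a.
  move=> lti ai; case/orP=> [ij|/andP[/eqP e ax]] b ab bi ub pb.
    rewrite ltnNge WE // pb ltnn eqxx /= loclt //; lia.
  subst i; move: pb; rewrite !Wpar // => pb.
  have lx : lexlt j a j x by rewrite /lexlt eqxx ax orbT.
  have := mn j a ltj ai lx b ab bi ub pb; rewrite !Wj // => lt.
  case: (leqP (ev w j a) c) => h1; first lia.
  case: (leqP c.+1 (ev w j b)) => h2; first lia.
  case: (leqP c.+2 (ev w j a)) => h3; first lia.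
  case: (leqP c (ev w j b)) => h4; last lia.
  have := succ a ai ltac:(lia); lia.
have naW : nonalone t W j x.
  by exists z; split=> //; [exact: succ | rewrite !Wj // ez -/c; lia].
exists r', W; split=> //.
- split=> // -[i [a [[lti ai nca mna] [b [ab bi eb]]]]].
  case: (boolP (lexlt i a j x)) => h1.
    have := mn i a lti ai h1; apply: nonalone_noncrit => //; by exists b.
  case: (boolP (lexlt j x i a)) => h2.
    have := mna j x ltj xj h2 z (succ z zj ez) zj.
    rewrite !Wj // ez -/c => K; suff : c.+1 < c by lia.
    by apply: K; [lia | rewrite !mor_comm // ez -/c rc].
  have [e1 e2] : i = j /\ a = x by move: h1 h2; rewrite /lexlt; lia.
  by subst i a; have := alone b bi eb; lia.
- split=> //; split=> //; exact: nonalone_noncrit naW.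
have [m mE] := coarser_factor cowW; exists m; split=> //.
have mw i a : i <= n -> a < lsize t i -> ev m i (ev w i a) = ev W i a.
  by move=> lei ai; rewrite -mE ev_comp.
split=> //.
- move=> i a /andP[ji lei] ai; have [a' a'i <-] := mor_surj w lei ai.
  by rewrite mw // Wabove // ji.
- split=> [a ai|i a b ij ai bi].
    by have [a' a'i <-] := mor_surj w lej ai; rewrite mw // Wj.
  have lei : i <= n by lia.
  have [a' a'i <-] := mor_surj w lei ai; have [b' b'i <-] := mor_surj w lei bi.
  by rewrite !mw // => /(injlow _ _ _ ij a'i b'i) ->.
Qed.

End Matching.

Section CanonicalFactorization.
Variable n : nat.
Implicit Types t r s : ptree n.

Lemma critWW t s (W : mor t s) i x : i < n -> x < lsize t i ->
  crit t W W i x <-> ~ nonalone t W i x.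
Proof.
move=> lti xi; split=> [cr [y [xy yi e]]|na y xy yi e].
  by have := cr y xy yi e (mor_pareq lti yi xi e); rewrite e ltnn.
by exfalso; apply: na; exists y.
Qed.

Lemma coarser_refl t s (W : mor t s) : coarser t W W.
Proof. by []. Qed.

(* The converse operation: the first vertex of W that shares its block with a
   later vertex is split off, in front of the rest of its block. *)
Lemma canonical_ex t s (W : mor t s) : ~~ is_id W ->
  exists r (m : mor r s) (a : mor t r),
    [/\ mcomp m a = W, mdeg m = 1%R & ~ up t a W].
Proof.
move=> nid; have [j [x fn]] := first_noncrit_ex W nid.
case: (fn) => ltj xj nc mn; have lej := ltnW ltj.
have [y [xy yj ey]] : nonalone t W j x by apply: contrapT => h; apply/nc/critWW.
have al i z : i < n -> z < lsize t i -> lexlt i z j x -> ~ nonalone t W i z.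
  by move=> lti zi lx; apply/critWW => //; apply: mn.
pose loc i z := 2 * ev W i z + ((i != j) || (z != x)).
have [|r [a aE]] := @build_quotient n t loc.
  move=> i p q lti pq qi ep; have pi := leq_ltn_trans pq qi; rewrite /loc.
  have := mor_fib W lti pq qi ep; case: (eqVneq i j) => [e|] /=; last lia.
  subst i; case: (eqVneq q x) => [e|]; last lia.
  subst q; case: (eqVneq p x) => [->|px]; first lia.
  rewrite leq_eqVlt => /orP[/eqP e|]; last lia.
  have px' : p < x by lia.
  exfalso; apply: (al j p ltj pi); first by rewrite /lexlt eqxx px' orbT.
  by exists x.
have above i z : j < i <= n -> z < lsize t i -> ev a i z = ev W i z.
  apply: (@mor_det_above n _ _ _ a W j.+1) => {z}{}i p q /andP[ji lti] pi qi ep Hz.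
  by rewrite aE // ep ltnn eqxx /= /loc gtn_eqF //=; lia.
have par z : z < lsize t j -> ev a j.+1 (ev t j z) = ev W j.+1 (ev t j z).
  by move=> zj; rewrite above ?ptree_lt //; lia.
pose c := ev W j x.
pose g z := ev W j z + ((c <= ev W j z) && (z != x)).
have ordj p q : p < lsize t j -> q < lsize t j -> (ev a j p <= ev a j q) = (g p <= g q).
  move=> pj qj; rewrite aE // !par // /g /loc eqxx /=.
  case: (ltngtP (ev W j.+1 (ev t j p)) (ev W j.+1 (ev t j q))) => /= h.
  - by have := mor_parlt ltj pj qj h; lia.
  - have := mor_parlt ltj qj pj h.
    case: (eqVneq p x) => [->|px]; rewrite -?/c; lia.
  - case: (eqVneq p x) => [->|px]; case: (eqVneq q x) => [->|qx] /=; rewrite -/c; lia.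
have aj z : z < lsize t j -> ev a j z = g z.
  move=> zj; apply/eqP; rewrite eqn_leq; apply/andP; split.
    apply: (@order_le (lsize r j) (lsize t j)) => //.
      by move=> q qj; apply: mor_surj.
    by move=> q qj; apply: ev_mor.
  apply: (@order_le (lsize s j).+1 (lsize t j) g (ev a j)) => //.
  - move=> q qj; case: (ltngtP q c) => qc.
    + have cs : c < lsize s j by apply: ev_mor.
      have [q' q'j e] := mor_surj W lej (y := q) ltac:(lia).
      by exists q' => //; rewrite /g e; lia.
    + have [q' q'j e] := mor_surj W lej (y := q.-1) ltac:(lia).
      case: (eqVneq q' x) => [e'|nq].
        subst q'; exists y => //; rewrite /g; have -> : y != x by lia.
        by rewrite ey -/c leqnn /=; rewrite -/c in e; lia.
      by exists q' => //; rewrite /g e nq; lia.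
    + by exists x => //; rewrite /g eqxx -/c; lia.
  - by move=> q qj; have := ev_mor W lej qj; rewrite /g; lia.
  - by move=> p q pj qj; rewrite ordj.
have coa : coarser t a W.
  move=> i p q lti pi qi ep; rewrite aE // ep ltnn eqxx /= /loc; lia.
have [m mE] := coarser_factor coa; exists r, m, a.
have ma i z : i <= n -> z < lsize t i -> ev m i (ev a i z) = ev W i z.
  by move=> lei zi; rewrite -mE ev_comp.
have ax : ev a j x = c by rewrite aj // /g eqxx andbF addn0.
have ay : ev a j y = c.+1.
  by rewrite aj // /g ey -/c leqnn /=; lia.
split=> //.
  apply: (@merge_mdeg1 n _ _ _ j c); split=> //.
  - by rewrite -ay ev_mor.
  - by rewrite -ay -[X in ev r j X = _]ax -!mor_comm // !par // (mor_pareq ltj yj xj ey).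
  - move=> i z /andP[ji lei] zi; have [z' z'i <-] := mor_surj a lei zi.
    by rewrite ma // above // ji.
  split=> [z zj|i p q ij pi qi].
    have [z' z'j <-] := mor_surj a lej zj; rewrite ma // aj // /g.
    case: (eqVneq z' x) => [->|_]; rewrite -/c; lia.
  have lti : i < n by lia.
  have [p' p'i <-] := mor_surj a (ltnW lti) pi.
  have [q' q'i <-] := mor_surj a (ltnW lti) qi.
  rewrite !ma ?(ltnW lti) // => e; congr (ev a i _).
  case: (ltngtP p' q') => // h; exfalso.
    by apply: (al i p' lti p'i); [rewrite /lexlt ij | exists q'].
  by apply: (al i q' lti q'i); [rewrite /lexlt ij | exists p'].
move=> [i [p [[lti pi ncp mnp] [q [pq qi e]]]]].
have h1 : ~~ lexlt i p j x.
  apply/negP => lx; apply: (al i p lti pi lx); exists q; split=> //.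
  exact: coarser_eq coa lti qi pi e.
case: (boolP (lexlt j x i p)) => h2.
  have := mnp j x ltj xj h2 y xy yj ey; rewrite !par // (mor_pareq ltj yj xj ey) => /(_ erefl).
  by rewrite ax ay ltnNge leqnSn.
have [e1 e2] : i = j /\ p = x by move: h1 h2; rewrite /lexlt; lia.
subst i p; move: e; rewrite ax aj // /g; lia.
Qed.

Lemma canonical_shape t r s (m : mor r s) (a : mor t r) (W : mor t s) :
  mcomp m a = W -> mdeg m = 1%R -> ~ up t a W ->
  exists j x, [/\ first_noncrit t W W j x,
    (forall i z, j < i <= n -> z < lsize t i -> ev a i z = ev W i z) &
    (forall z, z < lsize t j ->
       ev a j z = ev W j z + ((ev W j x <= ev W j z) && (z != x)))].
Proof.
move=> mE m1 nup; have coa : coarser t a W by rewrite -mE; apply: coarser_comp.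
have nidW : ~~ is_id W.
  rewrite -mdeg0 -mE mdegM m1; have := mdeg_ge0 a; lia.
have [j [x fn]] := first_noncrit_ex a nidW.
have alone := first_noncrit_alone coa nup fn.
case: (fn) => ltj xj nc mn; have lej := ltnW ltj.
have ma i z : i <= n -> z < lsize t i -> ev W i z = ev m i (ev a i z).
  by move=> lei zi; rewrite -mE ev_comp.
have [y [xy yj ey py ay]] : exists y, [/\ x < y, y < lsize t j, ev W j y = ev W j x,
    ev a j.+1 (ev t j y) = ev a j.+1 (ev t j x) & ev a j x < ev a j y].
  apply: contrapT => nex; apply: nc => y xy yj uy py; rewrite ltnNge; apply/negP => le.
  apply: nex; exists y; split=> //; rewrite ltn_neqAle le andbT; apply/eqP => e.
  by have := alone y yj (esym e); lia.
have [j' [c [ltj' cj' rc idl [mrg injl]]]] := mdeg1_merge m1.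
have ej : j' = j.
  case: (ltngtP j' j) => // h.
    by move: ey ay; rewrite !ma // !idl ?ev_mor ?h // => ->; rewrite ltnn.
  move: ey; rewrite !ma // => /(injl _ _ _ h) e.
  by move: ay; rewrite e ?ev_mor // ltnn.
subst j'.
have Wj z : z < lsize t j -> ev W j z = ev a j z - (c < ev a j z).
  by move=> zj; rewrite ma // mrg // ev_mor.
have above i z : j < i <= n -> z < lsize t i -> ev a i z = ev W i z.
  by move=> /andP[ji lei] zi; rewrite ma // idl // ?ev_mor ?ji.
have ax : ev a j x = c by move: ey; rewrite !Wj //; lia.
have ay' : ev a j y = c.+1 by move: ey; rewrite !Wj //; lia.
exists j, x; split=> //.
  split=> //.
    by move=> /critWW => /(_ ltj xj); apply; exists y.
  move=> i p lti pi lx; apply/critWW => // -[q [pq qi e]].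
  have crp := mn i p lti pi lx.
  case/orP: (lx) => [ij|/andP[/eqP eij px]].
    apply: (nonalone_noncrit coa lti _ crp); exists q; split=> //.
    move: e; rewrite !ma ?(ltnW lti) //; apply: injl => //; apply: ev_mor => //; exact: ltnW.
  subst i; have pe : ev a j.+1 (ev t j q) = ev a j.+1 (ev t j p).
    have := mor_pareq ltj qi pi e; rewrite !above ?ptree_lt //; lia.
  have lt := crp q pq qi e pe.
  have [aq ap] : ev a j q = c /\ ev a j p = c.+1 by move: e; rewrite !Wj //; lia.
  have qx : q = x by apply: alone; rewrite // aq ax.
  subst q; have yp : ev W j y = ev W j p by rewrite ey e.
  have := crp y ltac:(lia) yj yp; rewrite py pe => /(_ erefl); lia.
move=> z zj; rewrite !Wj // ax.
case: (eqVneq z x) => [->|zx]; first by rewrite ax; lia.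
have : ev a j z != c by apply/eqP => e; move/eqP: zx; apply; apply: alone; rewrite // e ax.
lia.
Qed.

Lemma canonical_uniq t r r' s (m : mor r s) (a : mor t r) (m' : mor r' s) (a' : mor t r')
  (W : mor t s) :
  mcomp m a = W -> mdeg m = 1%R -> ~ up t a W ->
  mcomp m' a' = W -> mdeg m' = 1%R -> ~ up t a' W -> mor_val a = mor_val a'.
Proof.
move=> mE m1 nup mE' m1' nup'.
have [j [x [fn above lj]]] := canonical_shape mE m1 nup.
have [j' [x' [fn' above' lj']]] := canonical_shape mE' m1' nup'.
have [e1 e2] := first_noncrit_uniq fn fn'; subst j' x'.
case: (fn) => ltj xj nc mn.
have coa : coarser t a W by rewrite -mE; apply: coarser_comp.
have coa' : coarser t a' W by rewrite -mE'; apply: coarser_comp.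
apply: mor_det => i p q lti pi qi ep Hz.
have ep' : ev a' i.+1 (ev t i p) = ev a' i.+1 (ev t i q) by rewrite -!Hz ?ptree_lt.
case: (ltngtP i j) => ij.
- have inj : ev W i p = ev W i q -> p = q.
    apply: (crit_inj (u := W) (@coarser_refl _ _ W) lti _ pi qi).
    by move=> z zi; apply: mn => //; rewrite /lexlt ij.
  apply/idP/idP => h; have := h; rewrite leqNgt; apply: contraTT.
    rewrite -ltnNge => h'; have := coa _ _ _ lti pi qi ep h.
    have := coa' _ _ _ lti qi pi (esym ep') (ltnW h') => h1 h2.
    have e : p = q by apply: inj; lia.
    by move: h'; rewrite e ltnn.
  rewrite -ltnNge => h'; have := coa' _ _ _ lti pi qi ep' h.
  have := coa _ _ _ lti qi pi (esym ep) (ltnW h') => h1 h2.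
  have e : p = q by apply: inj; lia.
  by move: h'; rewrite e ltnn.
- by rewrite !above ?above' // ij ltnW.
- by subst i; rewrite !lj ?lj'.
Qed.

Lemma crit_order t r s r' (W : mor t r) (W' : mor t r') (u : mor t s) i a b :
  coarser t W u -> coarser t W' u -> i < n ->
  (forall z, z < lsize t i -> crit t W u i z) ->
  (forall z, z < lsize t i -> crit t W' u i z) ->
  a < lsize t i -> b < lsize t i ->
  ev W i.+1 (ev t i a) = ev W i.+1 (ev t i b) ->
  ev W' i.+1 (ev t i a) = ev W' i.+1 (ev t i b) ->
  (ev W i a <= ev W i b) = (ev W' i a <= ev W' i b).
Proof.
move=> co co' lti cr cr' ai bi ep ep'.
case: (eqVneq (ev u i a) (ev u i b)) => [e|ne].
  case: (ltngtP a b) => [ab|ba|->]; last by rewrite !leqnn.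
    have := cr a ai b ab bi (esym e) (esym ep); have := cr' a ai b ab bi (esym e) (esym ep'); lia.
  have := cr b bi a ba ai e ep; have := cr' b bi a ba ai e ep'; lia.
have h1 := co i a b lti ai bi ep; have h2 := co i b a lti bi ai (esym ep).
have h1' := co' i a b lti ai bi ep'; have h2' := co' i b a lti bi ai (esym ep').
move: ne h1 h2 h1' h2'.
case: (leqP (ev W i a) (ev W i b)); case: (leqP (ev W' i a) (ev W' i b)) => //; lia.
Qed.

(* The rank [phi] counts the vertices that follow the noncritical vertex and not
   those that precede it: mergings at higher levels may put new blocks in front
   of it, but cannot remove any that follow it. *)
Definition after t (w u : seq (seq nat)) (i x : nat) : nat :=
  count (fun z => [&& x < z, ev u i z == ev u i x,
    ev w i.+1 (ev t i z) == ev w i.+1 (ev t i x) & ev w i x < ev w i z])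
    (iota 0 (lsize t i)).

Definition width t : nat := \max_(i < n) lsize t i.

Definition phi t (w u : seq (seq nat)) : nat :=
  if `[< up t w u >] then
    let p := xget (0, 0) [set p | first_noncrit t w u p.1 p.2]%classic in
    ((p.1 * (width t).+1 + p.2) * (width t).+1 + (width t - after t w u p.1 p.2)).+1
  else 0.

Lemma lsize_width t i : i < n -> lsize t i <= width t.
Proof. by move=> lti; rewrite (leq_bigmax (Ordinal lti)). Qed.

Lemma after_width t w u i x : i < n -> after t w u i x <= width t.
Proof.
move=> lti; apply: leq_trans (count_size _ _) _; rewrite size_iota; exact: lsize_width.
Qed.

Lemma phiE t w u i x : first_noncrit t w u i x -> up t w u ->
  phi t w u = ((i * (width t).+1 + x) * (width t).+1 + (width t - after t w u i x)).+1.
Proof.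
move=> fn upw; rewrite /phi asboolT //.
have ex : exists p : nat * nat, first_noncrit t w u p.1 p.2 by exists (i, x).
have := xgetPex (0, 0) ex => /= fn'.
by have [-> ->] := first_noncrit_uniq fn fn'.
Qed.

Lemma phi0 t w u : ~ up t w u -> phi t w u = 0.
Proof. by move=> nup; rewrite /phi asboolF. Qed.

Definition phi_bound t : nat := ((n * (width t).+1).+1 * (width t).+1).+2.

Lemma phi_lt_bound t w u : phi t w u < phi_bound t.
Proof.
case: (pselect (up t w u)) => [upw|nup]; last by rewrite phi0.
have [i [x [fn _]]] := upw; rewrite (phiE fn upw) /phi_bound.
case: fn => lti xi _ _; have := lsize_width t lti.
set B := width t => xB.
have h1 : i.+1 * B.+1 <= n * B.+1 by rewrite leq_mul2r lti orbT.
have h2 : (i * B.+1 + x).+1 * B.+1 <= (n * B.+1).+1 * B.+1.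
  rewrite leq_mul2r; apply/orP; right; rewrite mulSn in h1; lia.
rewrite mulSn in h2; lia.
Qed.

Lemma phi_lt t r s r1 r2 (w : mor t r) (u : mor t s) (W : mor t r1) (W' : mor t r2) j x :
  coarser t w W' -> coarser t W' u -> coarser t w u -> ~ up t w u ->
  first_noncrit t w u j x ->
  [/\ coarser t W u, first_noncrit t W u j x /\ nonalone t W j x,
      (forall i z, j < i <= n -> z < lsize t i -> ev W i z = ev w i z) &
      (forall z, z < lsize t j -> ev W j z = ev w j z - (ev w j x < ev w j z))] ->
  (exists2 m' : mor r r2, mdeg m' = 1%R & mcomp m' w = W') \/ up t w W' ->
  mor_val W' <> mor_val W -> phi t W' u < phi t W u.
Proof.
move=> cwW' cW'u cwu nup fn [cWu [fnW naW] above Wj] H ne.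
have alone := first_noncrit_alone cwu nup fn.
case: (fn) => ltj xj nc mn; have lej := ltnW ltj.
have upW : up t W u by exists j, x.
rewrite (phiE fnW upW).
case: (pselect (up t W' u)) => [upW'|nu]; last by rewrite phi0.
have [i' [x' [fn' na']]] := upW'; rewrite (phiE fn' upW').
case: (fn') => lti' xi' nc' mn'.
have ncj : ~ crit t W' u j x.
  move=> cr; apply: nc => y xy yj uy py; rewrite ltnNge; apply/negP => le.
  have := cwW' j x y ltj xj yj (esym py) le; rewrite leqNgt => /negP; apply.
  apply: cr => //; apply: (coarser_pareq cwW') => //; exact: ptree_lt.
have h1 : ~~ lexlt j x i' x' by apply/negP => /(mn' _ _ ltj xj).
have wb := lsize_width t ltj; have wb' := lsize_width t lti'.
set B := width t in wb wb' *.
case: (boolP (lexlt i' x' j x)) => h2.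
  have h3 : i' * B.+1 + x' < j * B.+1 + x.
    case/orP: h2 => [ij|/andP[/eqP-> ?]]; last by rewrite ltn_add2l.
    have : i'.+1 * B.+1 <= j * B.+1 by rewrite leq_mul2r ij orbT.
    rewrite mulSn; lia.
  have : (i' * B.+1 + x').+1 * B.+1 <= (j * B.+1 + x) * B.+1 by rewrite leq_mul2r h3 orbT.
  rewrite mulSn; lia.
have [e1 e2] : i' = j /\ x' = x by move: h1 h2; rewrite /lexlt; lia.
subst i' x'; rewrite !ltnS ltn_add2l.
have aB := after_width t W' u x ltj; have aW := after_width t W u x ltj.
suff : after t W u j x < after t W' u j x by rewrite -/B in aB aW *; lia.
have Wpar z : z < lsize t j -> ev W j.+1 (ev t j z) = ev w j.+1 (ev t j z).
  by move=> zj; rewrite above ?ptree_lt //; lia.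
apply: (@leq_trans (after t w u j x)).
  have [z [xz zj ez]] := naW.
  have wz : ev w j z = (ev w j x).+1.
    have : ev w j z != ev w j x by apply/eqP => /(alone z zj); lia.
    move: ez; rewrite !Wj //; lia.
  have uz := coarser_eq cWu ltj zj xj ez.
  have pz : ev w j.+1 (ev t j z) = ev w j.+1 (ev t j x).
    by have := mor_pareq ltj zj xj ez; rewrite !Wpar.
  rewrite /after -!size_filter.
  set s1 := [seq _ <- _ | _]; set s2 := [seq _ <- _ | _].
  have zs1 : z \notin s1 by rewrite mem_filter ez ltnn !andbF.
  have : uniq (z :: s1) by rewrite /= zs1 filter_uniq // iota_uniq.
  move=> un; have := uniq_leq_size (s1 := z :: s1) (s2 := s2) un => /=; apply=> q.
  rewrite inE => /orP[/eqP->|].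
    by rewrite mem_filter mem_iota /= add0n zj xz uz pz !eqxx wz /= ltnSn.
  rewrite !mem_filter mem_iota /= add0n => /andP[/and4P[xq uq pq wq] qj].
  rewrite xq uq qj /= -!Wpar // pq /= andbT; move: wq; rewrite !Wj //; lia.
rewrite /after -!size_filter; apply: uniq_leq_size; first by rewrite filter_uniq // iota_uniq.
move=> q; rewrite !mem_filter mem_iota /= add0n => /andP[+ qj]; rewrite qj andbT.
case/and4P=> xq /eqP uq /eqP pq wq.
have pq' : ev W' j.+1 (ev t j q) = ev W' j.+1 (ev t j x).
  by apply: (coarser_pareq cwW') => //; apply: ptree_lt.
rewrite xq uq pq' !eqxx /= ltn_neqAle (cwW' j x q ltj xj qj (esym pq) (ltnW wq)) andbT.
apply/eqP => e'.
case: H => [[m' m1 mE]|[i2 [x2 [[lti2 xi2 nc2 mn2] na2]]]]; last first.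
  have nl : ~~ lexlt i2 x2 j x.
    apply/negP => lx; have := mn _ _ lti2 xi2 lx; exact: nonalone_noncrit.
  have h3 : lexlt j x i2 x2.
    apply/negPn/negP => nl2.
    have [e1 e2] : i2 = j /\ x2 = x by move: nl nl2; rewrite /lexlt; lia.
    subst i2 x2; case: na2 => z [xz zj ez]; have := alone z zj ez; lia.
  have := mn2 j x ltj xj h3 q xq qj (esym e') pq; lia.
have [j' [c [ltj' cj' rc idl [mrg injl]]]] := mdeg1_merge m1.
have mw i z : i <= n -> z < lsize t i -> ev W' i z = ev m' i (ev w i z).
  by move=> lei zi; rewrite -mE ev_comp.
have ej : j' = j.
  case: (ltngtP j' j) => // h.
    by move: e' wq; rewrite !mw // !idl ?ev_mor ?h // => ->; rewrite ltnn.
  by move: e'; rewrite !mw // => /(injl _ _ _ h) e; move: wq; rewrite e ?ev_mor // ltnn.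
subst j'.
have W'j z : z < lsize t j -> ev W' j z = ev w j z - (c < ev w j z).
  by move=> zj; rewrite mw // mrg // ev_mor.
have cE : ev w j x = c by move: e'; rewrite !W'j //; lia.
apply: ne; apply: mor_det => i p q' lti pi qi ep Hz.
have ep' : ev W i.+1 (ev t i p) = ev W i.+1 (ev t i q') by rewrite -!Hz ?ptree_lt.
case: (ltngtP i j) => ij.
- case: fnW => _ _ _ mnW.
  by apply: (crit_order cW'u cWu) => // z zi; [apply: mn' | apply: mnW] => //; rewrite /lexlt ij.
- have lei := ltnW lti.
  by rewrite !mw // !idl ?ev_mor ?ij // !above ?ij.
- by subst i; rewrite !W'j // !Wj // cE.
Qed.

End CanonicalFactorization.

(** * Signs of rearrangements and depth-first order *)

Section Rearr.
Implicit Types l : seq (nat * nat).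
Local Notation x0 := (0, 0).

Lemma rearr_ex l1 l2 : perm_eq l1 l2 ->
  exists p : 'S_(size l1), l2 = [seq nth x0 l1 (p i) | i <- enum 'I_(size l1)].
Proof.
rewrite perm_sym => pe.
have /tuple_permP [p pE] : perm_eq l2 (in_tuple l1) by [].
exists p; rewrite pE /=; apply: eq_map => i; exact: tnth_nth.
Qed.

Lemma rearr_oddE l1 (p : 'S_(size l1)) : uniq l1 ->
  rearr_odd l1 [seq nth x0 l1 (p i) | i <- enum 'I_(size l1)] = odd_perm p.
Proof.
move=> un; apply/existsP/idP => [[q /andP[/eqP e oq]]|op]; last by exists p; rewrite eqxx.
suff -> : p = q by [].
apply/permP => i; apply: val_inj => /=; apply/eqP.
rewrite -(nth_uniq x0 _ _ un) ?ltn_ord //.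
have nthE (r : 'S_(size l1)) :
    nth x0 [seq nth x0 l1 (r j) | j <- enum 'I_(size l1)] i = nth x0 l1 (r i).
  by rewrite (nth_map i) ?size_enum_ord // nth_ord_enum.
by rewrite -!nthE e.
Qed.

Lemma rearr_trans l1 l2 l3 : uniq l1 -> perm_eq l1 l2 -> perm_eq l2 l3 ->
  rearr_odd l1 l3 = rearr_odd l1 l2 (+) rearr_odd l2 l3.
Proof.
move=> un1 p12 p23; have un2 : uniq l2 by rewrite -(perm_uniq p12).
have [p e2] := rearr_ex p12; have [q e3] := rearr_ex p23.
have sz : size l2 = size l1 by rewrite (perm_size p12).
have [q' [eq' e3']] : exists q' : 'S_(size l1), odd_perm q' = odd_perm q /\
    l3 = [seq nth x0 l2 (q' i) | i <- enum 'I_(size l1)].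
  by move: q e3; rewrite sz => q ->; exists q.
rewrite [in RHS]e3 (rearr_oddE q un2) [in rearr_odd l1 l2]e2 (rearr_oddE p un1).
have -> : l3 = [seq nth x0 l1 ((q' * p)%g i) | i <- enum 'I_(size l1)].
  rewrite e3'; apply: eq_map => i; rewrite permM e2.
  by rewrite (nth_map (q' i)) ?size_enum_ord // nth_ord_enum.
by rewrite rearr_oddE // odd_permM eq' addbC.
Qed.

Lemma rearr_refl l : uniq l -> rearr_odd l l = false.
Proof.
by move=> un; have := rearr_trans un (perm_refl l) (perm_refl l); case: (rearr_odd l l).
Qed.

Lemma rearr_map (f : nat * nat -> nat * nat) l1 l2 : {in l1 &, injective f} ->
  uniq l1 -> perm_eq l1 l2 -> rearr_odd (map f l1) (map f l2) = rearr_odd l1 l2.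
Proof.
move=> inj un p12; have [p e2] := rearr_ex p12.
have un' : uniq (map f l1) by rewrite map_inj_in_uniq.
rewrite [in RHS]e2 rearr_oddE //.
have : exists p' : 'S_(size l1), odd_perm p' = odd_perm p /\
    map f l2 = [seq nth x0 (map f l1) (p' i) | i <- enum 'I_(size l1)].
  exists p; split=> //; rewrite e2 -map_comp; apply: eq_map => i /=.
  by rewrite (nth_map x0).
move: (odd_perm p) => b; rewrite -(size_map f l1) => -[p' [<- ->]].
by rewrite rearr_oddE.
Qed.

Lemma rearr_cons x l1 l2 : uniq (x :: l1) -> perm_eq l1 l2 ->
  rearr_odd (x :: l1) (x :: l2) = rearr_odd l1 l2.
Proof.
move=> un p12; have [p e2] := rearr_ex p12; rewrite [in RHS]e2 rearr_oddE; last by case/andP: un.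
have -> : x :: l2 = [seq nth x0 (x :: l1) (lift_perm ord0 ord0 p i) | i <- enum 'I_(size l1).+1].
  rewrite enum_ordSl /= lift_perm_id /=; congr (_ :: _).
  by rewrite -map_comp e2; apply: eq_map => i /=; rewrite lift_perm_lift.
by rewrite (rearr_oddE (l1 := x :: l1)) // odd_lift_perm.
Qed.

Lemma rearr_swap2 x y l : uniq (x :: y :: l) -> rearr_odd (x :: y :: l) (y :: x :: l) = true.
Proof.
move=> un.
have -> : y :: x :: l = [seq nth x0 (x :: y :: l) (tperm (ord0 : 'I_(size l).+2) (lift ord0 ord0) i) |
   i <- enum 'I_(size l).+2].
  rewrite !enum_ordSl !map_cons -2!map_comp tpermL tpermR; congr (_ :: _ :: _).
  rewrite -[LHS](mkseq_nth x0) /mkseq -val_enum_ord -map_comp; apply: eq_map => i /=.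
  by rewrite tpermD.
by rewrite (rearr_oddE (l1 := x :: y :: l)) // odd_tperm.
Qed.

Lemma perm_swap a x y l : perm_eq (a ++ x :: y :: l) (a ++ y :: x :: l).
Proof. by rewrite perm_cat2l; apply/permPl; exact: (perm_catCA [:: x] [:: y] l). Qed.

Lemma rearr_swap a x y l : uniq (a ++ x :: y :: l) ->
  rearr_odd (a ++ x :: y :: l) (a ++ y :: x :: l) = true.
Proof.
elim: a => [|b a IH] /=; first exact: rearr_swap2.
move=> un; rewrite rearr_cons //; last exact: perm_swap.
by apply: IH; case/andP: un.
Qed.

Lemma rearr_swapr v a x y l : uniq v -> perm_eq v (a ++ x :: y :: l) ->
  rearr_odd v (a ++ y :: x :: l) = ~~ rearr_odd v (a ++ x :: y :: l).
Proof.
move=> un pe; rewrite (rearr_trans un pe (perm_swap _ _ _ _)) rearr_swap ?addbT //.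
by rewrite -(perm_uniq pe).
Qed.

Lemma rearr_swapl v a x y l : uniq v -> perm_eq v (a ++ x :: y :: l) ->
  rearr_odd (a ++ y :: x :: l) v = ~~ rearr_odd (a ++ x :: y :: l) v.
Proof.
move=> un pe.
have un' : uniq (a ++ y :: x :: l).
  by rewrite (perm_uniq (perm_swap _ _ _ _)) -(perm_uniq pe).
rewrite (rearr_trans un' (perm_swap _ _ _ _)) ?[perm_eq _ v]perm_sym //.
by rewrite rearr_swap.
Qed.

End Rearr.

Section Dfs.
Variable n : nat.
Implicit Types t r s : ptree n.

Fixpoint anc t (l d y : nat) : nat := if d is d'.+1 then ev t (l + d') (anc t l d' y) else y.

Lemma anc_lt t l d y : l + d <= n -> y < lsize t l -> anc t l d y < lsize t (l + d).
Proof.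
elim: d => [|d IH] /=; first by rewrite addn0.
rewrite addnS => ld yl; apply: ptree_lt => //; apply: IH => //; exact: ltnW.
Qed.

Lemma anc_mono t l d x y : l + d <= n -> x <= y -> y < lsize t l -> anc t l d x <= anc t l d y.
Proof.
elim: d => [|d IH] //=; rewrite addnS => ld xy yl; apply: ptree_mono => //.
  by apply: IH => //; apply: ltnW.
by apply: anc_lt => //; apply: ltnW.
Qed.

Lemma filter_split (f : nat -> nat) (P : pred nat) K m N :
  (forall x y, x <= y -> y < m + N -> f x <= f y) ->
  [seq y <- iota m N | P (f y) & f y < K] ++ [seq y <- iota m N | P (f y) & f y == K] =
  [seq y <- iota m N | P (f y) & f y < K.+1].
Proof.
elim: N m => [|N IH] m mono //=.
have {}IH : [seq y <- iota m.+1 N | P (f y) & f y < K] ++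
    [seq y <- iota m.+1 N | P (f y) & f y == K] = [seq y <- iota m.+1 N | P (f y) & f y < K.+1].
  by apply: IH => x y xy yN; apply: mono => //; lia.
have -> : (f m < K.+1) = (f m == K) || (f m < K) by rewrite ltnS leq_eqVlt.
case: (ltngtP (f m) K) => h; rewrite ?andbT ?andbF ?orbT ?orbF -IH.
- by case: (P (f m)).
- by [].
have e0 : [seq y <- iota m.+1 N | P (f y) & f y < K] = [::].
  rewrite -(filter_pred0 (iota m.+1 N)); apply: eq_in_filter => y; rewrite mem_iota => /andP[my yN].
  have := mono m y (ltnW my) ltac:(lia); rewrite h; case: (P _) => //=; lia.
by rewrite e0; case: (P (f m)).
Qed.

Lemma flatten_filter (f : nat -> nat) (P : pred nat) N M :
  (forall x y, x <= y -> y < N -> f x <= f y) -> (forall x, x < N -> f x < M) ->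
  flatten [seq [seq y <- iota 0 N | f y == z] | z <- iota 0 M & P z] =
  [seq y <- iota 0 N | P (f y)].
Proof.
move=> mono bf.
have -> : [seq y <- iota 0 N | P (f y)] = [seq y <- iota 0 N | P (f y) & f y < M].
  by apply: eq_in_filter => y; rewrite mem_iota /= add0n => /bf ->; rewrite andbT.
elim: M {bf} => [|M IH].
  by rewrite [RHS](eq_filter (a2 := pred0)) ?filter_pred0 // => y; rewrite ltn0 andbF.
rewrite -addn1 iotaD filter_cat map_cat flatten_cat IH addn1 -filter_split // add0n; congr (_ ++ _).
rewrite /=; case PM: (P M) => /=.
  by rewrite cats0; apply: eq_filter => y; case: eqP => [->|]; rewrite ?PM ?andbF.
rewrite -(filter_pred0 (iota 0 N)); apply: eq_filter => y.
by case: eqP => [->|]; rewrite ?PM ?andbF.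
Qed.

Lemma dfs_le t i x z : z \in dfs t i x -> z.1 <= i.
Proof.
elim: i x => [|i IH] x /=; first by rewrite inE => /eqP ->.
rewrite inE => /orP[/eqP->//|/flattenP[s /mapP[y _ ->] /IH h]]; exact: ltnW.
Qed.

Lemma dfs_level t i x l : i <= n -> l <= i -> x < lsize t i ->
  [seq z.2 | z <- dfs t i x & z.1 == l] = [seq y <- iota 0 (lsize t l) | anc t l (i - l) y == x].
Proof.
have base l' y : y < lsize t l' -> [seq z <- iota 0 (lsize t l') | z == y] = [:: y].
  by move=> yl; rewrite filter_pred1_uniq // ?iota_uniq // mem_iota.
elim: i x => [|i IH] x lei.
  by rewrite leqn0 => /eqP -> xl /=; rewrite base.
rewrite leq_eqVlt => /orP[/eqP->|li] xi /=.
  have e : [seq z <- flatten [seq dfs t i y | y <- iota 0 (lsize t i) & ev t i y == x]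
      | z.1 == i.+1] = [::].
    apply/eqP; rewrite -[_ == _]negbK -has_filter; apply/hasPn => z /flattenP[s /mapP[y _ ->] /dfs_le h].
    by rewrite neq_ltn ltnS h.
  by rewrite eqxx subnn /= base // e.
rewrite gtn_eqF // filter_flatten map_flatten -!map_comp.
have li' : l <= i by [].
rewrite (_ : map _ _ = [seq [seq y <- iota 0 (lsize t l) | anc t l (i - l) y == z] |
    z <- iota 0 (lsize t i) & ev t i z == x]); last first.
  by apply/eq_in_map => y; rewrite mem_filter mem_iota /= add0n => /andP[_ yi]; apply: IH => //; apply: ltnW.
rewrite (@flatten_filter (anc t l (i - l)) (fun z => ev t i z == x)).
- by rewrite subSn //= subnKC.
- by move=> a b ab bl; apply: anc_mono => //; rewrite subnKC // ltnW.
- by move=> a al; rewrite -[in lsize t i](subnKC li'); apply: anc_lt => //; rewrite subnKC // ltnW.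
Qed.

Lemma dfs_root_level t l : l <= n ->
  [seq z <- dfs t n 0 | z.1 == l] = [seq (l, y) | y <- iota 0 (lsize t l)].
Proof.
move=> ln; have r0 : 0 < lsize t n by rewrite lsize_root.
have := congr1 (map (pair l)) (dfs_level (leqnn n) ln r0); rewrite -map_comp.
rewrite [X in _ = map _ X](_ : _ = iota 0 (lsize t l)); last first.
  rewrite -[RHS]filter_predT; apply: eq_in_filter => y; rewrite mem_iota /= add0n => yl.
  by have := @anc_lt t l (n - l) y; rewrite subnKC // lsize_root => /(_ (leqnn _) yl); case: anc.
move=> <-; rewrite -[LHS]map_id; apply/eq_in_map => -[a b]; rewrite mem_filter /=.
by case/andP=> /eqP ->.
Qed.

Lemma vertices_cons t : dfs t n 0 = (n, 0) :: vertices t.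
Proof.
have dfsE v i x : dfs v i x = (i, x) :: behead (dfs v i x) by case: i.
exact: dfsE.
Qed.

Lemma vertices_level t l : l < n ->
  [seq z <- vertices t | z.1 == l] = [seq (l, y) | y <- iota 0 (lsize t l)].
Proof. by move=> ln; rewrite -(dfs_root_level t (ltnW ln)) vertices_cons /= gtn_eqF. Qed.

Lemma vertices_lt t z : z \in vertices t -> z.1 < n.
Proof.
move=> zv; have : z \in dfs t n 0 by rewrite vertices_cons inE zv orbT.
move/dfs_le; rewrite leq_eqVlt => /orP[/eqP e|//].
have := dfs_root_level t (leqnn n); rewrite lsize_root vertices_cons /= eqxx => -[].
move=> h; have : z \in [seq z <- vertices t | z.1 == n] by rewrite mem_filter e eqxx zv.
by rewrite h.
Qed.

Lemma mem_vertices t z : (z \in vertices t) = (z.1 < n) && (z.2 < lsize t z.1).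
Proof.
case: z => l y /=; case: ltnP => [ln|nl] /=; last first.
  by apply/negP => /vertices_lt /=; rewrite ltnNge nl.
have : ((l, y) \in [seq z <- vertices t | z.1 == l]) = (y < lsize t l).
  rewrite vertices_level // mem_map ?mem_iota //; by move=> a b [].
by rewrite mem_filter eqxx.
Qed.

Lemma vertices_uniq t : uniq (vertices t).
Proof.
apply: count_mem_uniq => -[l y].
case: (ltnP l n) => ln; last first.
  have h : (l, y) \notin vertices t by rewrite mem_vertices /= ltnNge ln.
  by rewrite (negbTE h) (count_memPn h).
have e : count_mem (l, y) (vertices t) = count_mem (l, y) [seq z <- vertices t | z.1 == l].
  rewrite count_filter; apply: eq_count => z /=; case: eqP => [->|//] /=; by rewrite eqxx.
rewrite e vertices_level // count_uniq_mem; last by rewrite map_inj_uniq ?iota_uniq // => a b [].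
by rewrite -vertices_level // mem_filter eqxx.
Qed.

Lemma perm_verticesP t l : perm_eq l (vertices t) <->
  uniq l /\ forall z, (z \in l) = (z.1 < n) && (z.2 < lsize t z.1).
Proof.
split=> [pe|[un H]].
  split; first by rewrite (perm_uniq pe) vertices_uniq.
  by move=> z; rewrite (perm_mem pe) mem_vertices.
by apply: uniq_perm => //; [exact: vertices_uniq | move=> z; rewrite H mem_vertices].
Qed.

End Dfs.

Section Signs.
Variable n : nat.
Implicit Types t r s : ptree n.

Lemma merge_levelP t s (u : mor t s) j c l x y : merge_level t u j c -> l < n ->
  x < lsize t l -> y < lsize t l -> ev u l x = ev u l y ->
  x = y \/ l = j /\ (x = c /\ y = c.+1 \/ x = c.+1 /\ y = c).
Proof.
case=> ltj cj ec idl [mrg injl] lt xl yl e.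
case: (ltngtP l j) => h.
- by left; apply: injl e.
- by move: e; rewrite !idl ?h ?(ltnW lt) //; left.
- subst l; move: e; rewrite !mrg //.
  case: (ltnP c x); case: (ltnP c y); lia.
Qed.

Lemma merge_level_bot t s (u : mor t s) j c : merge_level t u j c ->
  ev u j c = c /\ ev u j c.+1 = c.
Proof. by case=> ltj cj ec idl [mrg injl]; rewrite !mrg ?(ltnW cj) //; lia. Qed.

Lemma merged_merge t s (u : mor t s) j c : merge_level t u j c ->
  merged u = [:: (j, c); (j, c.+1)].
Proof.
move=> mg; have [ltj cj _ _ _] := mg; have [ec ec'] := merge_level_bot mg.
pose a := fun z : nat * nat => (z == (j, c)) || (z == (j, c.+1)).
have -> : merged u = [seq z <- vertices t | a z].
  apply: eq_in_filter => -[l x]; rewrite mem_vertices /= => /andP[ln xl].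
  apply/hasP/orP => [[[l' y]]|].
    rewrite mem_vertices /= => /andP[ln' yl] /andP[ne /eqP[e1 e2]].
    subst l'; case: (merge_levelP mg ln yl xl e2) => [e|[-> [[_ ->]|[_ ->]]]].
    - by move: ne; rewrite e eqxx.
    - by right.
    - by left.
  case=> /eqP[-> ->].
    exists (j, c.+1); first by rewrite mem_vertices /= ltj cj.
    by rewrite /vimage /= ec ec' eqxx andbT; apply/eqP => -[]; lia.
  exists (j, c); first by rewrite mem_vertices /= ltj ltnW.
  by rewrite /vimage /= ec ec' eqxx andbT; apply/eqP => -[]; lia.
have -> : [seq z <- vertices t | a z] = [seq z <- [seq z <- vertices t | z.1 == j] | a z].
  rewrite -filter_predI; apply: eq_filter => -[l x] /=; rewrite /a !xpair_eqE.
  by case: (l == j); rewrite /= ?andbT ?andbF.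
rewrite vertices_level // filter_map.
have [N eN] : exists N, lsize t j = c + (2 + N) by exists (lsize t j - c - 2); lia.
have ne : (c == c.+1) = false by lia.
rewrite eN iotaD add0n iotaD !filter_cat /=.
rewrite (@eq_in_filter _ _ pred0 (iota 0 c)); last first.
  by move=> y; rewrite mem_iota /= add0n /a => yc; rewrite !xpair_eqE !eqxx /=; lia.
rewrite (@eq_in_filter _ _ pred0 (iota (c + 2) N)); last first.
  by move=> y; rewrite mem_iota /= /a => /andP[yc _]; rewrite !xpair_eqE !eqxx /=; lia.
by rewrite !filter_pred0 /= /a !xpair_eqE !eqxx /= orbT.
Qed.

Lemma perm_image t s (u : mor t s) j c R : merge_level t u j c ->
  perm_eq ((j, c) :: (j, c.+1) :: R) (vertices t) ->
  perm_eq ((j, c) :: map (vimage u) R) (vertices s).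
Proof.
move=> mg /perm_verticesP[un mem]; have [ltj cj _ _ _] := mg; have [ec ec'] := merge_level_bot mg.
have -> : (j, c) :: map (vimage u) R = map (vimage u) ((j, c) :: R) by rewrite /= /vimage /= ec.
have memR z : z \in (j, c) :: R -> [/\ z.1 < n, z.2 < lsize t z.1 & z != (j, c.+1)].
  move=> zR; have := mem z; rewrite [_ \in _](_ : _ = true); last first.
    by move: zR; rewrite !inE => /orP[->//|->]; rewrite !orbT.
  move=> /esym/andP[-> ->]; split=> //; apply/eqP => e; move: un zR.
  rewrite e /= !inE => /and3P[_ h1 _]; rewrite (negbTE h1) orbF xpair_eqE => /andP[_ /eqP]; lia.
apply/perm_verticesP; split.
  rewrite map_inj_in_uniq; first by move: un; rewrite /= inE => /and3P[h1 _ ->]; move: h1; rewrite negb_or => /andP[_ ->].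
  move=> [l x] [l' y] /memR /= [ln xl nx] /memR /= [ln' yl ny] [e1 e2]; subst l'.
  case: (merge_levelP mg ln xl yl e2) => [->//|[e [[e3 e4]|[e3 e4]]]]; subst.
    by move: ny; rewrite eqxx.
  by move: nx; rewrite eqxx.
move=> [l y]; apply/mapP/andP => /= [[[l' x] /memR[/= ln xl _] [-> ->]]|[ln yl]].
  by split=> //; apply: ev_mor => //; apply: ltnW.
have [x xl <-] := mor_surj u (ltnW ln) yl.
have := mem (l, x); rewrite /= ln xl !inE => /or3P[h|/eqP[e1 e2]|h].
- by exists (l, x); rewrite // inE h.
- by exists (j, c); rewrite ?inE ?eqxx // e1 e2 /vimage /= ec ec'.
- by exists (l, x); rewrite // inE h orbT.
Qed.

Lemma rearr_sym l1 l2 : uniq l1 -> perm_eq l1 l2 -> rearr_odd l2 l1 = rearr_odd l1 l2.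
Proof.
move=> un p12; have p21 : perm_eq l2 l1 by rewrite perm_sym.
have := rearr_trans un p12 p21; rewrite rearr_refl //.
by case: (rearr_odd l2 l1); case: (rearr_odd l1 l2).
Qed.

Lemma sgn_merge t s (u : mor t s) j c R : merge_level t u j c ->
  perm_eq ((j, c) :: (j, c.+1) :: R) (vertices t) ->
  sgn_odd u = rearr_odd (vertices t) ((j, c) :: (j, c.+1) :: R)
    (+) rearr_odd ((j, c) :: map (vimage u) R) (vertices s).
Proof.
move=> mg pe; have [ec ec'] := merge_level_bot mg.
rewrite /sgn_odd (merged_merge mg) /=.
set U := unmerged u; have vU : vimage u (j, c) = (j, c) by rewrite /vimage /= ec.
rewrite vU.
have peU : perm_eq ((j, c) :: (j, c.+1) :: U) (vertices t).
  have [ltj cj _ _ _] := mg; apply/perm_verticesP; split.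
    rewrite /= !inE xpair_eqE eqxx /= /U /unmerged (merged_merge mg) !mem_filter !inE !eqxx ?orbT /=.
    by rewrite filter_uniq ?vertices_uniq // andbT orbF; lia.
  move=> z; rewrite !inE /U /unmerged mem_filter (merged_merge mg) !inE mem_vertices.
  case: (eqVneq z (j, c)) => [->|_] /=; first by rewrite ltj ltnW.
  by case: (eqVneq z (j, c.+1)) => [->|_] /=; first by rewrite ltj cj.
have unt := vertices_uniq t.
have peUR : perm_eq U R.
  by rewrite -(perm_cons (j, c.+1)) -(perm_cons (j, c)) (perm_trans peU) // perm_sym.
have imU := perm_image mg peU; have imR := perm_image mg pe.
have unU : uniq ((j, c) :: (j, c.+1) :: U) by rewrite (perm_uniq peU).
have unU1 : uniq ((j, c.+1) :: U) by case/andP: unU.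
have unU0 : uniq U by case/andP: unU1.
have uniU : uniq ((j, c) :: map (vimage u) U) by rewrite (perm_uniq imU) vertices_uniq.
have uniU0 : uniq (map (vimage u) U) by case/andP: uniU.
have e1 : rearr_odd (vertices t) ((j, c) :: (j, c.+1) :: R) =
    rearr_odd (vertices t) ((j, c) :: (j, c.+1) :: U) (+) rearr_odd U R.
  rewrite (@rearr_trans _ ((j, c) :: (j, c.+1) :: U)) // ?perm_cons // 1?perm_sym //.
  by rewrite !rearr_cons // ?perm_cons.
have e2 : rearr_odd ((j, c) :: map (vimage u) U) (vertices s) =
    rearr_odd U R (+) rearr_odd ((j, c) :: map (vimage u) R) (vertices s).
  rewrite (@rearr_trans _ ((j, c) :: map (vimage u) R)) // ?perm_cons ?perm_map //.
  rewrite rearr_cons ?perm_map // rearr_map //.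
  move=> x y xU yU e; apply/eqP/negPn/negP => ne; move: uniU0.
  rewrite (perm_uniq (perm_map (vimage u) (perm_to_rem xU))) /= e map_f //.
  by rewrite (rem_filter _ unU0) mem_filter /= yU eq_sym ne.
rewrite e1 e2; case: (rearr_odd U R); by rewrite ?addbT ?addbF ?addbN ?addNb.
Qed.

Lemma map_vimage_comp t r s (v : mor r s) (w : mor t r) R :
  (forall z, z \in R -> z.1 < n /\ z.2 < lsize t z.1) ->
  map (vimage v) (map (vimage w) R) = map (vimage (mcomp v w)) R.
Proof.
move=> H; rewrite -map_comp; apply/eq_in_map => -[l x] /H[/= ln xl].
by rewrite /vimage /= ev_mcomp // ltnW.
Qed.

Lemma perm_vertices_mem t a R : perm_eq (a ++ R) (vertices t) ->
  forall z, z \in R -> z.1 < n /\ z.2 < lsize t z.1.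
Proof.
by case/perm_verticesP => _ H z zR; apply/andP; rewrite -H mem_cat zR orbT.
Qed.

Lemma sgn_disjoint t r s (v : mor r s) (w : mor t r) j c j2 c2 b1 b2 R :
  merge_level t w j c -> merge_level r v j2 c2 ->
  ev w j2 b1 = c2 -> ev w j2 b2 = c2.+1 ->
  perm_eq ((j, c) :: (j, c.+1) :: (j2, b1) :: (j2, b2) :: R) (vertices t) ->
  sgn_odd w (+) sgn_odd v =
  rearr_odd (vertices t) ((j, c) :: (j, c.+1) :: (j2, b1) :: (j2, b2) :: R) (+)
  rearr_odd (vimage (mcomp v w) (j2, b1) :: vimage (mcomp v w) (j, c) ::
    map (vimage (mcomp v w)) R) (vertices s).
Proof.
move=> mw mv e1 e2 pe; have im := perm_image mw pe; have [ec _] := merge_level_bot mw.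
have [ec2 _] := merge_level_bot mv.
rewrite (sgn_merge mw pe); move: im; rewrite /= {1 2 4 5}/vimage /= e1 e2 => im.
set X := (j, c); set P := (j2, c2); set Q := (j2, c2.+1) in im *.
set wR := map (vimage w) R in im *.
have unr := vertices_uniq r.
have unX : uniq [:: X, P, Q & wR] by rewrite (perm_uniq im).
have im' : perm_eq [:: P, Q, X & wR] (vertices r).
  apply: perm_trans im; apply: (perm_trans (perm_swap [:: P] Q X wR)).
  exact: (perm_swap [::] P X (Q :: wR)).
have ir := im; rewrite perm_sym in ir.
rewrite (sgn_merge mv im') -/P -/Q /=.
have -> : rearr_odd (vertices r) [:: P, Q, X & wR] = rearr_odd [:: X, P, Q & wR] (vertices r).
  rewrite (rearr_swapr (a := [:: P]) (x := X)) //=; last first.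
    by apply: (perm_trans ir); exact: (perm_swap [::] X P (Q :: wR)).
  by rewrite (rearr_swapr (a := [::]) (x := X)) //= negbK rearr_sym.
have -> : vimage v X = vimage (mcomp v w) (j, c).
  have [ltj cj _ _ _] := mw; rewrite /vimage /= ev_mcomp ?ec //; exact: ltnW.
have := perm_vertices_mem (a := [:: (j, c); (j, c.+1)]) pe (z := (j2, b1)).
rewrite inE eqxx => /(_ isT) [/= ltj2 b1l].
have -> : vimage (mcomp v w) (j2, b1) = P by rewrite /vimage /= ev_mcomp ?(ltnW ltj2) // e1 ec2.
rewrite map_vimage_comp; last first.
  exact: (perm_vertices_mem (a := [:: (j, c); (j, c.+1); (j2, b1); (j2, b2)]) pe).
by case: (rearr_odd [:: X, P, Q & wR] _); rewrite ?addbT ?addbF ?addbN ?addNb ?negbK.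
Qed.

Lemma sgn_triple t r s (v : mor r s) (w : mor t r) j c c2 z R :
  merge_level t w j c -> merge_level r v j c2 ->
  (c = z /\ c2 = z) \/ (c = z.+1 /\ c2 = z) ->
  perm_eq ((j, z) :: (j, z.+1) :: (j, z.+2) :: R) (vertices t) ->
  sgn_odd w (+) sgn_odd v =
  (c != z) (+)
  (rearr_odd (vertices t) ((j, z) :: (j, z.+1) :: (j, z.+2) :: R) (+)
  rearr_odd ((j, z) :: map (vimage (mcomp v w)) R) (vertices s)).
Proof.
move=> mw mv H pe; have [ltj cj _ _ [mrg injl]] := mw; have [ec _] := merge_level_bot mw.
have mapE : map (vimage v) (map (vimage w) R) = map (vimage (mcomp v w)) R.
  apply: map_vimage_comp.
  exact: (perm_vertices_mem (a := [:: (j, z); (j, z.+1); (j, z.+2)]) pe).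
have bd y : (j, y) \in [:: (j, z); (j, z.+1); (j, z.+2)] -> y < lsize t j.
  move=> yin; have /perm_verticesP[_ /(_ (j, y))] := pe.
  rewrite -[_ :: _]/([:: (j, z); (j, z.+1); (j, z.+2)] ++ R) mem_cat yin => /esym/andP[_ //].
have unt := vertices_uniq t; have unr := vertices_uniq r.
have pt := pe; rewrite perm_sym in pt.
case: H => -[e1 e2]; subst.
  have im := perm_image mw pe; rewrite (sgn_merge mw pe).
  move: im; rewrite /= {1 3}/vimage /=.
  have -> : ev w j z.+2 = z.+1 by rewrite mrg ?bd ?inE ?eqxx ?orbT //; lia.
  move=> im; have ir := im; rewrite perm_sym in ir.
  rewrite (sgn_merge mv im) mapE eqxx /= (rearr_sym unr ir).
  by case: (rearr_odd (vertices r) _); rewrite ?addbT ?addbF ?addbN ?addNb ?negbK.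
have p1 : perm_eq (vertices t) [:: (j, z.+1), (j, z), (j, z.+2) & R].
  by apply: (perm_trans pt); exact: (perm_swap [::] (j, z) (j, z.+1)).
have p2 : perm_eq (vertices t) [:: (j, z.+1), (j, z.+2), (j, z) & R].
  by apply: (perm_trans p1); exact: (perm_swap [:: (j, z.+1)] (j, z) (j, z.+2)).
have p2' := p2; rewrite perm_sym in p2'.
have im := perm_image mw p2'; rewrite (sgn_merge mw p2').
rewrite (rearr_swapr (a := [:: (j, z.+1)]) (x := (j, z))) //=.
rewrite (rearr_swapr (a := [::]) (x := (j, z))) //= negbK.
move: im; rewrite /= {1 3}/vimage /=.
have -> : ev w j z = z by rewrite mrg ?bd ?inE ?eqxx ?orbT //; lia.
move=> im; have ir := im; rewrite perm_sym in ir.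
have im' : perm_eq [:: (j, z), (j, z.+1) & map (vimage w) R] (vertices r).
  by apply: perm_trans im; exact: (perm_swap [::] (j, z) (j, z.+1)).
have ir' := im'; rewrite perm_sym in ir'.
rewrite (sgn_merge mv im') mapE (rearr_sym unr ir).
rewrite (rearr_swapr (a := [::]) (x := (j, z))) //=.
have -> : z.+1 != z by rewrite neq_ltn ltnSn orbT.
by case: (rearr_odd (vertices r) _); rewrite ?addbT ?addbF ?addbN ?addNb ?addTb ?negbK.
Qed.

End Signs.

Section Diamond.
Variable n : nat.
Implicit Types t r s : ptree n.

Definition triple_shape t (u : seq (seq nat)) j c z : Prop :=
  [/\ j < n, z.+2 < lsize t j, c = z \/ c = z.+1,
      ev u j z.+1 = ev u j z /\ ev u j z.+2 = ev u j z &
      forall l x y, l < n -> x < lsize t l -> y < lsize t l -> x <> y ->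
        ev u l x = ev u l y -> l = j /\ (z <= x <= z.+2 /\ z <= y <= z.+2)].

Definition pair_shape t (u : seq (seq nat)) j c j2 b1 b2 : Prop :=
  [/\ [/\ j2 < n, b1 < lsize t j2, b2 < lsize t j2 & b1 <> b2],
      ~ (j2 = j /\ (b1 = c \/ b1 = c.+1)) /\ ~ (j2 = j /\ (b2 = c \/ b2 = c.+1)),
      ev u j2 b1 = ev u j2 b2, ev u j c = ev u j c.+1 &
      forall l x y, l < n -> x < lsize t l -> y < lsize t l -> x <> y ->
        ev u l x = ev u l y -> l = j /\ (x = c /\ y = c.+1 \/ x = c.+1 /\ y = c) \/
          l = j2 /\ (x = b1 /\ y = b2 \/ x = b2 /\ y = b1)].

Lemma two_merges_shape t r s (v : mor r s) (w : mor t r) j c j2 c2 :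
  merge_level t w j c -> merge_level r v j2 c2 ->
  (j2 = j /\ triple_shape t (mcomp v w) j c c2 /\ (c = c2 \/ c = c2.+1)) \/
  exists b1 b2, [/\ ev w j2 b1 = c2, ev w j2 b2 = c2.+1 &
    pair_shape t (mcomp v w) j c j2 b1 b2].
Proof.
move=> mw mv; have [ltj cj ec above [mrg injl]] := mw; have [ltj2 cj2 _ _ _] := mv.
have [wc wc'] := merge_level_bot mw; have [vc vc'] := merge_level_bot mv.
have lej := ltnW ltj; have lej2 := ltnW ltj2.
have uE l x : l < n -> x < lsize t l -> ev (mcomp v w) l x = ev v l (ev w l x).
  by move=> ln xl; rewrite ev_comp // ltnW.
have ker l x y : l < n -> x < lsize t l -> y < lsize t l -> x <> y ->
    ev (mcomp v w) l x = ev (mcomp v w) l y ->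
    l = j /\ (x = c /\ y = c.+1 \/ x = c.+1 /\ y = c) \/
    l = j2 /\ (ev w l x = c2 /\ ev w l y = c2.+1 \/ ev w l x = c2.+1 /\ ev w l y = c2).
  move=> ln xl yl ne; rewrite !uE // => e.
  case: (merge_levelP mv ln _ _ e) => [||e'|[e1 e2]]; try (by apply: ev_mor; rewrite // ltnW).
    by case: (merge_levelP mw ln xl yl e') => // ?; left.
  by right.
case: (pselect (j2 = j /\ (c2 = c \/ c2.+1 = c))) => [[e2 H]|nT].
  subst j2; left; split=> //; split; last by lia.
  have zj : c2.+2 < lsize t j.
    have [b bl eb] := mor_surj w lej cj2; move: eb; rewrite mrg //; lia.
  split=> //; first by lia.
    rewrite !uE ?mrg //; try lia.
    case: H => e; subst.
      have -> : c - (c < c) = c by lia.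
      have -> : c.+1 - (c < c.+1) = c by lia.
      have -> : c.+2 - (c < c.+2) = c.+1 by lia.
      by rewrite vc'.
    have -> : c2 - (c2.+1 < c2) = c2 by lia.
    have -> : c2.+1 - (c2.+1 < c2.+1) = c2.+1 by lia.
    have -> : c2.+2 - (c2.+1 < c2.+2) = c2.+1 by lia.
    by rewrite vc' vc.
  move=> l x y ln xl yl ne e; case: (ker _ _ _ ln xl yl ne e) => -[el h]; subst l; split=> //.
    lia.
  move: h; rewrite !mrg //; case: (ltnP c x); case: (ltnP c y); lia.
right.
have [b1 b1l e1] := mor_surj w lej2 (y := c2) ltac:(lia).
have [b2 b2l e2] := mor_surj w lej2 cj2.
have u1 x : x < lsize t j2 -> ev w j2 x = c2 -> x = b1.
  move=> xl ex; case: (merge_levelP mw ltj2 xl b1l _) => [|//|[ej h]]; first by rewrite ex e1.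
  exfalso; apply: nT; split=> //; left; rewrite -e1 ej; case: h => -[_ ->]; rewrite ?wc ?wc' //.
have u2 x : x < lsize t j2 -> ev w j2 x = c2.+1 -> x = b2.
  move=> xl ex; case: (merge_levelP mw ltj2 xl b2l _) => [|//|[ej h]]; first by rewrite ex e2.
  exfalso; apply: nT; split=> //; right; rewrite -e2 ej; case: h => -[_ ->]; rewrite ?wc ?wc' //.
exists b1, b2; split=> //; split=> //.
- by split=> // e; move: e1 e2; rewrite e; lia.
- split=> -[ej h]; apply: nT; split=> //; subst j2.
    by left; rewrite -e1; case: h => ->; rewrite ?wc ?wc'.
  by right; rewrite -e2; case: h => ->; rewrite ?wc ?wc'.
- by rewrite !uE // e1 e2 vc vc'.
- by rewrite !uE ?(ltnW cj) // wc wc'.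
move=> l x y ln xl yl ne e; case: (ker _ _ _ ln xl yl ne e) => -[el h]; subst l; [left|right]; split=> //.
by case: h => -[h1 h2]; [left | right]; split; auto.
Qed.

Lemma merge_same t r r' s (w : mor t r) (w' : mor t r') (u : mor t s) j c :
  merge_level t w j c -> merge_level t w' j c -> coarser t w u -> coarser t w' u ->
  (forall i x y, i < j -> x < lsize t i -> y < lsize t i -> x <> y ->
     ev u i x = ev u i y -> (ev w i x <= ev w i y) = (ev w' i x <= ev w' i y)) ->
  mor_val w = mor_val w'.
Proof.
move=> [ltj cj ec above [mrg injl]] [_ _ _ above' [mrg' injl']] co co' H.
apply: mor_det => i x y lti xi yi ep Hz.
have ep' : ev w' i.+1 (ev t i x) = ev w' i.+1 (ev t i y) by rewrite -!Hz ?ptree_lt.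
case: (ltngtP i j) => ij.
- case: (eqVneq x y) => [->|/eqP ne]; first by rewrite !leqnn.
  case: (eqVneq (ev u i x) (ev u i y)) => [e|/eqP neu]; first exact: H.
  have h1 := co i x y lti xi yi ep; have h2 := co i y x lti yi xi (esym ep).
  have h1' := co' i x y lti xi yi ep'; have h2' := co' i y x lti yi xi (esym ep').
  move: neu h1 h2 h1' h2'.
  case: (leqP (ev w i x) (ev w i y)); case: (leqP (ev w' i x) (ev w' i y)) => //; lia.
- by rewrite !above ?above' ?ij ?(ltnW lti).
- by subst i; rewrite !mrg // !mrg'.
Qed.

Lemma perm_listing t a : uniq a -> all (fun z => (z.1 < n) && (z.2 < lsize t z.1)) a ->
  perm_eq (a ++ [seq z <- vertices t | z \notin a]) (vertices t).
Proof.
move=> un al; apply/perm_verticesP; split.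
  rewrite cat_uniq un filter_uniq ?vertices_uniq // andbT /=.
  by apply/hasPn => z; rewrite mem_filter => /andP[].
move=> z; rewrite mem_cat mem_filter mem_vertices.
case: (boolP (z \in a)) => //= za; exact: esym (allP al z za).
Qed.

Lemma diamond_sign t r r' s (v : mor r s) (w : mor t r) (v' : mor r' s) (w' : mor t r') :
  mdeg v = 1%R -> mdeg w = 1%R -> mdeg v' = 1%R -> mdeg w' = 1%R ->
  mcomp v w = mcomp v' w' -> mor_val w <> mor_val w' ->
  sgn_odd w (+) sgn_odd v = ~~ (sgn_odd w' (+) sgn_odd v').
Proof.
move=> /mdeg1_merge[j2 [c2 mv]] /mdeg1_merge[j [c mw]] /mdeg1_merge[j2' [c2' mv']].
move=> /mdeg1_merge[j' [c' mw']] e ne.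
have cow : coarser t w (mcomp v w) by apply: coarser_comp.
have cow' : coarser t w' (mcomp v w) by rewrite e; apply: coarser_comp.
have [ltj cj rc above [mrg injl]] := mw; have [ltj' cj' rc' above' [mrg' injl']] := mw'.
have S1 := two_merges_shape mw mv; have S2 := two_merges_shape mw' mv'.
rewrite -e in S2; set u := mcomp v w in e cow cow' S1 S2.
have unt := vertices_uniq t.
case: S1 => [[ej [[_ zj cz [u1 u2] ker] _]]|[b1 [b2 [e1 e2 [[ltj2 b1l b2l nb] [nin1 nin2] ub uc ker]]]]];
case: S2 => [[ej' [[_ zj' cz' [u1' u2'] ker'] _]]|[b1' [b2' [e1' e2' [[ltj2' b1l' b2l' nb'] [nin1' nin2'] ub' uc' ker']]]]].
- have k1 := ker' j c2 c2.+1 ltj ltac:(lia) ltac:(lia) ltac:(lia) (esym u1).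
  have k2 := ker' j c2 c2.+2 ltj ltac:(lia) ltac:(lia) ltac:(lia) (esym u2).
  have ejj : j' = j by lia.
  subst j' j2 j2'; have ez : c2' = c2 by lia.
  subst c2'.
  have nc : c <> c'.
    move=> ecc; subst c'; apply: ne; apply: (merge_same mw mw' cow cow') => i x y ij xi yi nxy exy.
    have [] := ker i x y (ltn_trans ij ltj) xi yi nxy exy; lia.
  pose a := [:: (j, c2); (j, c2.+1); (j, c2.+2)].
  have pe := @perm_listing t a.
  have {}pe := pe ltac:(by rewrite /= !inE !xpair_eqE !eqxx /=; lia)
     ltac:(by rewrite /= ltj zj /= (ltnW zj) (ltnW (ltnW zj))).
  rewrite (sgn_triple mw mv _ pe); last by lia.
  rewrite (sgn_triple mw' mv' _ pe); last by lia.
  rewrite -e -/u; case: (_ (+) rearr_odd _ _); case: cz => ec; case: cz' => ec'; subst => //;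
    rewrite ?eqxx ?addbT ?addbF ?negbK //; lia.
- subst j2; exfalso.
  have k1 := ker' j c2 c2.+1 ltj ltac:(lia) ltac:(lia) ltac:(lia) (esym u1).
  have k2 := ker' j c2 c2.+2 ltj ltac:(lia) ltac:(lia) ltac:(lia) (esym u2).
  have k3 := ker' j c2.+1 c2.+2 ltj ltac:(lia) ltac:(lia) ltac:(lia) ltac:(by rewrite u1 u2).
  lia.
- subst j2'; exfalso.
  have k1 := ker j' c2' c2'.+1 ltj' ltac:(lia) ltac:(lia) ltac:(lia) (esym u1').
  have k2 := ker j' c2' c2'.+2 ltj' ltac:(lia) ltac:(lia) ltac:(lia) (esym u2').
  have k3 := ker j' c2'.+1 c2'.+2 ltj' ltac:(lia) ltac:(lia) ltac:(lia) ltac:(by rewrite u1' u2').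
  lia.
have k1 := ker' j c c.+1 ltj ltac:(lia) ltac:(lia) ltac:(lia) uc.
have k2 := ker' j2 b1 b2 ltj2 b1l b2l nb ub.
pose a := [:: (j, c); (j, c.+1); (j2, b1); (j2, b2)].
have un : uniq a.
  have d1 : (j, c) != (j, c.+1) by apply/eqP => -[]; clear; lia.
  have d2 : (j2, b1) != (j2, b2) by apply/eqP => -[].
  have d3 x : ~ (j2 = j /\ (x = c \/ x = c.+1)) ->
      ((j, c) != (j2, x)) && ((j, c.+1) != (j2, x)).
    by move=> nx; apply/andP; split; apply/eqP => -[ejj ecc]; apply: nx; auto.
  have /andP[d4 d5] := d3 _ nin1; have /andP[d6 d7] := d3 _ nin2.
  by rewrite /a /= !inE !negb_or d1 d2 d4 d5 d6 d7.
have al : all (fun z => (z.1 < n) && (z.2 < lsize t z.1)) a.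
  apply/allP => z; rewrite !inE => /or4P[] /eqP-> /=; apply/andP; split=> //; exact: ltnW.
have pe := perm_listing un al.
set R := [seq z <- vertices t | z \notin a] in pe.
have pt := pe; rewrite perm_sym in pt.
rewrite (sgn_disjoint mw mv e1 e2 pe) -/u.
have vub : vimage u (j2, b2) = vimage u (j2, b1) by rewrite /vimage /= ub.
case: k1 => -[ej k1].
  have ec : c' = c by clear -k1; lia.
  subst j' c'; case: k2 => -[ej2 k2].
    by exfalso; apply: nin1; split=> //; clear -k2; lia.
  subst j2'; case: k2 => -[eb1 eb2]; subst b1' b2'.
    exfalso; apply: ne; apply: (merge_same mw mw' cow cow') => i x y ij xi yi nxy exy.
    case: (ker i x y (ltn_trans ij ltj) xi yi nxy exy) => -[ei h]; first by lia.
    subst i; case: h => -[-> ->]; rewrite e1 e2 e1' e2'; lia.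
  have pe' : perm_eq [:: (j, c), (j, c.+1), (j2, b2), (j2, b1) & R] (vertices t).
    by apply: perm_trans pe; exact: (perm_swap [:: (j, c); (j, c.+1)] (j2, b2)).
  rewrite (sgn_disjoint mw' mv' e1' e2' pe') -e -/u vub.
  rewrite (rearr_swapr (a := [:: (j, c); (j, c.+1)]) (x := (j2, b1)) (y := (j2, b2)) unt) //=.
  by rewrite addNb negbK.
subst j2'; case: k2 => -[ej2 k2]; last first.
  by exfalso; apply: nin1; split=> //; clear -k1 k2; lia.
subst j'.
have f1 := mor_fib w' ltj (leqnSn c) cj rc.
have f2 := mor_fib w ltj2 (leqnSn c') cj' rc'.
have [eb1 eb2] : b1 = c' /\ b2 = c'.+1.
  by case: k2 => // -[h1 h2]; move: f2; rewrite -h1 -h2 e1 e2; clear; lia.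
have [eb1' eb2'] : b1' = c /\ b2' = c.+1.
  by case: k1 => -[h1 h2] //; move: f1; rewrite h2 h1 e1' e2'; clear; lia.
subst b1 b2 b1' b2'.
set p := (j, c) in pe pt *; set q := (j, c.+1) in pe pt *.
set p' := (j2, c') in pe pt vub *; set q' := (j2, c'.+1) in pe pt vub *.
have s1 := perm_swap [:: p] q p' (q' :: R).
have s2 := perm_swap [::] p p' (q :: q' :: R).
have s3 := perm_swap [:: p'; p] q q' R.
have s4 := perm_swap [:: p'] p q' (q :: R).
have p1 := perm_trans pt s1; have p2 := perm_trans p1 s2.
have p3 := perm_trans p2 s3; have p4 := perm_trans p3 s4.
have pe' : perm_eq [:: p', q', p, q & R] (vertices t) by rewrite perm_sym.
rewrite (sgn_disjoint mw' mv' e1' e2' pe') -e -/u -/p' -/q' -/p -/q.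
have := rearr_swapr (a := [:: p']) unt p3; rewrite /= => ->.
have := rearr_swapr (a := [:: p'; p]) unt p2; rewrite /= => ->.
have := rearr_swapr (a := [::]) unt p1; rewrite /= => ->.
have := rearr_swapr (a := [:: p]) unt pt; rewrite /= => ->.
rewrite !negbK.
have im : perm_eq (vertices s) [:: vimage u p', vimage u p & map (vimage u) R].
  have im1 := perm_image mw pe.
  have pr : perm_eq [:: (j2, c2), (j2, c2.+1), (j, c) & map (vimage w) R] (vertices r).
    move: im1; rewrite /= {1 2}/vimage /= e1 e2 => im1.
    apply: perm_trans im1; apply: (perm_trans (perm_swap [:: (j2, c2)] (j2, c2.+1) (j, c) _)).
    exact: (perm_swap [::] (j2, c2) (j, c)).
  have im2 := perm_image mv pr; rewrite perm_sym; move: im2; rewrite /=.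
  rewrite (map_vimage_comp v w (R := R)); last exact: (perm_vertices_mem (a := a) pe).
  have [wc _] := merge_level_bot mw; have [vc _] := merge_level_bot mv.
  have -> : vimage v (j, c) = vimage u p by rewrite /vimage /= ev_mcomp ?wc // ltnW.
  by have -> : (j2, c2) = vimage u p' by rewrite /vimage /= ev_mcomp ?e1 ?vc // ltnW.
have := rearr_swapl (a := [::]) (vertices_uniq s) im; rewrite /= => ->.
by rewrite addbN negbK.
Qed.

End Diamond.

(** * Graded free modules *)

Local Open Scope ring_scope.

Section Linear.
Variable k : comPzRingType.

Section Maps.
Variables (U V : lmodType k) (f : U -> V).
Hypothesis lf : is_linear f.

Lemma lin0 : f 0 = 0.
Proof. by have := lf (-1) 0 0; rewrite scaler0 addr0 scaleN1r addNr. Qed.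

Lemma linZ a x : f (a *: x) = a *: f x.
Proof. by have := lf a x 0; rewrite !addr0 lin0 addr0. Qed.

Lemma linD x y : f (x + y) = f x + f y.
Proof. by have := lf 1 x y; rewrite !scale1r. Qed.

Lemma linN x : f (- x) = - f x.
Proof. by rewrite -!scaleN1r linZ. Qed.

Lemma linB x y : f (x - y) = f x - f y.
Proof. by rewrite linD linN. Qed.

Lemma lin_sum (I : Type) (s : seq I) (P : pred I) (F : I -> U) :
  f (\sum_(i <- s | P i) F i) = \sum_(i <- s | P i) f (F i).
Proof. by apply: (big_morph f linD lin0). Qed.

End Maps.

Lemma lin_comp (U V W : lmodType k) (f : V -> W) (g : U -> V) :
  is_linear f -> is_linear g -> is_linear (fun x => f (g x)).
Proof. by move=> lf lg a x y; rewrite lg lf. Qed.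

Lemma lin_add (U V : lmodType k) (f g : U -> V) :
  is_linear f -> is_linear g -> is_linear (fun x => f x + g x).
Proof. by move=> lf lg a x y; rewrite lf lg scalerDr addrACA. Qed.

Lemma lin_scale (U V : lmodType k) c (f : U -> V) :
  is_linear f -> is_linear (fun x => c *: f x).
Proof. by move=> lf a x y; rewrite lf scalerDr !scalerA mulrC. Qed.

Lemma lin_zero (U V : lmodType k) : is_linear (fun _ : U => 0 : V).
Proof. by move=> a x y; rewrite scaler0 addr0. Qed.

Lemma lin_id (U : lmodType k) : is_linear (fun x : U => x).
Proof. by []. Qed.

Section Free.
Variable K : choiceType.
Implicit Types (x y : freemod k K) (p q : K).

Lemma fcoefZ c x p : (c *: x)@_p = c * x@_p.
Proof. exact: fscaleE. Qed.

Lemma fcoefD x y p : (x + y)@_p = x@_p + y@_p.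
Proof. exact: mcoeffD. Qed.

Lemma fcoefB x y p : (x - y)@_p = x@_p - y@_p.
Proof. exact: mcoeffB. Qed.

Lemma fcoef0 p : (0 : freemod k K)@_p = 0.
Proof. exact: mcoeff0. Qed.

Lemma fcoef_sum (I : Type) (s : seq I) (P : pred I) (F : I -> freemod k K) p :
  (\sum_(i <- s | P i) F i)@_p = \sum_(i <- s | P i) (F i)@_p.
Proof. by apply: (big_morph (fun x : freemod k K => x@_p)); [exact: (fun a b => fcoefD a b p) | exact: fcoef0]. Qed.

Lemma fcoef_basis p q : (basis p : freemod k K)@_q = (p == q)%:R.
Proof. exact: mcoeffU. Qed.

Lemma freemodP x y : (forall p, x@_p = y@_p) -> x = y.
Proof. by move=> h; apply/malgP. Qed.

Lemma fsum_coef (V : lmodType k) (f : K -> V) x (s : seq K) : uniq s ->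
  {subset msupp x <= s} -> linext f x = \sum_(p <- s) x@_p *: f p.
Proof.
move=> us sub; rewrite /linext.
rewrite [RHS](bigID (fun p => p \in msupp x)) /= [X in _ + X]big1 ?addr0; last first.
  by move=> p; rewrite -mcoeff_eq0 => /eqP ->; rewrite scale0r.
rewrite -[RHS]big_filter; apply: perm_big; apply: uniq_perm; rewrite ?filter_uniq ?fset_uniq //.
by move=> p; rewrite mem_filter; case: (boolP (p \in msupp x)) => // /sub ->.
Qed.

Lemma linext_linear (V : lmodType k) (f : K -> V) : is_linear (linext f : freemod k K -> V).
Proof.
move=> a x y; pose s : seq K := undup (msupp x ++ msupp y ++ msupp (a *: x + y)).
have us : uniq s by apply: undup_uniq.
have sub z : {subset z <= msupp x ++ msupp y ++ msupp (a *: x + y)} -> {subset z <= s}.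
  by move=> h p /h; rewrite mem_undup.
rewrite !(@fsum_coef _ f _ s) //; try by apply: sub => p; rewrite !mem_cat => ->; rewrite ?orbT.
rewrite scaler_sumr -big_split /=; apply: eq_bigr => p _.
by rewrite fcoefD fcoefZ scalerDl scalerA.
Qed.

Lemma linext_basis (V : lmodType k) (f : K -> V) p : linext f (basis p : freemod k K) = f p.
Proof.
rewrite (@fsum_coef _ f _ [:: p]) //; first by rewrite big_seq1 fcoef_basis eqxx scale1r.
by move=> q; rewrite inE -mcoeff_neq0 fcoef_basis; case: (p =P q) => [->|_]; rewrite eqxx.
Qed.

Lemma basis_sum x : x = \sum_(p <- msupp x) x@_p *: (basis p : freemod k K).
Proof.
apply: freemodP => q; rewrite fcoef_sum.
under eq_bigr => p _ do rewrite fcoefZ fcoef_basis.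
case: (boolP (q \in msupp x)) => qx.
  rewrite (bigD1_seq q) ?fset_uniq //= eqxx mulr1 big1 ?addr0 // => p /negbTE ->; exact: mulr0.
rewrite big1_seq ?mcoeff_outdom // => p /= pin.
by case: eqP => [e|_]; [rewrite -e pin in qx | rewrite mulr0].
Qed.

Lemma linear_eq (V : lmodType k) (f g : freemod k K -> V) : is_linear f -> is_linear g ->
  forall x, (forall p, p \in msupp x -> f (basis p) = g (basis p)) -> f x = g x.
Proof.
move=> lf lg x h; rewrite [x]basis_sum !lin_sum //; apply: eq_big_seq => p px.
by rewrite !linZ // h.
Qed.

Lemma linear_ext (V : lmodType k) (f g : freemod k K -> V) : is_linear f -> is_linear g ->
  (forall p, f (basis p) = g (basis p)) -> forall x, f x = g x.
Proof. by move=> lf lg h x; apply: linear_eq. Qed.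

Lemma linext_fun (V : lmodType k) (f g : K -> V) a x :
  linext (fun p => a *: f p + g p) x = a *: linext f x + linext g x.
Proof.
rewrite /linext scaler_sumr -big_split /=; apply: eq_bigr => p _.
by rewrite scalerDr !scalerA mulrC.
Qed.

Lemma eq_linext (V : lmodType k) (f g : K -> V) : f =1 g -> linext f =1 (linext g : freemod k K -> V).
Proof. by move=> h x; apply: eq_bigr => p _; rewrite h. Qed.

Section Homog.
Variable deg : K -> int.

Definition fhomog (i : int) (x : freemod k K) : Prop := forall p, p \in msupp x -> deg p = i.

Lemma fhomog0 i : fhomog i 0.
Proof. by move=> p; rewrite -mcoeff_neq0 fcoef0 eqxx. Qed.

Lemma fhomog_lin i a x y : fhomog i x -> fhomog i y -> fhomog i (a *: x + y).
Proof.
move=> hx hy p; rewrite -mcoeff_neq0 fcoefD fcoefZ.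
case: (boolP (p \in msupp x)) => [/hx//|px]; case: (boolP (p \in msupp y)) => [/hy//|py].
by rewrite !mcoeff_outdom // mulr0 addr0 eqxx.
Qed.

Lemma fhomogZ i a x : fhomog i x -> fhomog i (a *: x).
Proof. by move=> h; rewrite -[_ *: _]addr0; apply: fhomog_lin => //; apply: fhomog0. Qed.

Lemma fhomogD i x y : fhomog i x -> fhomog i y -> fhomog i (x + y).
Proof. by move=> hx hy; rewrite -[x]scale1r; apply: fhomog_lin. Qed.

Lemma fhomogB i x y : fhomog i x -> fhomog i y -> fhomog i (x - y).
Proof. by move=> hx hy; rewrite addrC -scaleN1r; apply: fhomog_lin. Qed.

Lemma fhomog_sum i (I : eqType) (s : seq I) (F : I -> freemod k K) :
  (forall j, j \in s -> fhomog i (F j)) -> fhomog i (\sum_(j <- s) F j).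
Proof.
move=> h; rewrite big_seq; apply: (big_ind (fhomog i)) => //; first exact: fhomog0.
exact: fhomogD.
Qed.

Lemma fhomog_basis p : fhomog (deg p) (basis p).
Proof. by move=> q; rewrite -mcoeff_neq0 fcoef_basis; case: (p =P q) => [->//|_]; rewrite eqxx. Qed.

Lemma fhomog_spanP i (P : freemod k K -> Prop) x : fhomog i x -> P 0 ->
  (forall x y, P x -> P y -> P (x + y)) -> (forall a p, deg p = i -> P (a *: basis p)) -> P x.
Proof.
move=> hx P0 PD PZ; rewrite [x]basis_sum big_seq; apply: (big_ind P) => // p px.
exact/PZ/hx.
Qed.

Lemma free_dgmod (D : freemod k K -> freemod k K) : is_linear D ->
  (forall p, fhomog (deg p - 1) (D (basis p))) ->
  (forall p, D (D (basis p)) = 0) ->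
  is_dgmod (@DgModData k (freemod k K) fhomog D).
Proof.
move=> lD hD DD; split=> /=.
- exact: fhomog0.
- by move=> *; apply: fhomog_lin.
- move=> x; pose c i : freemod k K := \sum_(p <- msupp x | deg p == i) x@_p *: basis p.
  exists (undup [seq deg p | p <- msupp x]), c; split.
    move=> i; rewrite /c -big_filter; apply: fhomog_sum => p.
    rewrite mem_filter => /andP[/eqP <- _]; apply: fhomogZ; exact: fhomog_basis.
  rewrite /c {1}[x]basis_sum big_seq; under [RHS]eq_bigr do rewrite big_mkcond big_seq.
  rewrite exchange_big /=; apply: eq_bigr => p px.
  rewrite (bigD1_seq (deg p)) ?undup_uniq //= ?eqxx ?mem_undup ?map_f //.
  by rewrite big1 ?addr0 // => i /negbTE; rewrite eq_sym => ->.
- move=> s c us hc e i si; apply: freemodP => p; rewrite fcoef0.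
  case: (eqVneq (deg p) i) => dp; last first.
    by apply: mcoeff_outdom; apply/negP => /hc/eqP; rewrite (negbTE dp).
  have := congr1 (fun x : freemod k K => x@_p) e; rewrite fcoef0 fcoef_sum (bigD1_seq i) //=.
  rewrite big1 ?addr0 // => j ji; apply: mcoeff_outdom; apply/negP => /hc e'.
  by rewrite -e' dp eqxx in ji.
- exact: lD.
- move=> i x hx; apply: (fhomog_spanP (P := fun z => fhomog (i - 1) (D z)) hx).
  + by rewrite lin0 //; apply: fhomog0.
  + by move=> y z; rewrite linD //; apply: fhomogD.
  + by move=> a p <-; rewrite linZ //; apply: fhomogZ.
move=> x; apply: (@linear_ext _ (fun x => D (D x)) (fun _ => 0)) => //.
  exact: lin_comp.
exact: lin_zero.
Qed.

End Homog.
End Free.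

Section Bilinear.
Variables (K1 K2 K3 : choiceType) (op : K1 -> K2 -> K3).

Definition bilext (x : freemod k K1) (y : freemod k K2) : freemod k K3 :=
  linext (fun p => linext (fun q => basis (op p q) : freemod k K3) y) x.

Lemma bilext_linl y : is_linear (bilext^~ y).
Proof. exact: linext_linear. Qed.

Lemma bilext_linr x : is_linear (bilext x).
Proof.
move=> a y z; rewrite /bilext -linext_fun; apply: eq_linext => p.
exact: linext_linear.
Qed.

Lemma bilext_basis p q : bilext (basis p) (basis q) = basis (op p q).
Proof. by rewrite /bilext !linext_basis. Qed.

Lemma bilext_homog (d1 : K1 -> int) (d2 : K2 -> int) (d3 : K3 -> int) i j x y :
  (forall p q, d3 (op p q) = d1 p + d2 q) ->
  fhomog d1 i x -> fhomog d2 j y -> fhomog d3 (i + j) (bilext x y).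
Proof.
move=> hd hx hy; apply: (fhomog_spanP (P := fun z => fhomog d3 (i + j) (bilext z y)) hx).
- rewrite (lin0 (bilext_linl y)); exact: fhomog0.
- by move=> a b ha hb; rewrite (linD (bilext_linl y)); apply: fhomogD.
move=> a p dp; rewrite (linZ (bilext_linl y)); apply: fhomogZ.
apply: (fhomog_spanP (P := fun z => fhomog d3 (i + j) (bilext (basis p) z)) hy).
- rewrite (lin0 (bilext_linr _)); exact: fhomog0.
- by move=> b c hb hc; rewrite (linD (bilext_linr _)); apply: fhomogD.
move=> b q dq; rewrite (linZ (bilext_linr _)); apply: fhomogZ.
by rewrite bilext_basis -dp -dq -hd; apply: fhomog_basis.
Qed.

End Bilinear.

Lemma bilext_assoc (K1 K2 K3 K12 K23 K : choiceType)
  (op1 : K1 -> K23 -> K) (op2 : K2 -> K3 -> K23) (op3 : K12 -> K3 -> K) (op4 : K1 -> K2 -> K12) :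
  (forall p q r, op1 p (op2 q r) = op3 (op4 p q) r) ->
  forall x y z, bilext op1 x (bilext op2 y z) = bilext op3 (bilext op4 x y) z.
Proof.
move=> h x y z.
apply: (linear_ext (f := fun x => bilext op1 x (bilext op2 y z))
  (g := fun x => bilext op3 (bilext op4 x y) z)) => [||p]; first exact: bilext_linl.
  by apply: lin_comp; apply: bilext_linl.
apply: (linear_ext (f := fun y => bilext op1 (basis p) (bilext op2 y z))
  (g := fun y => bilext op3 (bilext op4 (basis p) y) z)) => [||q].
- by apply: lin_comp; [apply: bilext_linr | apply: bilext_linl].
- by apply: lin_comp; [apply: bilext_linl | apply: bilext_linr].
apply: (linear_ext (f := fun z => bilext op1 (basis p) (bilext op2 (basis q) z))
  (g := fun z => bilext op3 (bilext op4 (basis p) (basis q)) z)) => [||r].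
- by apply: lin_comp; apply: bilext_linr.
- exact: bilext_linr.
by rewrite !bilext_basis h.
Qed.

Lemma isignD (i j : int) : isign k (i + j) = isign k i * isign k j.
Proof.
rewrite /isign -exprD -[in RHS]signr_odd -[LHS]signr_odd; congr (_ ^+ nat_of_bool _).
have [m em] : exists m, (absz i + absz j = absz (i + j)%R + m.*2)%N.
  exists (uphalf (absz i + absz j - absz (i + j)%R))%N.
  case: i j => i [] j; rewrite ?NegzE; lia.
by rewrite em oddD odd_double addbF.
Qed.

Lemma isign_sqr (i : int) : isign k i * isign k i = 1.
Proof. by rewrite /isign -expr2 sqrr_sign. Qed.

Lemma isign0 : isign k 0 = 1.
Proof. by []. Qed.

Lemma isign1 : isign k 1 = -1.
Proof. by rewrite /isign expr1. Qed.

Lemma isignN1 : isign k (-1) = -1.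
Proof. by rewrite /isign expr1. Qed.

Lemma isignB1 (i : int) : isign k (i - 1) = - isign k i.
Proof. by rewrite isignD isignN1 mulrN1. Qed.

End Linear.

(** * The cobar construction *)

Section Paths.
Variable n : nat.
Implicit Types t r s : ptree n.

Lemma ptree_pair_inj (P : ptree n -> Type) b (x y : P b) : existT P b x = existT P b y -> x = y.
Proof. by apply: inj_pair2_eq_dec => a c; apply: decP eqP. Qed.

Lemma gcons_inj t r r' s (v : gen r s) (p : cpath t r) (v' : gen r' s) (p' : cpath t r') :
  gcons v p = gcons v' p' -> existT (fun r => (gen r s * cpath t r)%type) r (v, p) = existT _ r' (v', p').
Proof.
pose hd a (q : cpath t a) := match q in gpath _ _ a return option {r & (gen r a * cpath t r)%type} with
  | gnil => None | gcons _ _ u q' => Some (existT _ _ (u, q')) end.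
by move=> e; apply: Some_inj; exact: (congr1 (@hd s) e).
Qed.

Lemma gcons_inj2 t r s (v v' : gen r s) (p p' : cpath t r) :
  gcons v p = gcons v' p' -> v = v' /\ p = p'.
Proof.
move=> /gcons_inj e.
by have [-> ->] := @ptree_pair_inj (fun r => (gen r s * cpath t r)%type) _ _ _ e.
Qed.

Lemma gen_deg t s (u : gen t s) : 1 <= mdeg u.
Proof.
have := mdeg_ge0 u; rewrite le_eqVlt => /orP[/eqP e|]; last lia.
by have := genP u; rewrite -mdeg0 -e eqxx.
Qed.

Lemma gen_of t s (u : mor t s) : 1 <= mdeg u -> exists g : gen t s, gen_mor g = u.
Proof.
move=> h; have nid : ~~ is_id u by rewrite -mdeg0; apply/eqP => e; rewrite e in h.
by exists (Gen nid).
Qed.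

Lemma gen_inj t s (u v : gen t s) : gen_mor u = gen_mor v -> u = v.
Proof. exact: val_inj. Qed.

Lemma gcatA t r q s (a : cpath q s) (b : cpath r q) (c : cpath t r) :
  gcat a (gcat b c) = gcat (gcat a b) c.
Proof. by elim: a b => //= b' c' u a IH b; rewrite IH. Qed.

Lemma gcat_nil t s (a : cpath t s) : gcat a (gnil t) = a.
Proof. by elim: a => //= b c u a ->. Qed.

Lemma cpath_deg_cat t r s (a : cpath r s) (b : cpath t r) :
  cpath_deg (gcat a b) = cpath_deg a + cpath_deg b.
Proof. by elim: a b => [|b' c' u a IH] b /=; rewrite ?add0r // IH addrA. Qed.

Lemma cpath_deg_ge0 t s (p : cpath t s) : 0 <= cpath_deg p.
Proof. elim: p => //= b c u p IH; have := gen_deg u; lia. Qed.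

Fixpoint pcomp t s (p : cpath t s) : mor t s :=
  match p in gpath _ _ s return mor t s with
  | gnil => mid t
  | gcons _ _ u p' => mcomp u (pcomp p')
  end.

Definition factor t s : choiceType := {r : ptree n & (gen r s * gen t r)%type}.

Definition code (B : nat) (w : seq (seq nat)) : {ffun 'I_n -> {ffun 'I_B -> 'I_B.+1}} :=
  [ffun i : 'I_n => [ffun x : 'I_B => inord (ev w i x)]].

Lemma code_inj B r s s' (u : mor r s) (v : mor r s') :
  (forall i, (i < n)%N -> (lsize r i <= B)%N) ->
  code B u = code B v -> mor_val u = mor_val v.
Proof.
move=> hB e; apply: mor_ext => i x lti xi.
have xB : (x < B)%N by apply: leq_trans xi (hB i lti).
have := congr1 (fun f : {ffun 'I_n -> {ffun 'I_B -> 'I_B.+1}} => f (Ordinal lti) (Ordinal xB)) e.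
rewrite !ffunE /= => /(congr1 (@nat_of_ord _)); rewrite !inordK //.
  apply: leq_trans (ev_mor v (ltnW lti) xi) _; apply: leq_trans (lsize_le v (ltnW lti)) _.
  exact/leqW/hB.
apply: leq_trans (ev_mor u (ltnW lti) xi) _; apply: leq_trans (lsize_le u (ltnW lti)) _.
exact/leqW/hB.
Qed.

Lemma factor_eq t s (f g : factor t s) : mcomp (tagged f).1 (tagged f).2 = mcomp (tagged g).1 (tagged g).2 ->
  mor_val (tagged f).2 = mor_val (tagged g).2 -> f = g.
Proof.
case: f => r [v w]; case: g => r' [v' w'] /= e1 e2.
have er := mor_tgt e2; subst r'.
have ew : w = w' by apply: gen_inj; apply: val_inj.
subst w'; congr existT; congr pair; apply: gen_inj; exact: mcomp_epi e1.
Qed.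

Lemma finite_factor t s : finite_set [set: factor t s]%classic.
Proof.
pose B := width t.
pose f (x : factor t s) := (code B (tagged x).1, code B (tagged x).2).
have hB (x : factor t s) i : (i < n)%N -> (lsize (tag x) i <= B)%N.
  move=> lti; apply: leq_trans (lsize_le (tagged x).2 (ltnW lti)) _; exact: lsize_width.
have fi : injective f.
  move=> x y [e1 e2].
  have e2' := code_inj (fun i lti => lsize_width t lti) e2.
  move: e1 e2' (hB x); case: x {e2} => r [v w]; case: y => r' [v' w'] /= e1 e2 hx.
  have er := mor_tgt e2; subst r'.
  have ew : w = w' by apply: gen_inj; apply: val_inj.
  subst w'; congr existT; congr pair; apply: gen_inj; apply: val_inj; exact: (code_inj hx e1).
have -> : [set: factor t s]%classic = (f @^-1` [set: _])%classic by [].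
apply: finite_preimage; first by move=> x y _ _; apply: fi.
exact: finite_finset.
Qed.

Definition factors t s (u : mor t s) : seq (factor t s) :=
  fset_set [set f : factor t s | mcomp (tagged f).1 (tagged f).2 = u]%classic.

Lemma factors_uniq t s (u : mor t s) : uniq (factors u).
Proof. exact: fset_uniq. Qed.

Lemma mem_factors t s (u : mor t s) f :
  (f \in factors u) <-> mcomp (tagged f).1 (tagged f).2 = u.
Proof.
rewrite /factors in_fset_set; last by apply: sub_finite_set (finite_factor t s).
by rewrite inE.
Qed.

Lemma gen_d_sum (k : comPzRingType) t s (u : gen t s) :
  gen_d k u = \sum_(f <- factors u) isign k (mdeg (tagged f).1) *:
      basis (gcons (tagged f).1 (gcons (tagged f).2 (gnil t))).
Proof. by rewrite /gen_d fsbig_finite //=; apply: sub_finite_set (finite_factor t s). Qed.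

Lemma factor_deg t s (u : mor t s) f : f \in factors u ->
  mdeg u = mdeg (tagged f).1 + mdeg (tagged f).2.
Proof. by move/mem_factors <-; rewrite mdegM. Qed.

End Paths.

Section PathDgCat.
Variables (k : comPzRingType) (n : nat).
Implicit Types t r s : ptree n.

Definition path_hom (D : forall t s : ptree n, cobar_car k t s -> cobar_car k t s) t s : dgmod_data k :=
  @DgModData k (cobar_car k t s) (fhomog (@cpath_deg n t s)) (@D t s).

Definition path_dgcat D : dgcat_data k (ptree n) :=
  DgCatData (dg_hom := path_hom D) (fun t => basis (gnil t)) (@cobar_comp k n).

Lemma cobar_comp_linl t r s (y : cobar_car k t r) :
  is_linear (fun x : cobar_car k r s => cobar_comp x y).
Proof. exact: linext_linear. Qed.

Lemma cobar_comp_linr t r s (x : cobar_car k r s) :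
  is_linear (fun y : cobar_car k t r => cobar_comp x y).
Proof. exact: (bilext_linr (@gcat _ _ t r s)). Qed.

Lemma cobar_comp_basis t r s (p : cpath r s) (q : cpath t r) :
  cobar_comp (basis p : cobar_car k r s) (basis q) = basis (gcat p q).
Proof. exact: (bilext_basis k (@gcat _ _ t r s)). Qed.

Lemma cobar_compA t q r s (x : cobar_car k q s) (y : cobar_car k r q) (z : cobar_car k t r) :
  cobar_comp x (cobar_comp y z) = cobar_comp (cobar_comp x y) z.
Proof. apply: bilext_assoc; exact: gcatA. Qed.

Lemma cobar_comp1l t s (x : cobar_car k t s) : cobar_comp (basis (gnil s)) x = x.
Proof.
move: x; apply: linear_ext => [||p]; [exact: cobar_comp_linr | exact: lin_id |].
by rewrite cobar_comp_basis.
Qed.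

Lemma cobar_comp1r t s (x : cobar_car k t s) : cobar_comp x (basis (gnil t)) = x.
Proof.
move: x; apply: linear_ext => [||p]; [exact: cobar_comp_linl | exact: lin_id |].
by rewrite cobar_comp_basis gcat_nil.
Qed.

Lemma cobar_comp_homog t r s i j (x : cobar_car k r s) (y : cobar_car k t r) :
  fhomog (@cpath_deg n r s) i x -> fhomog (@cpath_deg n t r) j y ->
  fhomog (@cpath_deg n t s) (i + j) (cobar_comp x y).
Proof. apply: bilext_homog => p q; exact: cpath_deg_cat. Qed.

Lemma path_derivation D :
  (forall t s, is_linear (@D t s)) ->
  (forall t r s (p : cpath r s) (q : cpath t r), D t s (basis (gcat p q)) =
     cobar_comp (D r s (basis p)) (basis q) +
     isign k (cpath_deg p) *: cobar_comp (basis p) (D t r (basis q))) ->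
  forall a b c i (x : cobar_car k b c) (y : cobar_car k a b), fhomog (@cpath_deg n b c) i x ->
    D a c (cobar_comp x y) = cobar_comp (D b c x) y + isign k i *: cobar_comp x (D a b y).
Proof.
move=> lD der a b c i x y hx; apply: (linear_eq (f := fun x => D a c (cobar_comp x y))
  (g := fun x => cobar_comp (D b c x) y + isign k i *: cobar_comp x (D a b y))) => [||p px].
- by apply: lin_comp; [apply: lD | apply: cobar_comp_linl].
- apply: lin_add.
    by apply: (lin_comp (f := fun x => cobar_comp x y)); [apply: cobar_comp_linl | apply: lD].
  by apply: lin_scale; apply: cobar_comp_linl.
rewrite -(hx p px).
apply: (linear_ext (f := fun y => D a c (cobar_comp (basis p) y))
  (g := fun y => cobar_comp (D b c (basis p)) y +
    isign k (cpath_deg p) *: cobar_comp (basis p) (D a b y))) => [||q].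
- by apply: lin_comp; [apply: lD | apply: cobar_comp_linr].
- apply: lin_add; first exact: cobar_comp_linr.
  apply: lin_scale; apply: (lin_comp (f := fun y => cobar_comp (basis p) y)).
    exact: cobar_comp_linr.
  exact: lD.
by rewrite cobar_comp_basis der.
Qed.

Lemma path_dgcatP D :
  (forall t s, is_linear (@D t s)) ->
  (forall t s (p : cpath t s), fhomog (@cpath_deg n t s) (cpath_deg p - 1) (D t s (basis p))) ->
  (forall t s (p : cpath t s), D t s (D t s (basis p)) = 0) ->
  (forall t r s (p : cpath r s) (q : cpath t r), D t s (basis (gcat p q)) =
     cobar_comp (D r s (basis p)) (basis q) +
     isign k (cpath_deg p) *: cobar_comp (basis p) (D t r (basis q))) ->
  (forall t, D t t (basis (gnil t)) = 0) ->
  is_dgcat (path_dgcat D).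
Proof.
move=> lD hD DD der D1; split=> //=.
- by move=> a b; apply: free_dgmod; [exact: lD | exact: hD | exact: DD].
- by move=> a b c y; apply: cobar_comp_linl.
- by move=> a b c x; apply: cobar_comp_linr.
- by move=> a b c i j x y; apply: cobar_comp_homog.
- exact: path_derivation.
- by move=> a; apply: (@fhomog_basis k _ (@cpath_deg n a a)).
- by move=> *; apply: cobar_compA.
- by move=> *; apply: cobar_comp1l.
- by move=> *; apply: cobar_comp1r.
Qed.

Definition cobar_d t s : cobar_car k t s -> cobar_car k t s :=
  linext (fun p : cpath t s => cpath_d k p).

Lemma cobar_d_linear t s : is_linear (@cobar_d t s).
Proof. exact: linext_linear. Qed.

Lemma cobar_d_basis t s (p : cpath t s) : cobar_d (basis p) = cpath_d k p.
Proof. exact: linext_basis. Qed.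

Lemma gen_d_homog t s (u : gen t s) : fhomog (@cpath_deg n t s) (mdeg u - 1 - 1) (gen_d k u).
Proof.
rewrite gen_d_sum; apply: fhomog_sum => f /factor_deg e; apply: fhomogZ.
have -> : mdeg u - 1 - 1 =
    cpath_deg (gcons (tagged f).1 (gcons (tagged f).2 (gnil t))) by rewrite /= e; move: (mdeg _) (mdeg _) => a b; lia.
exact: (@fhomog_basis k _ (@cpath_deg n t s)).
Qed.

Lemma gcons_basis t r s (u : gen r s) (p : cpath t r) :
  basis (gcons u p) = cobar_comp (basis (gcons u (gnil r)) : cobar_car k r s) (basis p).
Proof. by rewrite cobar_comp_basis. Qed.

Lemma cpath_d_homog t s (p : cpath t s) :
  fhomog (@cpath_deg n t s) (cpath_deg p - 1) (cpath_d k p).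
Proof.
elim: p => [|b c u p IH] /=; first exact: fhomog0.
apply: fhomogD.
  have -> : mdeg u - 1 + cpath_deg p - 1 = (mdeg u - 1 - 1) + cpath_deg p by lia.
  apply: cobar_comp_homog; [exact: gen_d_homog | exact: (@fhomog_basis k _ (@cpath_deg n t b))].
apply: fhomogZ.
have -> : mdeg u - 1 + cpath_deg p - 1 = cpath_deg (gcons u (gnil b)) + (cpath_deg p - 1).
  by rewrite /=; lia.
by apply: cobar_comp_homog => //; exact: (@fhomog_basis k _ (@cpath_deg n b c)).
Qed.

Lemma cpath_d_cat t r s (p : cpath r s) (q : cpath t r) :
  cpath_d k (gcat p q) = cobar_comp (cpath_d k p) (basis q) +
    isign k (cpath_deg p) *: cobar_comp (basis p) (cpath_d k q).
Proof.
elim: p q => [|b c u p IH] q /=.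
  by rewrite (lin0 (cobar_comp_linl _)) add0r isign0 scale1r cobar_comp1l.
rewrite IH -(cobar_comp_basis p q) (linD (cobar_comp_linr _)) (linZ (cobar_comp_linr _)).
rewrite (linD (cobar_comp_linl _)) (linZ (cobar_comp_linl _)).
rewrite scalerDr scalerA -(isignD k (mdeg u - 1) (cpath_deg p)) addrA !cobar_compA.
by rewrite -(gcons_basis u p).
Qed.

Lemma cpath_d_gen t s (u : gen t s) : cpath_d k (gcons u (gnil t)) = gen_d k u.
Proof.
by rewrite /= (lin0 (cobar_comp_linr _)) scaler0 addr0 [LHS]cobar_comp1r.
Qed.

Lemma cpath_d_cons t r s (u : gen r s) (p : cpath t r) :
  cpath_d k (gcons u p) = cobar_comp (gen_d k u) (basis p) +
    isign k (mdeg u - 1) *: cobar_comp (basis (gcons u (gnil r))) (cpath_d k p).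
Proof. by []. Qed.

Lemma cobar_d_gen t s (u : gen t s) : cobar_d (gen_d k u) = 0.
Proof.
pose triple : choiceType := {r2 : ptree n & {r1 : ptree n & (gen r1 s * gen r2 r1 * gen t r2)%type}}.
pose P (x : triple) : cpath t s :=
  gcons (tagged (tagged x)).1.1 (gcons (tagged (tagged x)).1.2 (gcons (tagged (tagged x)).2 (gnil t))).
pose mkl (f : factor t s) (g : factor (tag f) s) : triple :=
  existT _ (tag f) (existT _ (tag g) ((tagged g).1, (tagged g).2, (tagged f).2)).
pose mkr (f : factor t s) (g : factor t (tag f)) : triple :=
  existT _ (tag g) (existT _ (tag f) ((tagged f).1, (tagged g).1, (tagged g).2)).
pose G (x : triple) : cobar_car k t s := isign k (mdeg (tagged (tagged x)).1.2) *: basis (P x).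
pose L1 := [seq mkl f g | f <- factors u, g <- factors (tagged f).1].
pose L2 := [seq mkr f g | f <- factors u, g <- factors (tagged f).2].
have -> : cobar_d (gen_d k u) = \sum_(x <- L1) G x - \sum_(x <- L2) G x.
  rewrite /L1 /L2 !big_allpairs_dep -sumrB gen_d_sum (lin_sum (@cobar_d_linear t s)).
  apply: eq_bigr => -[r [v w]] _; rewrite (linZ (@cobar_d_linear t s)) cobar_d_basis [tagged _]/=.
  rewrite cpath_d_cons cpath_d_gen scalerDr; congr (_ + _).
    rewrite gen_d_sum (lin_sum (cobar_comp_linl _)) scaler_sumr.
    rewrite !big_seq; apply: eq_bigr => -[r1 [a b]] /factor_deg /= e.
    rewrite (linZ (cobar_comp_linl _)) cobar_comp_basis scalerA e isignD /G /P /=.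
    by rewrite mulrAC isign_sqr mul1r.
  rewrite scalerA isignB1 mulrN isign_sqr scaleN1r gen_d_sum (lin_sum (cobar_comp_linr _)).
  congr (- _); apply: eq_bigr => -[r1 [c d]] _.
  by rewrite (linZ (cobar_comp_linr _)) cobar_comp_basis.
suff pe : perm_eq L1 L2 by rewrite (perm_big _ pe) subrr.
have eq3 r2 r2' r1 r1' (a : gen r1 s) (b : gen r2 r1) (c : gen t r2)
    (a' : gen r1' s) (b' : gen r2' r1') (c' : gen t r2') :
    existT _ r2 (existT _ r1 (a, b, c)) = existT _ r2' (existT _ r1' (a', b', c')) :> triple ->
    existT (fun p : ptree n * ptree n => (gen p.1 s * gen p.2 p.1 * gen t p.2)%type) (r1, r2) (a, b, c) =
    existT _ (r1', r2') (a', b', c').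
  by move=> e; exact: (congr1 (fun x : triple =>
    existT (fun p : ptree n * ptree n => (gen p.1 s * gen p.2 p.1 * gen t p.2)%type)
    (tag (tagged x), tag x) (tagged (tagged x))) e).
have inj2 (T : ptree n * ptree n -> Type) p (x y : T p) : existT T p x = existT T p y -> x = y.
  by apply: inj_pair2_eq_dec => p1 p2; apply: decP eqP.
apply: uniq_perm.
- apply: allpairs_uniq_dep; first exact: factors_uniq.
    by move=> f _; exact: factors_uniq.
  move=> x y /allpairsPdep[f1 [g1 [hf /mem_factors hg ->]]] /allpairsPdep[f2 [g2 [hf' /mem_factors hg' ->]]] /=.
  case: f1 g1 hf hg => r [v w] [r1 [a b]] /= hf hg.
  case: f2 g2 hf' hg' => r' [v' w'] [r1' [a' b']] /= hf' hg' /eq3 e.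
  have [e1 e2] : r1 = r1' /\ r = r' by have /= [-> ->] := congr1 (@projT1 _ _) e.
  subst r1' r'; have [ea eb ew] := inj2 _ _ _ _ e; subst a' b' w'.
  by have -> : v = v' by apply: gen_inj; rewrite -hg -hg'.
- apply: allpairs_uniq_dep; first exact: factors_uniq.
    by move=> f _; exact: factors_uniq.
  move=> x y /allpairsPdep[f1 [g1 [hf /mem_factors hg ->]]] /allpairsPdep[f2 [g2 [hf' /mem_factors hg' ->]]] /=.
  case: f1 g1 hf hg => r [v w] [r1 [a b]] /= hf hg.
  case: f2 g2 hf' hg' => r' [v' w'] [r1' [a' b']] /= hf' hg' /eq3 e.
  have [e1 e2] : r = r' /\ r1 = r1' by have /= [-> ->] := congr1 (@projT1 _ _) e.
  subst r1' r'; have [ea eb ew] := inj2 _ _ _ _ e; subst v' a' b'.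
  by have -> : w = w' by apply: gen_inj; rewrite -hg -hg'.
move=> [r2 [r1 [[a b] w]]].
have [v ev] : exists v : gen r2 s, gen_mor v = mcomp a b.
  by apply: gen_of; rewrite mdegM; have := gen_deg a; have := gen_deg b; lia.
have [z ez] : exists z : gen t r1, gen_mor z = mcomp b w.
  by apply: gen_of; rewrite mdegM; have := gen_deg w; have := gen_deg b; lia.
apply/idP/idP => /allpairsPdep[[r [v' w']] [[r' [a' b']] [/mem_factors /= hf /mem_factors /= hg /eq3 e]]].
  have [e1 e2] : r1 = r' /\ r2 = r by have /= [-> ->] := congr1 (@projT1 _ _) e.
  subst r' r; have [ea eb ew] := inj2 _ _ _ _ e; subst a' b' w'.
  apply/allpairsPdep; exists (existT _ r1 (a, z)), (existT _ r2 (b, w)); split=> //.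
    by apply/mem_factors; rewrite /= ez mcompA hg.
  by apply/mem_factors.
have [e1 e2] : r1 = r /\ r2 = r' by have /= [-> ->] := congr1 (@projT1 _ _) e.
subst r' r; have [ea eb ew] := inj2 _ _ _ _ e; subst v' a' b'.
apply/allpairsPdep; exists (existT _ r2 (v, w)), (existT _ r1 (a, b)); split=> //.
  by apply/mem_factors; rewrite /= ev -mcompA hg.
by apply/mem_factors.
Qed.

Lemma cobar_d_cat t r s (p : cpath r s) (q : cpath t r) : cobar_d (basis (gcat p q)) =
  cobar_comp (cobar_d (basis p)) (basis q) +
  isign k (cpath_deg p) *: cobar_comp (basis p) (cobar_d (basis q)).
Proof. by rewrite !cobar_d_basis cpath_d_cat. Qed.

Lemma cobar_derivation a b c i (x : cobar_car k b c) (y : cobar_car k a b) :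
  fhomog (@cpath_deg n b c) i x ->
  cobar_d (cobar_comp x y) = cobar_comp (cobar_d x) y + isign k i *: cobar_comp x (cobar_d y).
Proof. exact: (path_derivation cobar_d_linear cobar_d_cat). Qed.

Lemma cobar_d_d t s (p : cpath t s) : cobar_d (cpath_d k p) = 0.
Proof.
elim: p => [|b c u p IH]; first by rewrite /= (lin0 (@cobar_d_linear _ _)).
rewrite cpath_d_cons (linD (@cobar_d_linear _ _)) (linZ (@cobar_d_linear _ _)).
rewrite (cobar_derivation _ (@gen_d_homog _ _ u)) cobar_d_gen (lin0 (cobar_comp_linl _)) add0r.
have hU := @fhomog_basis k _ (@cpath_deg n b c) (gcons u (gnil b)).
rewrite (cobar_derivation _ hU) !cobar_d_basis cpath_d_gen IH (lin0 (cobar_comp_linr _)).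
by rewrite scaler0 addr0 (isignB1 k (mdeg u - 1)) scaleNr addNr.
Qed.

Lemma cobar_is_dgcat : is_dgcat (cobar k n).
Proof.
apply: (@path_dgcatP cobar_d).
- exact: cobar_d_linear.
- by move=> t s p; rewrite cobar_d_basis; apply: cpath_d_homog.
- by move=> t s p; rewrite cobar_d_basis cobar_d_d.
- exact: cobar_d_cat.
- by move=> t; rewrite cobar_d_basis.
Qed.

Definition free_gen t s : dgmod_data k :=
  @DgModData k (freemod k (gen t s)) (fhomog (fun u : gen t s => mdeg u - 1)) (fun=> 0).

Definition free_path : dgcat_data k (ptree n) := path_dgcat (fun t s _ => 0).

Definition free_incl t s : free_gen t s -> free_path t s :=
  linext (fun u : gen t s => basis (gcons u (gnil t)) : cobar_car k t s).

Lemma free_gen_dgmod t s : is_dgmod (free_gen t s).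
Proof.
apply: free_dgmod => // [|p]; first exact: lin_zero.
exact: fhomog0.
Qed.

Lemma free_path_dgcat : is_dgcat free_path.
Proof.
apply: path_dgcatP => //.
- by move=> t s; apply: lin_zero.
- by move=> t s p; apply: fhomog0.
- move=> t r s p q; rewrite (lin0 (cobar_comp_linl _)) (lin0 (cobar_comp_linr _)).
  by rewrite scaler0 addr0.
Qed.

Lemma free_incl_dgmorph t s : is_dgmorph (@free_incl t s).
Proof.
have lf : is_linear (@free_incl t s) by apply: linext_linear.
split=> //= [i x hx|x]; last exact: (lin0 lf).
apply: (fhomog_spanP (P := fun z => fhomog (@cpath_deg n t s) i (free_incl z)) hx).
- by rewrite (lin0 lf); apply: fhomog0.
- by move=> a b ha hb; rewrite (linD lf); apply: fhomogD.
move=> a u <-; rewrite (linZ lf); apply: fhomogZ; rewrite /free_incl linext_basis.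
have -> : mdeg u - 1 = cpath_deg (gcons u (gnil t)) by rewrite /= addr0.
exact: (@fhomog_basis k _ (@cpath_deg n t s)).
Qed.

Section Universal.
Variables (O' : Type) (C : dgcat_data k O') (f0 : ptree n -> O')
  (g : forall a b, free_gen a b -> C (f0 a) (f0 b)).
Hypotheses (dgC : is_dgcat C) (dgg : forall a b, is_dgmorph (@g a b)).

Fixpoint path_value t s (p : cpath t s) : C (f0 t) (f0 s) :=
  match p in gpath _ _ s return C (f0 t) (f0 s) with
  | gnil => dg_id C (f0 t)
  | gcons _ _ u p' => dg_comp (g (basis u)) (path_value p')
  end.

Definition path_ext t s : free_path t s -> C (f0 t) (f0 s) :=
  linext (fun p : cpath t s => path_value p).

Lemma path_ext_linear t s : is_linear (@path_ext t s).
Proof. exact: linext_linear. Qed.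

Lemma path_ext_basis t s (p : cpath t s) : path_ext (basis p) = path_value p.
Proof. exact: linext_basis. Qed.

Lemma path_value_homog t s (p : cpath t s) : dg_homog (cpath_deg p) (path_value p).
Proof.
elim: p => [|b c u p IH] /=; first exact: dgcat_id_homog.
apply: (dgcat_comp_homog dgC) => //; apply: (dgmorph_homog (dgg _ _)).
exact: (@fhomog_basis k _ (fun u : gen b c => mdeg u - 1)).
Qed.

Lemma g_closed t s (u : gen t s) : dg_d (g (basis u)) = 0.
Proof.
by rewrite -(dgmorph_d (dgg t s)) /= (lin0 (dgmorph_linear (dgg t s))).
Qed.

Lemma path_value_d t s (p : cpath t s) : dg_d (path_value p) = 0.
Proof.
elim: p => [|b c u p IH] /=; first exact: dgcat_id_d.
have hu : dg_homog (mdeg u - 1) (g (basis u)).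
  apply: (dgmorph_homog (dgg _ _)); exact: (@fhomog_basis k _ (fun u : gen b c => mdeg u - 1)).
rewrite (dgcat_comp_d dgC _ hu) g_closed IH.
by rewrite (lin0 (dgcat_comp_linearl dgC _)) (lin0 (dgcat_comp_linearr dgC _)) scaler0 addr0.
Qed.

Lemma path_value_cat t r s (p : cpath r s) (q : cpath t r) :
  path_value (gcat p q) = dg_comp (path_value p) (path_value q).
Proof.
elim: p q => [|b c u p IH] q /=; first by rewrite (dgcat_comp1l dgC).
by rewrite IH (dgcat_compA dgC).
Qed.

Lemma path_ext_functor : is_dgfunctor path_ext.
Proof.
split=> [a b|a|a b c x y].
- have dgm := dgcat_hom dgC (f0 a) (f0 b).
  split=> [|i x hx|x]; first exact: path_ext_linear.
    apply: (fhomog_spanP (P := fun z => dg_homog i (path_ext z)) hx).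
    + by rewrite (lin0 (@path_ext_linear _ _)); apply: homog0.
    + move=> z z' h h'; rewrite (linD (@path_ext_linear _ _)) -[path_ext z]scale1r.
      exact: homog_lin.
    + move=> e p <-; rewrite (linZ (@path_ext_linear _ _)) path_ext_basis -[_ *: _]addr0.
      apply: homog_lin => //; [exact: path_value_homog | exact: homog0].
  rewrite /= (lin0 (@path_ext_linear _ _)); apply: esym.
  apply: (linear_ext (f := fun x => dg_d (path_ext x)) (g := fun=> 0)) => [||p].
  + by apply: lin_comp; [exact: dg_d_linear | exact: path_ext_linear].
  + exact: lin_zero.
  + by rewrite path_ext_basis path_value_d.
- exact: path_ext_basis.
pose F (x : cobar_car k b c) : C (f0 a) (f0 c) := path_ext (dg_comp (x : free_path b c) y).
pose G (x : cobar_car k b c) : C (f0 a) (f0 c) := dg_comp (path_ext x) (path_ext y).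
apply: (linear_ext (f := F) (g := G)) => [||p]; rewrite /F /G.
- by apply: lin_comp; [exact: path_ext_linear | exact: cobar_comp_linl].
- apply: (lin_comp (f := fun x => dg_comp x (path_ext y))); last exact: path_ext_linear.
  exact: dgcat_comp_linearl.
pose F' (y : cobar_car k a b) : C (f0 a) (f0 c) := path_ext (dg_comp (basis p : free_path b c) y).
pose G' (y : cobar_car k a b) : C (f0 a) (f0 c) := dg_comp (path_ext (basis p)) (path_ext y).
apply: (linear_ext (f := F') (g := G')) => [||q]; rewrite /F' /G'.
- by apply: lin_comp; [exact: path_ext_linear | exact: cobar_comp_linr].
- apply: (lin_comp (f := fun y => dg_comp (path_ext (basis p)) y)); last exact: path_ext_linear.
  exact: dgcat_comp_linearr.
by rewrite /= [cobar_comp _ _]cobar_comp_basis !path_ext_basis path_value_cat.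
Qed.

Lemma path_ext_incl t s (x : free_gen t s) : path_ext (free_incl x) = g x.
Proof.
apply: (linear_ext (f := fun x => path_ext (free_incl x)) (g := @g t s)) => [||u].
- by apply: lin_comp; [exact: path_ext_linear | exact: linext_linear].
- exact: (dgmorph_linear (dgg t s)).
by rewrite /free_incl linext_basis path_ext_basis /= (dgcat_comp1r dgC).
Qed.

Lemma path_ext_uniq (f' : forall a b, free_path a b -> C (f0 a) (f0 b)) :
  is_dgfunctor f' -> (forall a b x, f' a b (free_incl x) = g x) ->
  forall a b x, f' a b x = path_ext x.
Proof.
move=> ff' h a b x; apply: (linear_ext (f := f' a b) (g := @path_ext a b)) => [||p]; [| exact: path_ext_linear |].
  exact: (dgmorph_linear (dgfunctor_hom ff' a b)).
rewrite path_ext_basis; elim: p => [|b' c u p IH] /=; first exact: (dgfunctor_id ff').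
rewrite gcons_basis [LHS](dgfunctor_comp ff') IH; congr dg_comp.
by rewrite -h /free_incl linext_basis.
Qed.

End Universal.

Lemma free_path_free : is_free_dgcat free_incl.
Proof.
split; [exact: free_path_dgcat | exact: free_incl_dgmorph |].
move=> O' C f0 g dgC dgg; exists (path_ext g); split.
- exact: path_ext_functor.
- by move=> a b x; apply: path_ext_incl.
- by move=> f' ff' h a b x; apply: path_ext_uniq.
Qed.

Lemma cobar_quasi_free : quasi_free (cobar k n).
Proof.
exists free_gen, free_path, free_incl, cobar_d, (fun a b x => x); split.
- exact: free_gen_dgmod.
- exact: free_path_free.
- split=> [a b|a b i x hx|a b c i x y hx]; first exact: cobar_d_linear.
    exact: (dg_d_homog (dgcat_hom cobar_is_dgcat a b)).
  exact: cobar_derivation.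
- split=> // a b; split=> // x /=; exact: add0r.
- by move=> a b; exists id.
Qed.

End PathDgCat.

Section Augmentation.
Variables (k : comPzRingType) (n : nat).
Implicit Types t r s : ptree n.

Lemma omega_comp_linl t r s (y : omega_hom k t r) :
  is_linear (fun x : omega_hom k r s => omega_comp x y).
Proof. exact: linext_linear. Qed.

Lemma omega_comp_linr t r s (x : omega_hom k r s) :
  is_linear (fun y : omega_hom k t r => omega_comp x y).
Proof. exact: (bilext_linr (@mcomp n t r s)). Qed.

Lemma omega_comp_basis t r s (p : mor r s) (q : mor t r) :
  omega_comp (basis p : omega_hom k r s) (basis q) = basis (mcomp p q).
Proof. exact: (bilext_basis k (@mcomp n t r s)). Qed.

Lemma omega_compA t q r s (x : omega_hom k q s) (y : omega_hom k r q) (z : omega_hom k t r) :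
  omega_comp x (omega_comp y z) = omega_comp (omega_comp x y) z.
Proof. apply: bilext_assoc; exact: mcompA. Qed.

Lemma omega_comp1l t s (x : omega_hom k t s) : omega_comp (basis (mid s)) x = x.
Proof.
move: x; apply: linear_ext => [||p]; [exact: omega_comp_linr | exact: lin_id |].
by rewrite omega_comp_basis mcomp1l.
Qed.

Lemma omega_comp1r t s (x : omega_hom k t s) : omega_comp x (basis (mid t)) = x.
Proof.
move: x; apply: linear_ext => [||p]; [exact: omega_comp_linl | exact: lin_id |].
by rewrite omega_comp_basis mcomp1r.
Qed.

Lemma omega_hom_dgmod t s : is_dgmod (omega_hom k t s).
Proof.
split=> //=.
- by move=> i a x y hx hy ni; rewrite hx // hy // scaler0 addr0.
- move=> x; exists [:: 0], (fun i => if i == 0 then x else 0); split.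
    by move=> i; case: eqP.
  by rewrite big_seq1 eqxx.
- move=> sq c us hc e i si; case: (eqVneq i 0) => [i0|/eqP]; last exact: hc.
  move: e; rewrite (bigD1_seq i) //= big1 ?addr0 // => j ji; apply: hc => j0.
  by rewrite i0 j0 eqxx in ji.
- exact: lin_zero.
Qed.

Lemma omega_is_dgcat : is_dgcat (omega k n).
Proof.
split=> //=.
- exact: omega_hom_dgmod.
- by move=> a b c y; apply: omega_comp_linl.
- by move=> a b c x; apply: omega_comp_linr.
- move=> a b c i j x y hx hy nij; case: (eqVneq i 0) => [i0|/eqP ni].
    rewrite (hy _); first exact: (lin0 (omega_comp_linr _)).
    by move=> j0; apply: nij; rewrite i0 j0.
  by rewrite (hx ni); exact: (lin0 (omega_comp_linl _)).
- move=> a b c i x y _.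
  by rewrite (lin0 (omega_comp_linl _)) (lin0 (omega_comp_linr _)) scaler0 addr0.
- by move=> *; apply: omega_compA.
- by move=> *; apply: omega_comp1l.
- by move=> *; apply: omega_comp1r.
Qed.

Lemma up_mid t s (u : mor t s) : ~ up t (mid t) u.
Proof.
move=> [i [x [[lti xi _ _] [y [xy yi]]]]] /=.
rewrite !ev_mid ?(ltnW lti) //; lia.
Qed.

Lemma two_factors t s (u : mor t s) : mdeg u = 2 ->
  exists f g : factor t s, [/\ f \in factors u, g \in factors u & f <> g].
Proof.
move=> du; have nid : ~~ is_id u by rewrite -mdeg0 du.
have cou : coarser t (mid t) u by rewrite -[u]mcomp1r; apply: coarser_comp.
have [j [x fn]] := first_noncrit_ex (mid t) nid.
have [r [W [[_ cWu _] fnW _ _ [m [mg mE]]]]] := partner_ex cou (@up_mid t s u) fn.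
have [v vE] := coarser_factor cWu.
have [r' [m' [a [aE dm nup]]]] := canonical_ex nid.
have dW : mdeg W = 1 by rewrite -mE mdegM (merge_mdeg1 mg) (eqP (_ : mdeg (mid t) == 0)) // mdeg0 mid_is_id.
have dv : mdeg v = 1 by have := mdegM v W; rewrite vE du dW; lia.
have da : mdeg a = 1 by have := mdegM m' a; rewrite aE du dm; lia.
have [gv ev] := gen_of (u := v) ltac:(by rewrite dv).
have [gW eW] := gen_of (u := W) ltac:(by rewrite dW).
have [gm em] := gen_of (u := m') ltac:(by rewrite dm).
have [ga ea] := gen_of (u := a) ltac:(by rewrite da).
exists (existT _ r (gv, gW)), (existT _ r' (gm, ga)); split.
- by apply/mem_factors; rewrite /= ev eW.
- by apply/mem_factors; rewrite /= em ea.
move=> e; apply: nup; rewrite -ea.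
have <- : gen_mor gW = ga :> seq (seq nat).
  exact: (congr1 (fun f : factor t s => mor_val (gen_mor (tagged f).2)) e).
by rewrite eW; exists j, x.
Qed.

Definition factor_sgn t s (f : factor t s) : bool :=
  sgn_odd (tagged f).2 (+) sgn_odd (tagged f).1.

Lemma factor_deg1 t s (u : mor t s) f : mdeg u = 2 -> f \in factors u ->
  mdeg (tagged f).1 = 1 /\ mdeg (tagged f).2 = 1.
Proof.
move=> du /factor_deg; rewrite du.
have := gen_deg (tagged f).1; have := gen_deg (tagged f).2.
move: (mdeg _) (mdeg _) => a b; lia.
Qed.

Lemma factor_sgn_neq t s (u : mor t s) f g : mdeg u = 2 ->
  f \in factors u -> g \in factors u -> f <> g -> factor_sgn f = ~~ factor_sgn g.
Proof.
move=> du hf hg ne; have [f1 f2] := factor_deg1 du hf; have [g1 g2] := factor_deg1 du hg.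
have ef := proj1 (mem_factors _ _) hf; have eg := proj1 (mem_factors _ _) hg.
apply: diamond_sign => //; first by rewrite ef eg.
by move=> e; apply: ne; apply: factor_eq; rewrite ?ef ?eg.
Qed.

Lemma factors2 t s (u : mor t s) : mdeg u = 2 -> exists f g : factor t s,
  perm_eq (factors u) [:: f; g] /\ factor_sgn f = ~~ factor_sgn g.
Proof.
move=> du; have [f [g [hf hg ne]]] := two_factors du; exists f, g.
have sg := factor_sgn_neq du hf hg ne; split=> //.
apply: uniq_perm; first exact: factors_uniq.
  by rewrite /= inE andbT; apply/eqP.
move=> h; rewrite !inE; apply/idP/orP => [hh|[]/eqP-> //].
case: (eqVneq h f) => [_|/eqP nf]; first by left.
case: (eqVneq h g) => [_|/eqP ng]; first by right.
have := factor_sgn_neq du hh hf nf; rewrite (factor_sgn_neq du hh hg ng) sg.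
by case: (factor_sgn g).
Qed.

Lemma aug_linear t s : is_linear (@augmentation k n t s).
Proof. exact: linext_linear. Qed.

Lemma aug_basis t s (p : cpath t s) : augmentation (basis p : cobar k n t s) = cpath_aug k p.
Proof. exact: linext_basis. Qed.

Lemma aug_cat t r s (p : cpath r s) (q : cpath t r) :
  cpath_aug k (gcat p q) = omega_comp (cpath_aug k p) (cpath_aug k q).
Proof.
elim: p q => [|b c u p IH] q /=; first by rewrite omega_comp1l.
by rewrite IH omega_compA.
Qed.

Lemma aug_comp t r s (x : cobar k n r s) (y : cobar k n t r) :
  augmentation (cobar_comp x y : cobar k n t s) = omega_comp (augmentation x) (augmentation y).
Proof.
pose F (x : cobar_car k r s) : omega_hom k t s := augmentation (cobar_comp x y : cobar k n t s).
pose G (x : cobar_car k r s) : omega_hom k t s :=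
  omega_comp (augmentation (x : cobar k n r s)) (augmentation y).
apply: (linear_ext (f := F) (g := G)) => [||p]; rewrite /F /G.
- by apply: (lin_comp (f := @augmentation k n t s)); [exact: aug_linear | exact: cobar_comp_linl].
- apply: (lin_comp (f := fun x => omega_comp x (augmentation y))); first exact: omega_comp_linl.
  exact: aug_linear.
pose F' (y : cobar_car k t r) : omega_hom k t s := augmentation (cobar_comp (basis p) y : cobar k n t s).
pose G' (y : cobar_car k t r) : omega_hom k t s :=
  omega_comp (augmentation (basis p : cobar k n r s)) (augmentation (y : cobar k n t r)).
apply: (linear_ext (f := F') (g := G')) => [||q]; rewrite /F' /G'.
- by apply: (lin_comp (f := @augmentation k n t s)); [exact: aug_linear | exact: cobar_comp_linr].
- apply: (lin_comp (f := fun y => omega_comp (augmentation (basis p : cobar k n r s)) y)).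
    exact: omega_comp_linr.
  exact: aug_linear.
by rewrite cobar_comp_basis !aug_basis aug_cat.
Qed.

Lemma cpath_aug_deg t s (p : cpath t s) : cpath_deg p <> 0 -> cpath_aug k p = 0.
Proof.
elim: p => [|b c u p IH] //= ne.
rewrite /gen_aug; case: eqP => e; last exact: (lin0 (omega_comp_linl _)).
rewrite IH; first exact: (lin0 (omega_comp_linr _)).
by move=> e'; apply: ne; rewrite e e'.
Qed.

Lemma aug_gen_d t s (u : gen t s) : augmentation (gen_d k u : cobar k n t s) = 0.
Proof.
rewrite gen_d_sum (lin_sum (@aug_linear _ _)).
have termE (f : factor t s) : augmentation (isign k (mdeg (tagged f).1) *:
     basis (gcons (tagged f).1 (gcons (tagged f).2 (gnil t))) : cobar k n t s) =
   isign k (mdeg (tagged f).1) *: omega_comp (gen_aug k (tagged f).1) (gen_aug k (tagged f).2).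
  by rewrite (linZ (@aug_linear _ _)) aug_basis /= omega_comp1r.
under eq_bigr => f _ do rewrite termE.
case: (eqVneq (mdeg u) 2) => [du|nu]; last first.
  rewrite big1_seq // => f /andP[_ /factor_deg e]; rewrite /gen_aug.
  case: eqP => e1; last by rewrite (lin0 (omega_comp_linl _)) scaler0.
  case: eqP => e2; last by rewrite (lin0 (omega_comp_linr _)) scaler0.
  by rewrite e e1 e2 in nu.
have [f [g [pe sg]]] := factors2 du.
have hf : f \in factors u by rewrite (perm_mem pe) inE eqxx.
have hg : g \in factors u by rewrite (perm_mem pe) !inE eqxx orbT.
have valE h : h \in factors u -> isign k (mdeg (tagged h).1) *:
    omega_comp (gen_aug k (tagged h).1) (gen_aug k (tagged h).2) =
    - ((-1) ^+ factor_sgn h *: (basis (gen_mor u) : omega_hom k t s)).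
  move=> hh; have [d1 d2] := factor_deg1 du hh; rewrite /gen_aug d1 d2 eqxx isign1 scaleN1r.
  rewrite (linZ (omega_comp_linl _)) (linZ (omega_comp_linr _)) scalerA omega_comp_basis.
  by rewrite (proj1 (mem_factors _ _) hh) /factor_sgn addbC signr_addb.
rewrite (perm_big _ pe) big_cons big_seq1 !valE // sg signrN.
by rewrite scaleNr opprK; exact: addrN.
Qed.

Lemma aug_dgfunctor : is_dgfunctor (f0 := id) (@augmentation k n).
Proof.
split=> [t s|t|t r s x y]; [|exact: aug_basis | exact: aug_comp].
split=> [|i x hx ni|x]; first exact: aug_linear.
  have -> : augmentation x = (fun=> 0) x; last by [].
  apply: (linear_eq (f := @augmentation k n t s) (g := fun=> 0)) => [||p px].
  - exact: aug_linear.
  - exact: lin_zero.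
  by rewrite aug_basis cpath_aug_deg // (hx p px).
apply: (linear_ext (f := fun x : cobar k n t s => augmentation (cobar_d x : cobar k n t s)) (g := fun=> 0)) => [||p].
- by apply: (lin_comp (f := @augmentation k n t s)); [exact: aug_linear | exact: cobar_d_linear].
- exact: lin_zero.
rewrite cobar_d_basis; elim: p => [|b c u p IH].
  exact: (lin0 (@aug_linear _ _)).
rewrite cpath_d_cons (linD (@aug_linear _ _)) (linZ (@aug_linear _ _)) !aug_comp aug_gen_d IH.
by rewrite (lin0 (omega_comp_linl _)) (lin0 (omega_comp_linr _)) scaler0 addr0.
Qed.

End Augmentation.

(** * The matching on the paths of the cobar construction *)

Section Partner.
Variable n : nat.
Implicit Types t r s : ptree n.

Lemma up_lower t r s s' (a : mor t r) (W : mor t s) (u : mor t s') :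
  coarser t a W -> coarser t W u -> up t a u -> up t a W.
Proof.
move=> cW cu [i [x [[lti xi nc mn] na]]]; exists i, x; split=> //; split=> //.
  exact: nonalone_noncrit na.
move=> j z ltj zj lx y zy yj ey py.
by apply: (mn j z ltj zj lx) => //; apply: (coarser_eq cu).
Qed.

Lemma phi_lt_partner t r s r1 r2 (w : mor t r) (u : mor t s) (m : mor r r1) (W : mor t r1)
    (W' : mor t r2) :
  mcomp m w = W -> mdeg m = 1 -> ~ up t w W -> coarser t W u -> up t W u ->
  coarser t w W' -> coarser t W' u ->
  (exists2 m' : mor r r2, mdeg m' = 1 & mcomp m' w = W') \/ up t w W' ->
  mor_val W' <> mor_val W -> (phi t W' u < phi t W u)%N.
Proof.
move=> mE dm nup cWu upW cwW' cW'u.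
have cwW : coarser t w W by rewrite -mE; apply: coarser_comp.
have cwu : coarser t w u.
  move=> i x y lti xi yi e le; apply: cWu => //; last exact: cwW.
  by apply: (coarser_pareq cwW) => //; apply: ptree_lt.
have nupu : ~ up t w u by move/(up_lower cwW cWu).
have [j [x [fnW above wj]]] := canonical_shape mE dm nup.
have [ltj xj ncW mnW] := fnW.
have naW : nonalone t W j x by apply: contrapT => na; apply/ncW/critWW.
have fnu : first_noncrit t W u j x.
  have [j' [x' [fn' na']]] := upW; have [ltj' xj' _ mn'] := fn'.
  have h1 : ~~ lexlt j' x' j x.
    by apply/negP => lx; have := mnW _ _ ltj' xj' lx => /critWW; apply.
  have h2 : ~~ lexlt j x j' x'.
    by apply/negP => lx; have := mn' _ _ ltj xj lx; apply: nonalone_noncrit.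
  by have [-> ->] : j = j' /\ x = x' by move: h1 h2; rewrite /lexlt; lia.
have ncu : ~ crit t w u j x.
  have [y [xy yj ey]] := naW => cr.
  have py : ev w j.+1 (ev t j y) = ev w j.+1 (ev t j x).
    have := mor_pareq ltj yj xj ey; rewrite !above ?ptree_lt //; lia.
  have := cr y xy yj (coarser_eq cWu ltj yj xj ey) py; rewrite !wj // ey; lia.
have fnw : first_noncrit t w u j x.
  have [j2 [x2 fn2]] := first_noncritP (ex_intro _ j (ex_intro _ x (And3 ltj xj ncu))).
  have [ltj2 xj2 nc2 mn2] := fn2.
  case: (boolP (lexlt j x j2 x2)) => [/(mn2 _ _ ltj xj)//|h1].
  case: (boolP (lexlt j2 x2 j x)) => h2; last first.
    by have [-> ->] : j = j2 /\ x = x2 by move: h1 h2; rewrite /lexlt; lia.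
  exfalso; apply: nc2 => y xy yj uy py; rewrite ltnNge; apply/negP => le.
  have [_ _ _ mnu] := fnu.
  have := cwW j2 x2 y ltj2 xj2 yj (esym py) le.
  rewrite leqNgt => /negP; apply; apply: (mnu j2 x2) => //.
  by apply: (coarser_pareq cwW) => //; apply: ptree_lt.
apply: (phi_lt cwW' cW'u cwu nupu fnw); split=> //.
  by move=> i z hi zi; rewrite above.
move=> z zj; rewrite !wj // eqxx andbF addn0.
case: (eqVneq z x) => [->|_]; lia.
Qed.

End Partner.

Local Opaque mcomp.

Section Kinds.
Variable n : nat.
Implicit Types t r s : ptree n.

Inductive kind := Crit | Low | Up.

Fixpoint kind_of t s (p : cpath t s) : kind :=
  match p with
  | gnil => Crit
  | gcons _ _ u p' =>
      if kind_of p' is Crit then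
        if `[< up t (pcomp p') (mcomp u (pcomp p')) >] then Up
        else if mdeg u == 1 then Crit else Low
      else kind_of p'
  end.

Fixpoint plen t s (p : cpath t s) : nat := if p is gcons _ _ _ p' then (plen p').+1 else 0%N.

Fixpoint prank t s (p : cpath t s) : nat :=
  if p is gcons _ _ u p' then
    (phi t (pcomp p') (mcomp u (pcomp p')) * phi_bound t ^ plen p' + prank p')%N
  else 0%N.

Lemma prank_lt t s (p : cpath t s) : (prank p < phi_bound t ^ plen p)%N.
Proof.
elim: p => [|b c u p IH] //=; rewrite expnS.
have := phi_lt_bound t (pcomp p) (mcomp u (pcomp p)).
set f := phi _ _ _; set B := phi_bound t in IH *; set E := (B ^ plen p)%N in IH *.
move=> fB; have : (f.+1 * E <= B * E)%N by rewrite leq_mul2r fB orbT.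
rewrite mulSn; move: IH; clear; lia.
Qed.

Lemma prank_top t r r' s (v : gen r s) (p : cpath t r) (v' : gen r' s) (p' : cpath t r') :
  plen p = plen p' ->
  (phi t (pcomp p) (mcomp v (pcomp p)) < phi t (pcomp p') (mcomp v' (pcomp p')))%N ->
  (prank (gcons v p) < prank (gcons v' p'))%N.
Proof.
move=> e lt /=; rewrite e.
have := prank_lt p; rewrite e.
set f := phi _ _ _ in lt *; set f' := phi _ _ _ in lt *; set E := (_ ^ _)%N.
have : (f.+1 * E <= f' * E)%N by rewrite leq_mul2r lt orbT.
rewrite mulSn; clear; lia.
Qed.

Inductive matched t : forall s, cpath t s -> cpath t s -> Prop :=
| matched_here r r' s (v : gen r s) (p : cpath t r) (v' : gen r' s) (m : gen r r') :
    kind_of p = Crit -> mcomp v' m = v -> mdeg m = 1 ->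
    ~ up t (pcomp p) (mcomp m (pcomp p)) ->
    up t (mcomp m (pcomp p)) (mcomp v (pcomp p)) ->
    matched (gcons v p) (gcons v' (gcons m p))
| matched_cons r s (v : gen r s) (p q : cpath t r) :
    matched p q -> matched (gcons v p) (gcons v q).

Lemma gen_comp_deg t r s (v : gen r s) (w : gen t r) : 2 <= mdeg (mcomp v w).
Proof. rewrite mdegM; have := gen_deg v; have := gen_deg w; move: (mdeg _) (mdeg _) => a b; lia. Qed.

Lemma matched_kind t s (a b : cpath t s) : matched a b ->
  [/\ kind_of a = Low, kind_of b = Up, pcomp b = pcomp a, plen b = (plen a).+1 &
      cpath_deg a = cpath_deg b + 1].
Proof.
elim=> [r r' s' v p v' m kp vE dm nup upm|r s' v p q _ [ka kb ce le de]] /=; last first.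
  by rewrite ka kb ce le de addrA.
have dv : mdeg v = mdeg v' + 1 by rewrite -vE mdegM dm.
have cwm : coarser t (pcomp p) (mcomp m (pcomp p)) by apply: coarser_comp.
have cmu : coarser t (mcomp m (pcomp p)) (mcomp v (pcomp p)).
  by rewrite -vE -mcompA; apply: coarser_comp.
rewrite kp asboolF; last by move/(up_lower cwm cmu).
rewrite asboolF // dm eqxx mcompA vE asboolT //; split=> //.
  case: eqP => // e; exfalso; have h := gen_comp_deg v' m.
  by rewrite vE e in h.
by rewrite dv; move: (mdeg _) (cpath_deg p) => x y; lia.
Qed.

Lemma low_matched t s (a : cpath t s) : kind_of a = Low -> exists b, matched a b.
Proof.
elim: a => [|r s' v p IH] //=.
case kp: (kind_of p) => //; last by case: (IH kp) => b mb; exists (gcons v b); apply: matched_cons.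
case: asboolP => // nup; case: eqP => // dv _.
have dv2 : 2 <= mdeg v by have := gen_deg v; move: dv; move: (mdeg _) => x; lia.
have cou : coarser t (pcomp p) (mcomp v (pcomp p)) by apply: coarser_comp.
have nid : ~~ is_id (mcomp v (pcomp p)).
  rewrite -mdeg0 mdegM; have := mdeg_ge0 (pcomp p); move: dv2.
  by move: (mdeg (gen_mor v)) (mdeg (pcomp p)) => x y ? ?; apply/eqP; lia.
have [j [x fn]] := first_noncrit_ex (pcomp p) nid.
have [r' [W [[cwW cWu nupW] fnW _ _ [m [mg mE]]]]] := partner_ex cou nup fn.
have dm := merge_mdeg1 mg.
have [v' v'E] := coarser_factor cWu.
have vE : mcomp v' m = v by apply: (@mcomp_epi _ _ _ _ _ _ (pcomp p)); rewrite -mcompA mE.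
have dv' : 1 <= mdeg v'.
  by have := mdegM v' m; rewrite vE dm; move: dv2; move: (mdeg _) (mdeg _) => y z; lia.
have [gm em] := gen_of (u := m) ltac:(by rewrite dm).
have [gv ev] := gen_of dv'.
exists (gcons gv (gcons gm p)); apply: matched_here => //; rewrite ?em ?ev // mE //.
by exists j, x.
Qed.

Lemma up_matched t s (b : cpath t s) : kind_of b = Up -> exists a, matched a b.
Proof.
elim: b => [|r s' v p IH] //=.
case kp: (kind_of p) => //; last by case: (IH kp) => a ma; exists (gcons v a); apply: matched_cons.
case: asboolP => [upv _|_]; last by case: ifP.
case: p v kp upv {IH} => [|r0 r1 m p] v /=.
  by move=> _ /up_mid.
case kp: (kind_of p) => //; case: asboolP => // nup; case: eqP => // dm _ upv.
have dvm : 1 <= mdeg (mcomp v m) by apply: le_trans (gen_comp_deg v m).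
have [v0 ev0] := gen_of dvm.
exists (gcons v0 p); apply: matched_here => //.
by rewrite ev0 -mcompA.
Qed.

Lemma matched_inv t s (a b : cpath t s) : matched a b ->
  forall r (v : gen r s) (q : cpath t r), b = gcons v q ->
  (kind_of q = Up /\ exists2 p, a = gcons v p & matched p q) \/
  (kind_of q = Crit /\ exists r' (m : gen r' r) (p : cpath t r') (v0 : gen r' s),
     [/\ q = gcons m p, a = gcons v0 p & mcomp v m = v0]).
Proof.
case=> [r r' s' v p v' m kp vE dm nup upm|r s' v p q mpq] r0 v0 q0 e.
  right; have er : r' = r0 := congr1 (@projT1 _ _) (gcons_inj e).
  subst r0; have [ev eq] := gcons_inj2 e; subst v0 q0; split.
    by rewrite /= kp asboolF // dm eqxx.
  by exists r, m, p, v.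
left; have er : r = r0 := congr1 (@projT1 _ _) (gcons_inj e).
subst r0; have [ev eq] := gcons_inj2 e; subst v0 q0; split.
  by have [] := matched_kind mpq.
by exists p.
Qed.

Lemma matched_uniq t s (b a a' : cpath t s) : matched a b -> matched a' b -> a = a'.
Proof.
elim: b a a' => [|r s' v q IH] a a' ma ma'; first by have [_] := matched_kind ma.
case: (matched_inv ma erefl) => [[kq [p -> mp]]|[kq [r1 [m [p [v0 [eq -> ev]]]]]]];
case: (matched_inv ma' erefl) => [[kq' [p' -> mp']]|[kq' [r1' [m' [p' [v0' [eq' -> ev']]]]]]].
- by rewrite (IH _ _ mp mp').
- by rewrite kq in kq'.
- by rewrite kq in kq'.
rewrite eq in eq'; have er : r1 = r1' := congr1 (@projT1 _ _) (gcons_inj eq').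
subst r1'; have [em ep] := gcons_inj2 eq'; subst m' p'.
by congr gcons; apply: gen_inj; rewrite -ev -ev'.
Qed.

Lemma kind_deg t s (p : cpath t s) :
  (kind_of p = Crit -> cpath_deg p = 0) /\ (kind_of p = Low -> 1 <= cpath_deg p).
Proof.
elim: p => [|r s' v p [IH1 IH2]] //=; have dv := gen_deg v; have dp := cpath_deg_ge0 p.
split.
  case kp: (kind_of p) => //; case: asboolP => // _; case: eqP => // e _.
  by rewrite e (IH1 kp).
case kp: (kind_of p) => //; last first.
  by move=> _; have := IH2 kp; move: dv; move: (mdeg _) (cpath_deg p) => x y; lia.
case: asboolP => // _; case: eqP => // e _; rewrite (IH1 kp).
by move: dv e; move: (mdeg _) => x; lia.
Qed.

Lemma path_nil t s (q : cpath t s) : mdeg (pcomp q) = 0 ->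
  existT (cpath t) s q = existT (cpath t) t (gnil t).
Proof.
case: q => //= b c u p; rewrite mdegM; have := gen_deg u; have := mdeg_ge0 (pcomp p).
move: (mdeg _) (mdeg _) => x y; lia.
Qed.

Lemma path_cons t s (q : cpath t s) : mdeg (pcomp q) <> 0 ->
  exists r (v : gen r s) (q' : cpath t r), q = gcons v q'.
Proof.
case: q => /= [|b c u p _]; first by case; apply/eqP; rewrite mdeg0 mid_is_id.
by exists b, u, p.
Qed.

Lemma crit_cons t r s (v : gen r s) (p : cpath t r) : kind_of (gcons v p) = Crit ->
  [/\ kind_of p = Crit, mdeg v = 1 & ~ up t (pcomp p) (mcomp v (pcomp p))].
Proof. by rewrite /=; case: (kind_of p) => //; case: asboolP => // ? ; case: eqP. Qed.

Lemma crit_uniq t s (p q : cpath t s) : kind_of p = Crit -> kind_of q = Crit ->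
  pcomp p = pcomp q -> p = q.
Proof.
elim: p q => [|r s' v p IH] q kp kq e.
  have := @path_nil _ _ q; rewrite -e /= => h.
  have d0 : mdeg (mid t) = 0 by apply/eqP; rewrite mdeg0 mid_is_id.
  by apply: esym; apply: (@ptree_pair_inj n (cpath t)); apply: h.
have [r' [v' [q' eq]]] : exists r (v : gen r s') (q' : cpath t r), q = gcons v q'.
  apply: path_cons; rewrite -e /= mdegM; have := gen_deg v; have := mdeg_ge0 (pcomp p).
  by move: (mdeg _) (mdeg _) => x y ? ? ?; lia.
subst q; have [kp0 dv nup] := crit_cons kp; have [kq0 dv' nup'] := crit_cons kq.
rewrite /= in e.
have nup2 : ~ up t (pcomp q') (mcomp v (pcomp p)) by rewrite e.
have ea := canonical_uniq erefl dv nup (esym e) dv' nup2.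
have er := mor_tgt ea; subst r'.
have epq : pcomp p = pcomp q' by apply: val_inj.
have epq' := IH q' kp0 kq0 epq; subst q'.
by congr gcons; apply: gen_inj; apply: mcomp_epi e.
Qed.

Lemma crit_ex t s (u : mor t s) : exists2 p : cpath t s, kind_of p = Crit & pcomp p = u.
Proof.
have [N eN] : exists N : nat, mdeg u = N%:Z.
  by have := mdeg_ge0 u; case: (mdeg u) => // N _; exists N.
elim: N s u eN => [|N IH] s u eN.
  have : is_id u by rewrite -mdeg0 eN.
  case/andP=> /eqP ets /eqP eu; subst s; exists (gnil t) => //=; apply: val_inj => /=.
  by rewrite eu.
have nid : ~~ is_id u by rewrite -mdeg0 eN.
have [r [m [a [aE dm nup]]]] := canonical_ex nid.
have [p kp pE] := IH r a ltac:(by have := mdegM m a; rewrite aE eN dm; lia).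
have [gm em] := gen_of (u := m) ltac:(by rewrite dm).
exists (gcons gm p); last by rewrite /= em pE.
by rewrite /= kp em pE aE asboolF // dm eqxx.
Qed.

End Kinds.

Section Homology.
Variables (k : comPzRingType) (n : nat).
Implicit Types t r s : ptree n.

Lemma gcons_mul t r s (v : gen r s) (x : cobar_car k t r) :
  cobar_comp (basis (gcons v (gnil r))) x =
  \sum_(q <- msupp x) x@_q *: (basis (gcons v q) : cobar_car k t s).
Proof.
rewrite {1}[x]basis_sum (lin_sum (cobar_comp_linr _)); apply: eq_bigr => q _.
by rewrite (linZ (cobar_comp_linr _)) cobar_comp_basis.
Qed.

Lemma gcons_mul_coef t r s (v : gen r s) (x : cobar_car k t r) q :
  (cobar_comp (basis (gcons v (gnil r))) x)@_(gcons v q) = x@_q.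
Proof.
rewrite gcons_mul fcoef_sum.
under eq_bigr => p _ do rewrite fcoefZ fcoef_basis.
case: (boolP (q \in msupp x)) => qx.
  rewrite (bigD1_seq q) ?fset_uniq //= eqxx mulr1 big1 ?addr0 // => p pq.
  case: eqP => [/gcons_inj2[_ e]|_]; last exact: mulr0.
  by rewrite e eqxx in pq.
rewrite big1_seq ?mcoeff_outdom // => p /= pin.
case: eqP => [/gcons_inj2[_ e]|_]; last exact: mulr0.
by rewrite -e pin in qx.
Qed.

Lemma gcons_mul_supp t r s (v : gen r s) (x : cobar_car k t r) b :
  (cobar_comp (basis (gcons v (gnil r))) x)@_b != 0 ->
  exists2 q, x@_q != 0 & b = gcons v q.
Proof.
rewrite gcons_mul fcoef_sum => nz; apply: contrapT => nex; move/eqP: nz; apply.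
rewrite big1_seq // => q /= qx; rewrite fcoefZ fcoef_basis.
case: eqP => [e|_]; last exact: mulr0.
by exfalso; apply: nex; exists q; rewrite ?mcoeff_neq0.
Qed.

Lemma gen_mul t r s (v : gen r s) (p : cpath t r) :
  cobar_comp (gen_d k v) (basis p) = \sum_(f <- factors v)
    isign k (mdeg (tagged f).1) *:
      (basis (gcons (tagged f).1 (gcons (tagged f).2 p)) : cobar_car k t s).
Proof.
rewrite gen_d_sum (lin_sum (cobar_comp_linl _)); apply: eq_bigr => f _.
by rewrite (linZ (cobar_comp_linl _)) cobar_comp_basis.
Qed.

Lemma gen_mul_supp t r s (v : gen r s) (p : cpath t r) b :
  (cobar_comp (gen_d k v) (basis p))@_b != 0 ->
  exists2 f : factor r s, f \in factors v &
    b = gcons (tagged f).1 (gcons (tagged f).2 p).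
Proof.
rewrite gen_mul fcoef_sum => nz; apply: contrapT => nex; move/eqP: nz; apply.
rewrite big1_seq // => f /= fv; rewrite fcoefZ fcoef_basis.
case: eqP => [e|_]; last exact: mulr0.
by exfalso; apply: nex; exists f.
Qed.

Lemma gen_mul_coef t r s (v : gen r s) (p : cpath t r) (f : factor r s) : f \in factors v ->
  (cobar_comp (gen_d k v) (basis p))@_(gcons (tagged f).1 (gcons (tagged f).2 p)) =
  isign k (mdeg (tagged f).1).
Proof.
move=> fv; rewrite gen_mul fcoef_sum (bigD1_seq f) ?factors_uniq //=.
rewrite fcoefZ fcoef_basis eqxx mulr1 big1 ?addr0 // => g gf.
rewrite fcoefZ fcoef_basis; case: eqP => [e|_]; last exact: mulr0.
move/eqP: gf; case; case: f g e {fv} => r1 [a b] [r2 [c d]] /= e.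
have er : r2 = r1 := congr1 (@projT1 _ _) (gcons_inj e).
subst r2; have [-> e'] := gcons_inj2 e.
by have [-> _] := gcons_inj2 e'.
Qed.

Lemma cpath_d_supp t s (a b : cpath t s) : (cpath_d k a)@_b != 0 ->
  pcomp b = pcomp a /\ plen b = (plen a).+1.
Proof.
elim: a b => [|r s' v p IH] b; first by rewrite fcoef0 eqxx.
rewrite cpath_d_cons fcoefD fcoefZ => nz.
have [z1|nz1] := eqVneq ((cobar_comp (gen_d k v) (basis p))@_b) 0; last first.
  have [f /mem_factors fv ->] := gen_mul_supp nz1.
  by rewrite /= mcompA fv.
move: nz; rewrite z1 add0r => nz.
have [q nq ->] := gcons_mul_supp (v := v) (x := cpath_d k p) (b := b)
  ltac:(by apply: contraNneq nz => ->; rewrite mulr0).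
by have [e1 e2] := IH q nq; rewrite /= e1 e2.
Qed.

Lemma crit_d t s (p : cpath t s) : kind_of p = Crit -> cpath_d k p = 0.
Proof.
elim: p => [|r s' v p IH] // /crit_cons[kp dv _].
rewrite cpath_d_cons IH // (lin0 (cobar_comp_linr _)) scaler0 addr0 gen_mul.
rewrite big1_seq // => f /= /factor_deg; rewrite dv.
have := gen_deg (tagged f).1; have := gen_deg (tagged f).2.
move: (mdeg (gen_mor _)) (mdeg (gen_mor _)) => x y ? ? ?; lia.
Qed.

Lemma matched_d t s (a b : cpath t s) : matched a b ->
  (exists i, (cpath_d k a)@_b = isign k i) /\
  forall b', (cpath_d k a)@_b' != 0 -> kind_of b' <> Low -> b' <> b ->
    (prank b' < prank b)%N.
Proof.
elim=> [r r' s' v p v' m kp vE dm nup upm|r s' v p q mpq [[i ei] IH]].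
  have dE : cpath_d k (gcons v p) = cobar_comp (gen_d k v) (basis p).
    by rewrite cpath_d_cons crit_d // (lin0 (cobar_comp_linr _)) scaler0 addr0.
  pose f0 : factor r s' := existT _ r' (v', m).
  have hf0 : f0 \in factors v by apply/mem_factors.
  rewrite dE; split; first by exists (mdeg v'); exact: (gen_mul_coef p hf0).
  move=> b' /gen_mul_supp[f hf ->] nlow ne.
  have /mem_factors ef := hf.
  apply: prank_top => //=.
  have -> : mcomp v' (mcomp m (pcomp p)) = mcomp v (pcomp p) by rewrite mcompA vE.
  have -> : mcomp (tagged f).1 (mcomp (tagged f).2 (pcomp p)) = mcomp v (pcomp p).
    by rewrite mcompA ef.
  apply: (@phi_lt_partner _ _ _ _ _ _ (pcomp p) _ m) => //.
  - by rewrite -vE -mcompA; apply: coarser_comp.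
  - exact: coarser_comp.
  - by rewrite -ef -mcompA; apply: coarser_comp.
  - case: (pselect (up t (pcomp p) (mcomp (tagged f).2 (pcomp p)))) => [|nup']; first by right.
    left; exists (gen_mor (tagged f).2) => //.
    move: nlow; rewrite /= kp; rewrite asboolF //; case: eqP => // _; by case.
  move=> e; apply: ne; case: f hf ef e {nlow} => r2 [c d] /= hf ef e.
  have er := mor_tgt e; subst r2.
  have ed : d = m by apply: gen_inj; apply: (@mcomp_epi _ _ _ _ _ _ (pcomp p)); apply: val_inj.
  subst d; congr gcons; apply: gen_inj; apply: (@mcomp_epi _ _ _ _ _ _ (gen_mor m)).
  by rewrite ef vE.
have [kp kq cq lq _] := matched_kind mpq.
have nz1 b' : kind_of b' <> Low -> (cobar_comp (gen_d k v) (basis p))@_b' = 0.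
  move=> nlow; apply/eqP/negPn/negP => /gen_mul_supp[f _ eb]; apply: nlow.
  by rewrite eb /= kp.
rewrite cpath_d_cons; split.
  exists (mdeg v - 1 + i); rewrite fcoefD fcoefZ nz1 /= ?kq // add0r gcons_mul_coef ei.
  by rewrite -isignD.
move=> b'; rewrite fcoefD fcoefZ => nz nlow ne.
rewrite nz1 // add0r in nz.
have [q' nq' eb] := gcons_mul_supp (v := v) (x := cpath_d k p) (b := b')
  ltac:(by apply: contraNneq nz => ->; rewrite mulr0).
subst b'; have [cq' lq'] := cpath_d_supp nq'.
rewrite /= cq cq' lq lq' ltn_add2l; apply: IH => //.
  by move=> kq'; apply: nlow; rewrite /= kq'.
by move=> e; apply: ne; rewrite e.
Qed.

Lemma reduce_up t s i (x : cobar_car k t s) : fhomog (@cpath_deg n t s) i x ->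
  exists2 y : cobar_car k t s, fhomog (@cpath_deg n t s) (i + 1) y &
    forall p, (x - cobar_d y)@_p != 0 -> kind_of p <> Up.
Proof.
have [N hN] : exists N, forall p, x@_p != 0 -> kind_of p = Up -> (prank p < N)%N.
  exists (\max_(p <- msupp x) prank p).+1 => p px _; rewrite ltnS.
  by apply: (leq_bigmax_seq (F := fun p => prank p)) => //; rewrite -mcoeff_neq0.
elim: N x hN => [|N IH] x hN hx.
  exists 0; first exact: fhomog0.
  by move=> p; rewrite (lin0 (@cobar_d_linear _ _ _ _)) subr0 => px /(hN p px).
have selE (b : cpath t s) : exists ai : cpath t s * int, kind_of b = Up ->
    matched ai.1 b /\ (cpath_d k ai.1)@_b = isign k ai.2.
  case: (pselect (kind_of b = Up)) => [kb|nb]; last by exists (b, 0).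
  have [a ma] := up_matched kb; have [[j ej] _] := matched_d ma.
  by exists (a, j).
have [sel selP] := choice selE.
pose S := [seq p <- msupp x | `[< kind_of p = Up >] & prank p == N].
have SP p : p \in S -> [/\ x@_p != 0, kind_of p = Up & prank p = N].
  by rewrite mem_filter => /andP[/andP[/asboolP-> /eqP->]]; rewrite -mcoeff_neq0.
have uS : uniq S by rewrite filter_uniq // fset_uniq.
pose y0 : cobar_car k t s := \sum_(p <- S) (isign k (sel p).2 * x@_p) *: basis (sel p).1.
have hy0 : fhomog (@cpath_deg n t s) (i + 1) y0.
  apply: fhomog_sum => p /SP[px kp _]; apply: fhomogZ.
  have [mp _] := selP p kp; have [_ _ _ _ dp] := matched_kind mp.
  rewrite -(hx p) ?mcoeff_neq0 -?mcoeff_neq0 // -dp; exact: (@fhomog_basis k _ (@cpath_deg n t s)).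
have dy0 : cobar_d y0 = \sum_(p <- S) (isign k (sel p).2 * x@_p) *: cpath_d k (sel p).1.
  rewrite (lin_sum (@cobar_d_linear _ _ _ _)); apply: eq_bigr => p _.
  by rewrite (linZ (@cobar_d_linear _ _ _ _)) cobar_d_basis.
have hx' : fhomog (@cpath_deg n t s) i (x - cobar_d y0).
  apply: fhomogB => //; have := dg_d_homog (dgcat_hom (cobar_is_dgcat k n) t s) hy0.
  by rewrite addrK.
have zero p q : p \in S -> kind_of q = Up -> (N <= prank q)%N -> q <> p ->
    (cpath_d k (sel p).1)@_q = 0.
  move=> pS kq rq nqp; have [px kp rp] := SP p pS; have [mp _] := selP p kp.
  apply/eqP/negPn/negP => nz; have [_ lt] := matched_d mp.
  by have := lt q nz ltac:(by rewrite kq) nqp; rewrite rp ltnNge rq.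
have hN' q : (x - cobar_d y0)@_q != 0 -> kind_of q = Up -> (prank q < N)%N.
  move=> nz kq; rewrite ltnNge; apply/negP => rq; move/eqP: nz; apply.
  rewrite fcoefB dy0 fcoef_sum.
  have [qS|nqS] := boolP (q \in S).
    rewrite (bigD1_seq q) //= big1_seq ?addr0 => [|p /andP[pq pS]]; last first.
      by rewrite fcoefZ zero ?mulr0 // => e; rewrite e eqxx in pq.
    have [_ e] := selP q kq.
    by rewrite fcoefZ e mulrAC isign_sqr mul1r subrr.
  rewrite big1_seq ?subr0 => [|p /= pS].
    apply/eqP/negPn/negP => xq; move/negP: nqS; apply.
    rewrite mem_filter -mcoeff_neq0 xq andbT; apply/andP; split; first exact/asboolP.
    by rewrite eqn_leq rq andbT -ltnS; apply: hN.
  by rewrite fcoefZ zero ?mulr0 // => e; rewrite e pS in nqS.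
have [y hy hU] := IH _ hN' hx'.
exists (y0 + y); first exact: fhomogD.
move=> p; rewrite (linD (@cobar_d_linear _ _ _ _)) opprD addrA; exact: hU.
Qed.

Lemma low_cycle t s (x : cobar_car k t s) : (forall p, x@_p != 0 -> kind_of p = Low) ->
  cobar_d x = 0 -> x = 0.
Proof.
move=> hl dx; apply: contrapT => nx.
have selE (a : cpath t s) : exists b : cpath t s, kind_of a = Low -> matched a b.
  case: (pselect (kind_of a = Low)) => [ka|na]; last by exists a.
  by have [b mb] := low_matched ka; exists b.
have [sel selP] := choice selE.
pose P (r : nat) := has (fun a => prank (sel a) == r) (msupp x).
have exP : exists r : nat, P r.
  have [a ax] : exists a, a \in msupp x.
    apply: contrapT => nex; apply: nx; apply: freemodP => p; rewrite fcoef0.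
    by apply/eqP/negPn/negP => px; apply: nex; exists p; rewrite -mcoeff_neq0.
  by exists (prank (sel a)); apply/hasP; exists a.
have bdP (r : nat) : P r -> (r <= \max_(a <- msupp x) prank (sel a))%N.
  by case/hasP => a ax /eqP <-; apply: (leq_bigmax_seq (F := fun a => prank (sel a))).
case: (ex_maxnP exP bdP) => R /hasP[a ax /eqP ra] maxR.
have ka : kind_of a = Low by apply: hl; rewrite mcoeff_neq0.
have ma := selP a ka; have [[i ei] _] := matched_d ma.
have : (cobar_d x)@_(sel a) = 0 by rewrite dx fcoef0.
rewrite {1}[x]basis_sum (lin_sum (@cobar_d_linear _ _ _ _)) fcoef_sum (bigD1_seq a) ?fset_uniq //=.
rewrite big1_seq ?addr0 => [|a' /andP[na a'x]]; last first.
  have ka' : kind_of a' = Low by apply: hl; rewrite mcoeff_neq0.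
  have ma' := selP a' ka'; have [_ lt] := matched_d ma'.
  rewrite (linZ (@cobar_d_linear _ _ _ _)) fcoefZ cobar_d_basis.
  have [->|nz] := eqVneq ((cpath_d k a')@_(sel a)) 0; first by rewrite mulr0.
  have [_ ku _ _ _] := matched_kind ma.
  case: (pselect (sel a = sel a')) => [e|ne].
    by move: ma'; rewrite -e => /(matched_uniq ma) e'; rewrite e' eqxx in na.
  have := lt _ nz ltac:(by rewrite ku) ne; rewrite ra => ltR.
  have : (prank (sel a') <= R)%N by apply: maxR; apply/hasP; exists a'.
  by rewrite leqNgt ltR.
rewrite (linZ (@cobar_d_linear _ _ _ _)) fcoefZ cobar_d_basis ei => e.
have : x@_a = 0 by rewrite -[LHS]mulr1 -(isign_sqr k i) mulrA e mul0r.
by move/eqP; rewrite -[_ == _]negbK mcoeff_neq0 ax.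
Qed.

Lemma crit_aug t s (p : cpath t s) : kind_of p = Crit ->
  exists i, cpath_aug k p = isign k i *: (basis (pcomp p) : omega_hom k t s).
Proof.
elim: p => [|r s' v p IH] => [_|/crit_cons[kp dv _]].
  by exists 0; rewrite isign0 scale1r.
have [i ei] := IH kp; exists ((sgn_odd v : nat)%:Z + i).
rewrite /= ei /gen_aug dv eqxx (linZ (omega_comp_linl _)) (linZ (omega_comp_linr _)).
by rewrite omega_comp_basis scalerA isignD.
Qed.

Lemma crit_aug_inj t s (x : cobar_car k t s) : (forall p, x@_p != 0 -> kind_of p = Crit) ->
  augmentation (x : cobar k n t s) = 0 -> x = 0.
Proof.
move=> hc ax; apply: freemodP => p; rewrite fcoef0.
apply/eqP/negPn/negP => px; have kp := hc p px; have [i ei] := crit_aug kp.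
have : (augmentation (x : cobar k n t s) : freemod k (mor t s))@_(pcomp p) = 0 by rewrite ax fcoef0.
rewrite {1}[x]basis_sum (lin_sum (@aug_linear _ _ _ _)) fcoef_sum (bigD1_seq p) ?fset_uniq -?mcoeff_neq0 //=.
rewrite big1_seq ?addr0 => [|q /andP[qp qx]]; last first.
  have kq : kind_of q = Crit by apply: hc; rewrite mcoeff_neq0.
  have [j ej] := crit_aug kq.
  rewrite (linZ (@aug_linear _ _ _ _)) aug_basis ej scalerA fcoefZ fcoef_basis.
  by case: eqP => [/(crit_uniq kq kp) e|_]; [rewrite e eqxx in qp | rewrite mulr0].
rewrite (linZ (@aug_linear _ _ _ _)) aug_basis ei scalerA fcoefZ fcoef_basis eqxx mulr1 => e.
by move/eqP: px; apply; rewrite -[LHS]mulr1 -(isign_sqr k i) mulrA e mul0r.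
Qed.

Lemma aug_homology_iso t s : homology_iso (@augmentation k n t s).
Proof.
have dE (x : cobar k n t s) : dg_d x = cobar_d x by [].
move=> i; split=> [x y [hx dx] [hy dy] [z0 _ e]|z [hz _]].
  have hxy : fhomog (@cpath_deg n t s) i (x - y) by apply: fhomogB.
  have dxy : cobar_d (x - y) = 0.
    by rewrite (linB (@cobar_d_linear _ _ _ _)) -!dE dx dy subrr.
  have [w hw nup] := reduce_up hxy.
  exists w => //; rewrite dE; apply/eqP; rewrite -subr_eq0; apply/eqP.
  have [_ _ dd] : [/\ True, True & forall w, cobar_d (cobar_d w) = 0 :> cobar_car k t s].
    by split=> // w'; exact: (dg_d_d (dgcat_hom (cobar_is_dgcat k n) t s)).
  have dz : cobar_d (x - y - cobar_d w) = 0.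
    by rewrite (linB (@cobar_d_linear _ _ _ _)) dd dxy subrr.
  have hz : fhomog (@cpath_deg n t s) i (x - y - cobar_d w).
    apply: fhomogB => //; have := dg_d_homog (dgcat_hom (cobar_is_dgcat k n) t s) hw.
    by rewrite addrK.
  have az : augmentation (x - y - cobar_d w : cobar k n t s) = 0.
    have ad : augmentation (cobar_d w : cobar k n t s) = 0.
      exact: (dgmorph_d (dgfunctor_hom (aug_dgfunctor k n) t s) w).
    by rewrite !(linB (@aug_linear _ _ _ _)) ad subr0; exact: e.
  case: (eqVneq i 0) => [i0|ni].
    apply: crit_aug_inj => // p px; have dp := hz p ltac:(by rewrite -mcoeff_neq0).
    have := nup p px; have [_ h] := kind_deg p; case: (kind_of p) h => // h.
    by have := h erefl; rewrite dp i0.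
  apply: low_cycle => // p px; have dp := hz p ltac:(by rewrite -mcoeff_neq0).
  have := nup p px; have [h _] := kind_deg p; case: (kind_of p) h => // h.
  by have := h erefl; rewrite dp => i0; rewrite i0 eqxx in ni.
case: (eqVneq i 0) => [i0|/eqP ni]; last first.
  exists 0; last by exists 0 => //; rewrite (hz ni) (lin0 (@aug_linear _ _ _ _)) subrr.
  by split; [exact: fhomog0 | exact: (lin0 (@cobar_d_linear _ _ _ _))].
have selE (u : mor t s) : exists pj : cpath t s * int, kind_of pj.1 = Crit /\
    cpath_aug k pj.1 = isign k pj.2 *: (basis u : omega_hom k t s).
  have [p kp pu] := crit_ex u; have [j ej] := crit_aug kp; exists (p, j).
  by split; [exact: kp | rewrite -pu; exact: ej].
have [sel selP] := choice selE.
pose zz : freemod k (mor t s) := z.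
pose x : cobar_car k t s := \sum_(u <- msupp zz) (zz@_u * isign k (sel u).2) *: basis (sel u).1.
exists x.
  split.
    apply: fhomog_sum => u _; apply: fhomogZ; have [ku _] := selP u.
    rewrite i0 -(proj1 (kind_deg (sel u).1) ku); exact: (@fhomog_basis k _ (@cpath_deg n t s)).
  rewrite dE (lin_sum (@cobar_d_linear _ _ _ _)) big1 // => u _.
  by rewrite (linZ (@cobar_d_linear _ _ _ _)) cobar_d_basis crit_d ?scaler0 //; case: (selP u).
exists 0 => //=; rewrite [X in _ - X](basis_sum zz) (lin_sum (@aug_linear _ _ _ _)).
apply/eqP; rewrite subr_eq0; apply/eqP; apply: eq_bigr => u _.
have [_ eu] := selP u.
by rewrite (linZ (@aug_linear _ _ _ _)) aug_basis eu scalerA -mulrA isign_sqr mulr1.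
Qed.

End Homology.

Theorem mainTheorem4 (k : comPzRingType) (n : nat) (n_gt0 : (0 < n)%N) :
  [/\ is_dgcat (omega k n),
      is_dgcat (cobar k n),
      quasi_free (cobar k n),
      is_dgfunctor (f0 := id) (@augmentation k n)
    & forall t s : ptree n, homology_iso (@augmentation k n t s)].
Proof.
split; [exact: omega_is_dgcat | exact: cobar_is_dgcat | exact: cobar_quasi_free
       | exact: aug_dgfunctor | exact: aug_homology_iso].
Qed.
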